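(* For all $\gamma>0$, the Laplace transform $$\mathsf{L}:\mathcal{Z}_{\gamma-1/2}\to\mathcal{Z}_{1/2-\gamma},\qquad (\mathsf{L}f)(\lambda)=\int_0^\infty e^{-t\lambda}f(t)\,dt,$$ is an isomorphism (a bijection which is continuous together with its inverse).
   Context: $\mathbb{R}_+=(0,\infty)$. The space $\mathcal{Z}=\mathcal{Z}(\mathbb{R})$ is the subset of the Schwartz space $\mathcal{S}(\mathbb{R})$ consisting of functions $\varphi(x)$ that admit analytic continuation to entire functions satisfying, for all $z\in\mathbb{C}$, the bounds $|\varphi(z)|\le C_\varkappa(1+|z|)^{-\varkappa}e^{r|\operatorname{Im}z|}$ for some $r=r(\varphi)>0$ and all $\varkappa$. By definition, $\varphi_k\to0$ in $\mathcal{Z}$ if all $\varphi_k$ satisfy these bounds with the same constants $r$, $C_\varkappa$ and $\varphi_k\to0$ uniformly on compact subsets of $\mathbb{C}$. (Equivalently, the Fourier transform is an isomorphism of $\mathcal{Z}$ onto $C_0^\infty(\mathbb{R})$.) For $\gamma\in\mathbb{R}$, $\mathcal{Z}_\gamma$ is the space of functions $f$ on $\mathbb{R}_+$ such that the function $x\mapsto e^{(1/2-\gamma)x}f(e^x)$ belongs to $\mathcal{Z}$, i.e. $f(t)=t^{\gamma-1/2}F(\ln t)$ with $F\in\mathcal{Z}$; its topology is the one induced by that of $\mathcal{Z}$ via $f\mapsto F$. The function $\mathsf{L}f$ is considered on $\mathbb{R}_+$. *)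

(* Defs.v *)
From HB Require Import structures.
From mathcomp Require Import all_boot all_order all_algebra.
From mathcomp Require Import all_classical all_reals all_analysis.
From mathcomp Require Import complex.
Import Order.TTheory GRing.Theory Num.Theory numFieldNormedType.Exports.

Set Implicit Arguments.
Unset Strict Implicit.
Unset Printing Implicit Defensive.

Local Open Scope classical_set_scope.
Local Open Scope ring_scope.
Local Open Scope complex_scope.

(* [ `|z| ] takes its values in R[i]; this is the modulus as an element of R. *)
Definition cmod (R : realType) (z : R[i]) : R := ComplexField.Normc.normc z.

(* R[i] is normed (over itself) through its alias R[i]^o, so [derivable] is
   complex differentiability. *)
Definition entire (R : realType) (Phi : R[i]^o -> R[i]^o) : Prop :=
  forall z : R[i]^o, derivable Phi z 1.

Definition real_schwartz (R : realType) (u : R -> R) : Prop :=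
  (forall (n : nat) (x : R), derivable (derive1n n u) x 1) /\
  (forall m n : nat, exists M : R, forall x : R, `|x ^+ m * derive1n n u x| <= M).

Definition schwartz (R : realType) (phi : R -> R[i]) : Prop :=
  real_schwartz (fun x => complex.Re (phi x)) /\
  real_schwartz (fun x => complex.Im (phi x)).

Definition entire_continuation (R : realType)
    (phi : R -> R[i]) (Phi : R[i]^o -> R[i]^o) : Prop :=
  entire Phi /\ (forall x : R, Phi x%:C = phi x).

Definition Z_bounds (R : realType) (r : R) (C : R -> R)
    (Phi : R[i]^o -> R[i]^o) : Prop :=
  forall (kappa : R) (z : R[i]),
    cmod (Phi z) <=
      C kappa * (1 + cmod z) `^ (- kappa) * expR (r * `|complex.Im z|).

Definition Zspace (R : realType) : set (R -> R[i]) :=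
  [set phi | schwartz phi /\
     exists Phi, entire_continuation phi Phi /\
     exists r C, 0 < r /\ Z_bounds r C Phi].

(* The continuations [Phi k] are unique, by the identity theorem. *)
Definition Z_cvg0 (R : realType) (phi : nat -> R -> R[i]) : Prop :=
  exists (Phi : nat -> R[i]^o -> R[i]^o) (r : R) (C : R -> R),
    [/\ 0 < r,
        forall k, entire_continuation (phi k) (Phi k),
        forall k, Z_bounds r C (Phi k)
      & forall K : set R[i]^o, compact K ->
          {uniform K, Phi @ \oo --> (cst 0 : R[i]^o -> R[i]^o)}].

Definition Rpos (R : realType) : set R := `]0, +oo[.
Arguments Rpos R : clear implicits.

Definition ext0 (R : realType) (f : Rpos R -> R[i]) : R -> R[i] :=
  'valL_(0 : R[i]) f.

(* The F with f(t) = t^(gamma - 1/2) F(ln t). *)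
Definition log_profile (R : realType) (gamma : R) (f : Rpos R -> R[i]) :
    R -> R[i] :=
  fun x => (expR ((2^-1 - gamma) * x))%:C * ext0 f (expR x).

Definition Zgamma (R : realType) (gamma : R) : set (Rpos R -> R[i]) :=
  [set f | Zspace (log_profile gamma f)].

Definition Zgamma_cvg (R : realType) (gamma : R)
    (f_ : nat -> Rpos R -> R[i]) (f : Rpos R -> R[i]) : Prop :=
  Z_cvg0 (fun k x => log_profile gamma (f_ k) x - log_profile gamma f x).

Definition cintegral (R : realType) (D : set R) (g : R -> R[i]) : R[i] :=
  (\int[lebesgue_measure]_(t in D) complex.Re (g t)) +i*
  (\int[lebesgue_measure]_(t in D) complex.Im (g t)).

Definition laplace (R : realType) (f : Rpos R -> R[i]) : Rpos R -> R[i] :=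
  fun lambda =>
    cintegral (Rpos R) (fun t => (expR (- (t * val lambda)))%:C * ext0 f t).

(* The topology of Z is given by its convergent sequences, so continuity is
   sequential continuity. *)
Definition seq_continuous_on (S T : Type) (A : set S)
    (cvgS : (nat -> S) -> S -> Prop) (cvgT : (nat -> T) -> T -> Prop)
    (h : S -> T) : Prop :=
  forall (f_ : nat -> S) (f : S), (forall k, A (f_ k)) -> A f ->
    cvgS f_ f -> cvgT (fun k => h (f_ k)) (h f).

Definition isomorphism (S T : Type) (A : set S) (B : set T)
    (cvgS : (nat -> S) -> S -> Prop) (cvgT : (nat -> T) -> T -> Prop)
    (h : S -> T) : Prop :=
  [/\ set_bij A B h,
      seq_continuous_on A cvgS cvgT h
    & exists g : T -> S,
        [/\ set_fun B A g, {in A, cancel h g}, {in B, cancel g h}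
          & seq_continuous_on B cvgT cvgS g]].

(* Main.v *)
(* For f(t) = t^(gamma-1) F(ln t), the substitution t = e^(u-y) turns Lf into the
   convolution of the reflection of F with e^(gamma u - e^u), that is, into the
   Fourier multiplier Gamma(gamma - i xi). It is inverted by the Euler product of
   1/Gamma, read as an infinite product of the operators 1 - D/(gamma+n), each
   followed by the translation by ln(1 + 1/(gamma+n)). By Cauchy's estimate, D is
   bounded for every weighted norm sup |Phi(z)| (1+|z|)^k e^(-r|Im z|), so a factor
   differs from the identity by O(1/(gamma+n)^2) and the product converges in all
   these norms. Integration by parts shows that the n-th partial product applied to
   the convolution with parameter gamma is the convolution with parameter gamma+n,
   which tends to the identity because the logarithm of a Gamma(s) random variable
   concentrates about ln s. Hence the product is a two-sided inverse, bounded for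
   the same norms (this is the Post-Widder inversion of the Laplace transform). *)

(* On the Fourier side the inverse multiplies by 1/Gamma(gamma - i xi), which grows exponentially in
   xi; it acts on this space because the Fourier transforms have compact support. The holomorphic
   counterpart of that support is the exponential type r: on functions of type r, D has a finite
   norm that depends only on r and on the weight exponent k. All estimates therefore preserve r and
   treat each k separately. In terms of D, a factor of the product is (1 - D/s) exp(D ln(1 + 1/s))
   with s = gamma + n; the translation is there to cancel the first-order term. Limits are taken in
   the norm for k = 0: real translations leave that weight unchanged, and under uniform bounds for k
   = 1 locally uniform convergence is the same as convergence in it. The bounds for the other k then
   pass to pointwise limits. Uniqueness is read on the real line: at real points, the convolution
   and the factors of the product depend only on the values of their argument at real points. *)
Require Import Defs.
From mathcomp Require Import all_boot all_order all_algebra.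
From mathcomp Require Import all_classical all_reals all_analysis.
From mathcomp Require Import complex ring lra measurable_realfun.
Import Order.TTheory GRing.Theory Num.Theory numFieldNormedType.Exports.

Set Implicit Arguments.
Unset Strict Implicit.
Unset Printing Implicit Defensive.

Local Open Scope classical_set_scope.
Local Open Scope ring_scope.
Local Open Scope complex_scope.

(** * Complex differentiation *)

Section complex_modulus.
Variable R : realType.
Implicit Types (z w : R[i]) (x y : R).

Lemma cmod_ge0 z : 0 <= cmod z.
Proof. by case: z => a b; rewrite /cmod /= sqrtr_ge0. Qed.

Lemma cmodD z w : cmod (z + w) <= cmod z + cmod w.
Proof. exact: le_normcD. Qed.

Lemma cmodN z : cmod (- z) = cmod z.
Proof. exact: normcN. Qed.

Lemma cmodM z w : cmod (z * w) = cmod z * cmod w.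
Proof. exact: ComplexField.Normc.normcM. Qed.

Lemma cmodV z : cmod z^-1 = (cmod z)^-1.
Proof. exact: ComplexField.Normc.normcV. Qed.

Lemma cmod0 : cmod (0 : R[i]) = 0.
Proof. exact: ComplexField.Normc.normc0. Qed.

Lemma cmod1 : cmod (1 : R[i]) = 1.
Proof. exact: ComplexField.Normc.normc1. Qed.

Lemma cmod_eq0 z : (cmod z == 0) = (z == 0).
Proof.
apply/eqP/eqP => [/ComplexField.Normc.eq0_normc//|->]; exact: cmod0.
Qed.

Lemma cmod_gt0 z : (0 < cmod z) = (z != 0).
Proof. by rewrite lt_neqAle cmod_ge0 andbT eq_sym cmod_eq0. Qed.

Lemma cmodBC z w : cmod (z - w) = cmod (w - z).
Proof. by rewrite -cmodN opprB. Qed.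

Lemma cmod_real x : cmod x%:C = `|x|.
Proof. by rewrite /cmod /= expr0n /= addr0 sqrtr_sqr. Qed.

Lemma cmod_i : cmod ('i : R[i]) = 1.
Proof. by rewrite /cmod /= expr0n /= add0r expr1n sqrtr1. Qed.

Lemma normRe_cmod z : `|complex.Re z| <= cmod z.
Proof.
case: z => a b; rewrite /cmod /= -sqrtr_sqr ler_wsqrtr//.
by rewrite lerDl sqr_ge0.
Qed.

Lemma normIm_cmod z : `|complex.Im z| <= cmod z.
Proof.
case: z => a b; rewrite /cmod /= -sqrtr_sqr ler_wsqrtr//.
by rewrite lerDr sqr_ge0.
Qed.

Lemma cmod_ReIm z : cmod z <= `|complex.Re z| + `|complex.Im z|.
Proof.
case: z => a b /=; rewrite /cmod /= -[leRHS]ger0_norm ?addr_ge0//.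
rewrite -sqrtr_sqr ler_wsqrtr// sqrrD !real_normK ?num_real//.
by rewrite -addrA lerD2l addrC lerDl mulrn_wge0// mulr_ge0.
Qed.

Lemma lerB_cmod z w : cmod z - cmod w <= cmod (z - w).
Proof. by rewrite lerBlDr (le_trans _ (cmodD _ _))// subrK. Qed.

Lemma cReD z w : complex.Re (z + w) = complex.Re z + complex.Re w.
Proof. by case: z; case: w. Qed.
Lemma cImD z w : complex.Im (z + w) = complex.Im z + complex.Im w.
Proof. by case: z; case: w. Qed.
Lemma cReN z : complex.Re (- z) = - complex.Re z.
Proof. by case: z. Qed.
Lemma cImN z : complex.Im (- z) = - complex.Im z.
Proof. by case: z. Qed.
Lemma cReM z w : complex.Re (z * w) =
  complex.Re z * complex.Re w - complex.Im z * complex.Im w.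
Proof. by case: z; case: w. Qed.
Lemma cImM z w : complex.Im (z * w) =
  complex.Re z * complex.Im w + complex.Im z * complex.Re w.
Proof. by case: z; case: w. Qed.

Lemma complexP z w : complex.Re z = complex.Re w ->
  complex.Im z = complex.Im w -> z = w.
Proof. by case: z => a b; case: w => c d /= -> ->. Qed.

Lemma normcE_cmod z : `|z : R[i]^o| = (cmod z)%:C.
Proof. by []. Qed.

Lemma realcD x y : (x + y)%:C = x%:C + y%:C :> R[i].
Proof. exact: rmorphD. Qed.
Lemma realcM x y : (x * y)%:C = x%:C * y%:C :> R[i].
Proof. exact: rmorphM. Qed.
Lemma realcN x : (- x)%:C = - x%:C :> R[i].
Proof. exact: rmorphN. Qed.

End complex_modulus.

(** The bound uses real [e] and [del] because the norm of [R[i]^o] takes its values in [R[i]]. It is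
    multiplied out so that [h = 0] is allowed, and the value [d] is explicit so that estimates can
    name it. *)
Definition cder (R : realType) (f : R[i] -> R[i]) (z d : R[i]) : Prop :=
  forall e : R, 0 < e -> exists2 del : R, 0 < del &
    forall h : R[i], cmod h < del -> cmod (f (z + h) - f z - d * h) <= e * cmod h.

Definition ccont_at (R : realType) (f : R[i] -> R[i]) (z : R[i]) : Prop :=
  forall e : R, 0 < e -> exists2 del : R, 0 < del &
    forall h, cmod h < del -> cmod (f (z + h) - f z) <= e.

Definition ccont (R : realType) (f : R[i] -> R[i]) : Prop :=
  forall z, ccont_at f z.

Section cder_theory.
Variable R : realType.
Implicit Types (z w d : R[i]) (f g : R[i] -> R[i]).

(** Gives access to the differentiation rules of [is_derive], while the estimates are made with
    [cder]. *)
Lemma is_cder f z d :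
  is_derive (z : R[i]^o) 1 (f : R[i]^o -> R[i]^o) d <-> cder f z d.
Proof.
split.
  move=> [fz fzd] e e0.
  have /cvgrPdist_le fd :
      (fun h : R[i]^o => h^-1 *: ((f : R[i]^o -> R[i]^o) (h *: (1 : R[i]^o) + z) - f z))
        @ (0 : R[i]^o)^' --> (d : R[i]^o).
    by rewrite -fzd; exact: fz.
  have e0C : (0 : R[i]) < e%:C by rewrite ltcR.
  have := fd _ e0C; rewrite near_withinE => /nbhs_ballP[/= del del0 H].
  have [dr rd] : exists r : R, del = r%:C.
    by exists (complex.Re del); rewrite RRe_real// gtr0_real.
  exists dr; first by rewrite -ltcR -rd.
  move=> h hdr.
  have [->|h0] := eqVneq h 0.
    by rewrite addr0 subrr mulr0 subrr cmod0 mulr0.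
  have /= := H h.
  rewrite -ball_normE /= sub0r normrN rd => /(_ _ h0).
  rewrite normcE_cmod ltcR => /(_ hdr).
  rewrite normcE_cmod lecR -(ler_pM2r (_ : 0 < cmod h)) ?cmod_gt0//.
  rewrite -cmodM; suff -> : (d - h^-1 *: (f (h%:A + z) - f z)) * h =
    - (f (z + h) - f z - d * h) by rewrite cmodN.
  rewrite /GRing.scale /= mulr1 [h + z]addrC mulrBl.
  by rewrite [_^-1 * _ * _]mulrC mulrA mulfV// mul1r [RHS]opprB.
move=> fzd.
have H :
    (fun h : R[i]^o => h^-1 *: ((f : R[i]^o -> R[i]^o) (h *: (1 : R[i]^o) + z) - f z))
      @ (0 : R[i]^o)^' --> (d : R[i]^o).
  apply/cvgrPdist_le => e e0.
  have [er re] : exists r : R, e = r%:C.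
    by exists (complex.Re e); rewrite RRe_real// gtr0_real.
  have er0 : 0 < er by rewrite -ltcR -re.
  have [del del0 H] := fzd _ er0.
  rewrite near_withinE; apply/nbhs_ballP; exists del%:C; first by rewrite /= ltcR.
  move=> h /=; rewrite -ball_normE /= sub0r normrN normcE_cmod ltcR => hd h0.
  rewrite normcE_cmod re lecR -(ler_pM2r (_ : 0 < cmod h)) ?cmod_gt0//.
  rewrite -cmodM; suff -> : (d - h^-1 *: (f (h%:A + z) - f z)) * h =
    - (f (z + h) - f z - d * h) by rewrite cmodN; exact: H.
  rewrite /GRing.scale /= mulr1 [h + z]addrC mulrBl.
  by rewrite [_^-1 * _ * _]mulrC mulrA mulfV// mul1r [RHS]opprB.
split.
  by apply/cvg_ex; exists d.
by apply: cvg_lim => //.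
Qed.

Lemma entireP f : entire f <-> forall z, exists d, cder f z d.
Proof.
split=> [ef z|H z].
  exists ('D_1 (f : R[i]^o -> R[i]^o) z); apply/is_cder; exact/derivableP/ef.
by have [d /is_cder[]] := H z.
Qed.

Lemma cder_cont f z d : cder f z d -> ccont_at f z.
Proof.
move=> fd e e0; have [del del0 H] := fd _ ltr01.
have k0 : 0 < 1 + cmod d by rewrite ltr_pwDl// cmod_ge0.
exists (Num.min del (e / (1 + cmod d))); first by rewrite lt_min del0 divr_gt0.
move=> h; rewrite lt_min => /andP[hd he].
have -> : f (z + h) - f z = (f (z + h) - f z - d * h) + d * h by rewrite subrK.
apply: (le_trans (cmodD _ _)); rewrite cmodM.
apply: (@le_trans _ _ ((1 + cmod d) * cmod h)).
  by rewrite mulrDl lerD2r; exact: H.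
by rewrite mulrC -ler_pdivlMr// ltW.
Qed.

Lemma cder_cst c z : cder (cst c) z 0.
Proof.
by move=> e e0; exists 1 => // h _; rewrite subrr mul0r subrr cmod0 mulr_ge0 ?cmod_ge0// ltW.
Qed.

Lemma cderM f g z d1 d2 : cder f z d1 -> cder g z d2 ->
  cder (fun w => f w * g w) z (f z * d2 + g z * d1).
Proof. by move=> /is_cder ? /is_cder ?; apply/is_cder; exact: is_deriveM. Qed.

Lemma cderZ c f z d : cder f z d -> cder (fun w => c * f w) z (c * d).
Proof.
by move=> fd; have := cderM (@cder_cst c z) fd; rewrite mulr0 addr0.
Qed.

Lemma cderB f g z d1 d2 : cder f z d1 -> cder g z d2 ->
  cder (fun w => f w - g w) z (d1 - d2).
Proof. by move=> /is_cder ? /is_cder ?; apply/is_cder; exact: is_deriveB. Qed.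

Lemma cder_id z : cder id z 1.
Proof. by apply/is_cder; exact: is_derive_id. Qed.

Lemma cderV f z d : f z != 0 -> cder f z d -> exists d', cder (fun w => (f w)^-1) z d'.
Proof.
move=> fz0 /is_cder[fd _]; eexists; apply/is_cder; apply: derivableP.
exact: (@derivableV _ _ (f : R[i]^o -> R[i]) z 1 fz0 fd).
Qed.

Lemma cder_shift f z a d : cder f (z + a) d -> cder (fun w => f (w + a)) z d.
Proof.
move=> fd e /fd[del del0 H]; exists del => // h /H.
by rewrite -!addrA (addrC a).
Qed.

Lemma cder_refl f z a d : cder f (a - z) d -> cder (fun w => f (a - w)) z (- d).
Proof.
move=> fd e /fd[del del0 H]; exists del => // h; rewrite -cmodN => /H.
by rewrite opprD addrA cmodN mulNr mulrN.
Qed.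

End cder_theory.

(** * Complex-valued integrals *)

Definition rcont (R : realType) (g : R -> R[i]) (t : R) : Prop :=
  forall e : R, 0 < e -> exists2 del : R, 0 < del &
    forall s : R, `|s| < del -> cmod (g (t + s) - g t) <= e.

Definition cintegrable (R : realType) (D : set R) (g : R -> R[i]) : Prop :=
  (@lebesgue_measure R).-integrable D (EFin \o (fun t => complex.Re (g t))) /\
  (@lebesgue_measure R).-integrable D (EFin \o (fun t => complex.Im (g t))).

Section complex_integral.
Variable R : realType.
Notation mu := (@lebesgue_measure R).
Implicit Types (g : R -> R[i]) (D : set R).

Lemma eq_rintegrable D (f h : R -> R) : @measurable _ (measurableTypeR R) D ->
  (forall t, D t -> f t = h t) ->
  mu.-integrable D (EFin \o f) -> mu.-integrable D (EFin \o h).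
Proof.
move=> mD fh; apply: eq_integrable => // t /=.
by rewrite inE => /fh ->.
Qed.

Lemma rintegrableD D (f h : R -> R) : @measurable _ (measurableTypeR R) D ->
  mu.-integrable D (EFin \o f) -> mu.-integrable D (EFin \o h) ->
  mu.-integrable D (EFin \o (fun t => f t + h t)).
Proof. by move=> mD fi hi; exact: (integrableD mD fi hi). Qed.

Lemma rintegrableZ D k (f : R -> R) : @measurable _ (measurableTypeR R) D ->
  mu.-integrable D (EFin \o f) ->
  mu.-integrable D (EFin \o (fun t => k * f t)).
Proof. by move=> mD fi; exact: (integrableZl mD k fi). Qed.

Lemma rintegrableB D (f h : R -> R) : @measurable _ (measurableTypeR R) D ->
  mu.-integrable D (EFin \o f) -> mu.-integrable D (EFin \o h) ->
  mu.-integrable D (EFin \o (fun t => f t - h t)).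
Proof. by move=> mD fi hi; exact: (integrableB mD fi hi). Qed.

Lemma le_rintegrable D (f h : R -> R) : @measurable _ (measurableTypeR R) D ->
  measurable_fun D f ->
  (forall t, D t -> `|f t| <= h t) ->
  mu.-integrable D (EFin \o h) -> mu.-integrable D (EFin \o f).
Proof.
move=> mD mf fh; apply: le_integrable => //=; first exact/measurable_EFinP.
by move=> t Dt; rewrite lee_fin (le_trans (fh _ Dt))// ler_norm.
Qed.

Lemma rcont_ReIm g t : rcont g t ->
  {for t, continuous (fun t => complex.Re (g t))} /\
  {for t, continuous (fun t => complex.Im (g t))}.
Proof.
move=> gt; split; apply/cvgrPdist_le => e e0; have [del del0 H] := gt _ e0;
  apply/nbhs_ballP; exists del => //= s; rewrite /ball/= distrC => ts;
  have := H (s - t) ts; rewrite [t + _]addrC subrK; apply: le_trans;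
  rewrite distrC.
- by rewrite -cReN -cReD normRe_cmod.
- by rewrite -cImN -cImD normIm_cmod.
Qed.

Lemma cder_line_rcont (f : R[i] -> R[i]) (a b d : R[i]) (t : R) :
  cder f (a + b * t%:C) d -> rcont (fun t => f (a + b * t%:C)) t.
Proof.
move=> /cder_cont H e /H[del del0 {}H].
have b0 : 0 < cmod b + 1 by rewrite ltr_wpDl// cmod_ge0.
exists (del / (cmod b + 1)); first by rewrite divr_gt0.
move=> s; rewrite ltr_pdivlMr// => sd.
rewrite realcD mulrDr addrA; apply: H; rewrite cmodM cmod_real.
by rewrite (le_lt_trans _ sd)// mulrC ler_wpM2l// lerDl.
Qed.

Lemma rcont_cintegrable_itv g a b :
  (forall t, a <= t <= b -> rcont g t) -> cintegrable `[a, b] g.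
Proof.
move=> gc; split; apply: continuous_compact_integrable;
  try exact: segment_compact; apply: continuous_in_subspaceT => t;
  rewrite inE /= in_itv /= => /gc/rcont_ReIm[].
- by [].
- by [].
Qed.

Lemma rcont_measurable g : (forall t, rcont g t) ->
  measurable_fun setT (fun t => complex.Re (g t)) /\
  measurable_fun setT (fun t => complex.Im (g t)).
Proof.
by move=> gc; split; apply: continuous_measurable_fun => t;
  have [] := rcont_ReIm (gc t).
Qed.

Lemma cintegrableD D g1 g2 : @measurable _ (measurableTypeR R) D ->
  cintegrable D g1 -> cintegrable D g2 ->
  cintegrable D (fun t => g1 t + g2 t).
Proof.
move=> mD [r1 i1] [r2 i2]; split.
- by apply: eq_rintegrable (rintegrableD mD r1 r2) => // t _; rewrite cReD.
- by apply: eq_rintegrable (rintegrableD mD i1 i2) => // t _; rewrite cImD.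
Qed.

Lemma cintegrableZ D c g : @measurable _ (measurableTypeR R) D ->
  cintegrable D g -> cintegrable D (fun t => c * g t).
Proof.
move=> mD [r i]; split.
- apply: eq_rintegrable (rintegrableB mD (rintegrableZ (complex.Re c) mD r)
    (rintegrableZ (complex.Im c) mD i)) => // t _.
  by rewrite cReM.
- apply: eq_rintegrable (rintegrableD mD (rintegrableZ (complex.Re c) mD i)
    (rintegrableZ (complex.Im c) mD r)) => // t _.
  by rewrite cImM.
Qed.

Lemma cintegrableB D g1 g2 : @measurable _ (measurableTypeR R) D ->
  cintegrable D g1 -> cintegrable D g2 ->
  cintegrable D (fun t => g1 t - g2 t).
Proof.
move=> mD h1 /(cintegrableZ (-1) mD) h2.
have := cintegrableD mD h1 h2.
by congr (cintegrable _ _); apply/funext => t; rewrite mulN1r.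
Qed.

Lemma eq_cintegral D g1 g2 : (forall t, D t -> g1 t = g2 t) ->
  cintegral D g1 = cintegral D g2.
Proof.
move=> g12; rewrite /cintegral; congr (_ +i* _); apply: eq_Rintegral => t;
  by rewrite inE => /g12 ->.
Qed.

Lemma cintegralD D g1 g2 : @measurable _ (measurableTypeR R) D ->
  cintegrable D g1 -> cintegrable D g2 ->
  cintegral D (fun t => g1 t + g2 t) = cintegral D g1 + cintegral D g2.
Proof.
move=> mD [r1 i1] [r2 i2]; rewrite /cintegral; apply: complexP => /=.
- by rewrite -RintegralD//; apply: eq_Rintegral => t _; rewrite cReD.
- by rewrite -RintegralD//; apply: eq_Rintegral => t _; rewrite cImD.
Qed.

Lemma cintegralZ D c g : @measurable _ (measurableTypeR R) D -> cintegrable D g ->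
  cintegral D (fun t => c * g t) = c * cintegral D g.
Proof.
move=> mD [r i]; apply: complexP; rewrite ?(cReM, cImM) /=.
- rewrite -!RintegralZl// -RintegralB//.
  + by apply: eq_Rintegral => t _; rewrite cReM.
  + exact: (rintegrableZ _ mD r).
  + exact: (rintegrableZ _ mD i).
- rewrite -!RintegralZl// -RintegralD//.
  + by apply: eq_Rintegral => t _; rewrite cImM.
  + exact: (rintegrableZ _ mD i).
  + exact: (rintegrableZ _ mD r).
Qed.

Lemma cintegralB D g1 g2 : @measurable _ (measurableTypeR R) D ->
  cintegrable D g1 -> cintegrable D g2 ->
  cintegral D (fun t => g1 t - g2 t) = cintegral D g1 - cintegral D g2.
Proof.
move=> mD h1 h2; rewrite -(mulN1r (cintegral D g2)) -cintegralZ//.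
rewrite -cintegralD//; last exact: cintegrableZ.
by apply: eq_cintegral => t _; rewrite mulN1r.
Qed.

(** The integral is defined componentwise, so each component is bounded separately; this is one
    source of the factors 2 in later constants. *)
Lemma cmod_cintegral_le D g (h : R -> R) : @measurable _ (measurableTypeR R) D -> cintegrable D g ->
  mu.-integrable D (EFin \o h) -> (forall t, D t -> cmod (g t) <= h t) ->
  cmod (cintegral D g) <= 2 * \int[mu]_(t in D) h t.
Proof.
move=> mD [r i] hi gh; apply: (le_trans (cmod_ReIm _)) => /=.
rewrite mulrDl !mul1r lerD//.
- apply: (le_trans (le_normr_Rintegral mD r)); apply: le_Rintegral => //.
    exact: integrable_norm.
  by move=> t Dt; rewrite (le_trans (normRe_cmod _))// gh.
- apply: (le_trans (le_normr_Rintegral mD i)); apply: le_Rintegral => //.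
    exact: integrable_norm.
  by move=> t Dt; rewrite (le_trans (normIm_cmod _))// gh.
Qed.

Lemma itv_integrable_cst (a b k : R) : mu.-integrable `[a, b] (EFin \o cst k).
Proof.
apply: continuous_compact_integrable; first exact: segment_compact.
by apply: continuous_subspaceT => ?; exact: cst_continuous.
Qed.

Lemma Rintegral_itv_cst (a b k : R) : a <= b ->
  \int[mu]_(t in `[a, b]) k = k * (b - a).
Proof.
move=> ab; rewrite Rintegral_cst//= lebesgue_measure_itv/= lte_fin.
by move: ab; rewrite le_eqVlt => /predU1P[->|->//]; rewrite ltxx subrr.
Qed.

Lemma cintegral_itv_cst (a b : R) (c : R[i]) : a <= b ->
  cintegral `[a, b] (fun=> c) = c * (b - a)%:C.
Proof.
move=> ab; apply: complexP => /=; rewrite ?(cReM, cImM)/= Rintegral_itv_cst//.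
- by rewrite mulr0 subr0.
- by rewrite mulr0 add0r.
Qed.

Lemma cmod_cintegral_itv_le g (a b M : R) : a <= b ->
  cintegrable `[a, b] g -> (forall t, a <= t <= b -> cmod (g t) <= M) ->
  cmod (cintegral `[a, b] g) <= 2 * M * (b - a).
Proof.
move=> ab gi gM.
rewrite -mulrA -(Rintegral_itv_cst M ab); apply: cmod_cintegral_le => //.
exact: itv_integrable_cst.
Qed.

Lemma cintegral_itv_split g (a b c : R) : a <= b <= c ->
  cintegrable `[a, c] g ->
  cintegral `[a, c] g = cintegral `[a, b] g + cintegral `[b, c] g.
Proof.
move=> /andP[ab bc] [r i].
have sub : [set` `]b, c]] `<=` [set` `[a, c]].
  by apply: subset_itv; rewrite bnd_simp.
apply: complexP => /=; apply/eqP; rewrite addrC -subr_eq; apply/eqP.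
- rewrite (@Rintegral_itvB _ _ (BLeft a) (BRight c) b)// ?bnd_simp//.
  by rewrite Rintegral_itv_obnd_cbnd//; exact: integrableS r.
- rewrite (@Rintegral_itvB _ _ (BLeft a) (BRight c) b)// ?bnd_simp//.
  by rewrite Rintegral_itv_obnd_cbnd//; exact: integrableS i.
Qed.

End complex_integral.

(** * Goursat's theorem and Cauchy's estimates *)

(** The counterclockwise contour integral around the rectangle, with opposite edges paired into one
    integrand, so that constants cancel inside the integrals. *)
Definition rect_integral (R : realType) (f : R[i] -> R[i]) (x1 x2 y1 y2 : R) :=
  cintegral `[x1, x2] (fun t => f (t +i* y1) - f (t +i* y2)) +
  'i * cintegral `[y1, y2] (fun t => f (x2 +i* t) - f (x1 +i* t)).

Definition rect_holo (R : realType) (f : R[i] -> R[i]) (x1 x2 y1 y2 : R) :=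
  forall x y, x1 <= x <= x2 -> y1 <= y <= y2 -> exists d, cder f (x +i* y) d.

Section goursat.
Variable R : realType.
Implicit Types f : R[i] -> R[i].

Let hcont f y x1 x2 := forall t, x1 <= t <= x2 -> rcont (fun t => f (t +i* y)) t.
Let vcont f x y1 y2 := forall t, y1 <= t <= y2 -> rcont (fun t => f (x +i* t)) t.

Lemma ccont_at_hcont f (t y : R) : ccont_at f (t +i* y) -> rcont (fun t => f (t +i* y)) t.
Proof.
move=> H e /H[del del0 {}H]; exists del => // s sd.
have := H s%:C; rewrite cmod_real => /(_ sd).
by congr (cmod (f _ - _) <= _); apply: complexP => //=; rewrite addr0.
Qed.

Lemma cder_hcont f (t y : R) d : cder f (t +i* y) d ->
  rcont (fun t => f (t +i* y)) t.
Proof. by move=> /cder_cont/ccont_at_hcont. Qed.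

Lemma ccont_at_vcont f (x t : R) : ccont_at f (x +i* t) -> rcont (fun t => f (x +i* t)) t.
Proof.
move=> H e /H[del del0 {}H]; exists del => // s sd.
have := H ('i * s%:C); rewrite cmodM cmod_real cmod_i mul1r => /(_ sd).
congr (cmod (f _ - _) <= _); apply: complexP => //=; ring.
Qed.

Lemma cder_vcont f (x t : R) d : cder f (x +i* t) d ->
  rcont (fun t => f (x +i* t)) t.
Proof. by move=> /cder_cont/ccont_at_vcont. Qed.

Lemma rect_holo_hcont f x1 x2 y1 y2 y : rect_holo f x1 x2 y1 y2 ->
  y1 <= y <= y2 -> hcont f y x1 x2.
Proof. by move=> fh yy t tx; have [d /cder_hcont] := fh _ _ tx yy. Qed.

Lemma rect_holo_vcont f x1 x2 y1 y2 x : rect_holo f x1 x2 y1 y2 ->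
  x1 <= x <= x2 -> vcont f x y1 y2.
Proof. by move=> fh xx t ty; have [d /cder_vcont] := fh _ _ xx ty. Qed.

Lemma rect_integral_hsplit f x1 m x2 y1 y2 : x1 <= m <= x2 ->
  hcont f y1 x1 x2 -> hcont f y2 x1 x2 ->
  vcont f x1 y1 y2 -> vcont f m y1 y2 -> vcont f x2 y1 y2 ->
  rect_integral f x1 x2 y1 y2 =
  rect_integral f x1 m y1 y2 + rect_integral f m x2 y1 y2.
Proof.
move=> xm h1 h2 v1 vm v2; rewrite /rect_integral.
rewrite (cintegral_itv_split xm); last first.
  by apply: cintegrableB => //; apply: rcont_cintegrable_itv.
rewrite !(@cintegralB _ [set` `[y1, y2]])//;
  try by apply: rcont_cintegrable_itv.
ring.
Qed.

Lemma rect_integral_vsplit f x1 x2 y1 m y2 : y1 <= m <= y2 ->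
  vcont f x1 y1 y2 -> vcont f x2 y1 y2 ->
  hcont f y1 x1 x2 -> hcont f m x1 x2 -> hcont f y2 x1 x2 ->
  rect_integral f x1 x2 y1 y2 =
  rect_integral f x1 x2 y1 m + rect_integral f x1 x2 m y2.
Proof.
move=> ym v1 v2 h1 hm h2; rewrite /rect_integral.
rewrite (cintegral_itv_split ym); last first.
  by apply: cintegrableB => //; apply: rcont_cintegrable_itv.
rewrite !(@cintegralB _ [set` `[x1, x2]])//;
  try by apply: rcont_cintegrable_itv.
ring.
Qed.

Lemma rect_integral_quarter f x1 xm x2 y1 ym y2 : x1 <= xm <= x2 ->
  y1 <= ym <= y2 -> rect_holo f x1 x2 y1 y2 ->
  rect_integral f x1 x2 y1 y2 =
  rect_integral f x1 xm y1 ym + rect_integral f x1 xm ym y2 +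
  (rect_integral f xm x2 y1 ym + rect_integral f xm x2 ym y2).
Proof.
move=> xin yin fh.
have /andP[xl xr] := xin; have /andP[yl yr] := yin.
have xx := le_trans xl xr; have yy := le_trans yl yr.
have hc v a b : y1 <= v -> v <= y2 -> x1 <= a -> b <= x2 -> hcont f v a b.
  move=> v1 v2 xa bx t /andP[at_ tb]; apply: (rect_holo_hcont fh).
    exact/andP.
  by rewrite (le_trans xa at_) (le_trans tb bx).
have vc u a b : x1 <= u -> u <= x2 -> y1 <= a -> b <= y2 -> vcont f u a b.
  move=> v1 v2 xa bx t /andP[at_ tb]; apply: (rect_holo_vcont fh).
    exact/andP.
  by rewrite (le_trans xa at_) (le_trans tb bx).
rewrite (rect_integral_hsplit xin); try (by [apply: hc|apply: vc]).
rewrite !(rect_integral_vsplit yin); by [apply: hc|apply: vc|].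
Qed.

(** The affine part of [f] at [a +i* b] has contour integral 0, so only the remainder [rho] counts.
    On the boundary it is at most [e] times the sum L of the side lengths, and the length of the
    contour supplies the second factor L. *)
Lemma rect_integral_small f x1 x2 y1 y2 (a b : R) d (e : R) : 0 <= e ->
  x1 <= a <= x2 -> y1 <= b <= y2 -> rect_holo f x1 x2 y1 y2 ->
  (forall z, cmod (z - (a +i* b)) <= (x2 - x1) + (y2 - y1) ->
    cmod (f z - f (a +i* b) - d * (z - (a +i* b))) <= e * cmod (z - (a +i* b))) ->
  cmod (rect_integral f x1 x2 y1 y2) <= 4 * e * ((x2 - x1) + (y2 - y1)) ^+ 2.
Proof.
move=> e0 xa yb fh H; set L := (x2 - x1) + (y2 - y1).
have [xx yy] : x1 <= x2 /\ y1 <= y2.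
  by split; lra.
set z0 := a +i* b; pose rho z := f z - f z0 - d * (z - z0).
have rhoE x y : x1 <= x <= x2 -> y1 <= y <= y2 -> cmod (rho (x +i* y)) <= e * L.
  move=> hx hy.
  have dz : cmod ((x +i* y) - z0) <= L.
    apply: (le_trans (cmod_ReIm _)) => /=; rewrite lerD//.
      by rewrite ler_norml; apply/andP; split; lra.
    by rewrite ler_norml; apply/andP; split; lra.
  by apply: (le_trans (H _ dz)); rewrite ler_wpM2l.
have x1x : x1 <= x1 <= x2 by rewrite lexx.
have x2x : x1 <= x2 <= x2 by rewrite lexx andbT.
have y1y : y1 <= y1 <= y2 by rewrite lexx.
have y2y : y1 <= y2 <= y2 by rewrite lexx andbT.
have hI y : y1 <= y <= y2 -> cintegrable `[x1, x2] (fun t => f (t +i* y)).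
  by move=> hy; apply: rcont_cintegrable_itv; exact: rect_holo_hcont fh hy.
have vI x : x1 <= x <= x2 -> cintegrable `[y1, y2] (fun t => f (x +i* t)).
  by move=> hy; apply: rcont_cintegrable_itv; exact: rect_holo_vcont fh hy.
have cI (s t : R) (c : R[i]) : cintegrable `[s, t] (fun=> c).
  by split; exact: itv_integrable_cst.
have -> : rect_integral f x1 x2 y1 y2 =
    cintegral `[x1, x2] (fun t => rho (t +i* y1) - rho (t +i* y2)) +
    'i * cintegral `[y1, y2] (fun t => rho (x2 +i* t) - rho (x1 +i* t)).
  (* The affine part contributes [- d * 'i * (y1 - y2)] over the width and [- d * (x2 - x1)] over
     the height; the factor ['i] in front of the vertical edges makes the two cancel. *)
  have E1 t : rho (t +i* y1) - rho (t +i* y2) =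
      (f (t +i* y1) - f (t +i* y2)) - d * 'i * (y1 - y2)%:C.
    rewrite /rho; have -> : t +i* y1 = t +i* y2 + 'i * (y1 - y2)%:C.
      by apply: complexP => /=; ring.
    ring.
  have E2 t : rho (x2 +i* t) - rho (x1 +i* t) =
      (f (x2 +i* t) - f (x1 +i* t)) - d * (x2 - x1)%:C.
    rewrite /rho; have -> : x2 +i* t = x1 +i* t + (x2 - x1)%:C.
      by apply: complexP => /=; ring.
    ring.
  rewrite (eq_cintegral (fun t _ => E1 t)) (eq_cintegral (fun t _ => E2 t)).
  rewrite [in RHS]cintegralB//; last by apply: cintegrableB => //; exact: hI.
  rewrite [X in _ = _ + 'i * X]cintegralB//;
    last by apply: cintegrableB => //; exact: vI.
  rewrite !cintegral_itv_cst// /rect_integral.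
  rewrite -[y1 - y2]opprB realcN; ring.
have rB x y : x1 <= x <= x2 -> y1 <= y <= y2 -> exists d', cder rho (x +i* y) d'.
  move=> hx hy; have [d' fd] := fh _ _ hx hy.
  eexists; apply: cderB.
    by apply: cderB; [exact: fd|exact: cder_cst].
  by apply: cderZ; apply: cderB; [exact: cder_id|exact: cder_cst].
have M x y u v : x1 <= x <= x2 -> y1 <= y <= y2 -> x1 <= u <= x2 ->
  y1 <= v <= y2 -> cmod (rho (x +i* y) - rho (u +i* v)) <= 2 * (e * L).
  move=> *; apply: (le_trans (cmodD _ _)).
  by rewrite cmodN mulrDl !mul1r lerD// rhoE.
apply: (le_trans (cmodD _ _)); rewrite cmodM cmod_i mul1r.
have -> : 4 * e * L ^+ 2 = 2 * (2 * (e * L)) * (x2 - x1) + 2 * (2 * (e * L)) * (y2 - y1).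
  by rewrite /L; ring.
apply: lerD.
  apply: cmod_cintegral_itv_le => //; last by move=> t tx; exact: M.
  by apply: cintegrableB => //; apply: rcont_cintegrable_itv;
    apply: (@rect_holo_hcont rho x1 x2 y1 y2).
apply: cmod_cintegral_itv_le => //; last by move=> t tx; exact: M.
by apply: cintegrableB => //; apply: rcont_cintegrable_itv;
    apply: (@rect_holo_vcont rho x1 x2 y1 y2).
Qed.

(** The intervals with left end [X n] and length [w / 2 ^+ n] are nested, so the supremum of the
    left ends lies in all of them. *)
Lemma nested_halving (X : nat -> R) (w : R) :
  (forall n, X n <= X n.+1 /\ X n.+1 + w / 2 ^+ n.+1 <= X n + w / 2 ^+ n) -> 0 <= w ->
  exists a, forall n, X n <= a <= X n + w / 2 ^+ n.
Proof.
move=> H w0.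
have w2 n : 0 <= w / 2 ^+ n by rewrite divr_ge0// exprn_ge0.
have up n k : X n <= X (n + k)%N /\ X (n + k)%N + w / 2 ^+ (n + k) <= X n + w / 2 ^+ n.
  elim: k => [|k [I1 I2]]; first by rewrite addn0.
  rewrite addnS; have [H1 H2] := H (n + k)%N.
  by split; [exact: le_trans I1 H1|exact: le_trans H2 I2].
have ub n m : X m <= X n + w / 2 ^+ n.
  have [nm|mn] := leqP n m.
    have [_] := up n (m - n)%N; rewrite subnKC// => ?; have := w2 m; lra.
  have [] := up m (n - m)%N; rewrite subnKC 1?ltnW// => ? _; have := w2 n; lra.
exists (sup (range X)) => n; apply/andP; split.
  apply: ub_le_sup; last by exists n.
  by exists (X 0%N + w / 2 ^+ 0) => _ [m _ <-].
by apply: ge_sup; [exists (X 0%N); exists 0%N|move=> _ [m _ <-]].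
Qed.

(* Quartering: some quarter always carries a quarter of the integral, while on a
   small rectangle the integral is o(diameter^2). *)
Lemma goursat f x1 x2 y1 y2 : x1 <= x2 -> y1 <= y2 -> rect_holo f x1 x2 y1 y2 ->
  rect_integral f x1 x2 y1 y2 = 0.
Proof.
have coord (p q W l r : R) : q = p \/ q = p + W -> l <= p -> p + (W + W) <= r ->
  0 <= W -> l <= q /\ q + W <= r by case=> -> *; split; lra.
move=> xx yy fh; apply/eqP; rewrite -cmod_eq0; apply/negPn/negP => c0.
set c := cmod _ in c0.
have {c0}c0 : 0 < c by rewrite lt_neqAle eq_sym c0 cmod_ge0.
set w := x2 - x1; set h := y2 - y1.
have w0 : 0 <= w by rewrite subr_ge0.
have h0 : 0 <= h by rewrite subr_ge0.
have half (u : R) n : u / 2 ^+ n = u / 2 ^+ n.+1 + u / 2 ^+ n.+1.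
  by rewrite exprS; field; rewrite expf_neq0.
pose J n (p : R * R) := rect_integral f p.1 (p.1 + w / 2 ^+ n) p.2 (p.2 + h / 2 ^+ n).
pose inq n (p : R * R) := [/\ x1 <= p.1, p.1 + w / 2 ^+ n <= x2, y1 <= p.2 &
  p.2 + h / 2 ^+ n <= y2].
pose next n (p q : R * R) := [/\ q.1 = p.1 \/ q.1 = p.1 + w / 2 ^+ n.+1,
   q.2 = p.2 \/ q.2 = p.2 + h / 2 ^+ n.+1 & c / 4 ^+ n.+1 <= cmod (J n.+1 q)].
have w20 n : 0 <= w / 2 ^+ n by rewrite divr_ge0// exprn_ge0.
have h20 n : 0 <= h / 2 ^+ n by rewrite divr_ge0// exprn_ge0.
have step n p : inq n p -> c / 4 ^+ n <= cmod (J n p) -> exists q, next n p q.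
  case: p => x y [/= X1 X2 Y1 Y2]; rewrite leNgt => Jp.
  apply: contrapT => /forallNP N; case/negP: Jp.
  have N' q1 q2 : q1 = x \/ q1 = x + w / 2 ^+ n.+1 ->
      q2 = y \/ q2 = y + h / 2 ^+ n.+1 -> cmod (J n.+1 (q1, q2)) < c / 4 ^+ n.+1.
    move=> Q1 Q2; rewrite ltNge; apply/negP => Q3.
    by apply: (N (q1, q2)); split.
  have {fh}fh : rect_holo f x (x + w / 2 ^+ n) y (y + h / 2 ^+ n).
    by move=> u v /andP[? ?] /andP[? ?]; apply: fh; apply/andP; split; lra.
  have hw : 0 <= w / 2 ^+ n.+1 <= w / 2 ^+ n by have := half w n; have := w20 n.+1; lra.
  have hh : 0 <= h / 2 ^+ n.+1 <= h / 2 ^+ n by have := half h n; have := h20 n.+1; lra.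
  have E : J n (x, y) = J n.+1 (x, y) + J n.+1 (x, y + h / 2 ^+ n.+1) +
     (J n.+1 (x + w / 2 ^+ n.+1, y) + J n.+1 (x + w / 2 ^+ n.+1, y + h / 2 ^+ n.+1)).
    by rewrite /J /= -!(addrA x) -!(addrA y) -!half; apply: rect_integral_quarter fh; lra.
  change (cmod (J n (x, y)) < c / 4 ^+ n); rewrite E.
  have -> : c / 4 ^+ n = (c / 4 ^+ n.+1 + c / 4 ^+ n.+1) + (c / 4 ^+ n.+1 + c / 4 ^+ n.+1).
    by rewrite exprS; field; rewrite expf_neq0.
  apply: (le_lt_trans (cmodD _ _)); apply: ltrD.
    by apply: (le_lt_trans (cmodD _ _)); apply: ltrD; apply: N'; auto.
  by apply: (le_lt_trans (cmodD _ _)); apply: ltrD; apply: N'; auto.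
(* [xget] picks a quarter that keeps its share of the integral; along the sequence, [step] excludes
   its default value [P m]. *)
pose P := fix P n : R * R := if n is m.+1 then xget (P m) (next m (P m)) else (x1, y1).
have PP n : inq n (P n) /\ c / 4 ^+ n <= cmod (J n (P n)).
  elim: n => [|n [I1 I2]].
    have Ew : x1 + w / 2 ^+ 0 = x2 by rewrite divr1 addrC subrK.
    have Eh : y1 + h / 2 ^+ 0 = y2 by rewrite divr1 addrC subrK.
    change ([/\ x1 <= x1, x1 + w / 2 ^+ 0 <= x2, y1 <= y1 & y1 + h / 2 ^+ 0 <= y2]
      /\ c / 4 ^+ 0 <= cmod (rect_integral f x1 (x1 + w / 2 ^+ 0) y1 (y1 + h / 2 ^+ 0))).
    by rewrite Ew Eh divr1.
  have /(xgetPex (P n)) [A1 A2 A3] := step _ _ I1 I2.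
  split; last by [].
  case: I1 => X1 X2 Y1 Y2.
  rewrite half in X2; rewrite half in Y2.
  have [? ?] := coord _ _ _ _ _ A1 X1 X2 (w20 _).
  by have [? ?] := coord _ _ _ _ _ A2 Y1 Y2 (h20 _).
have PN n : next n (P n) (P n.+1).
  by have [I1 I2] := PP n; have /(xgetPex (P n)) := step _ _ I1 I2.
have [a Ha] : exists a, forall n, (P n).1 <= a <= (P n).1 + w / 2 ^+ n.
  apply: nested_halving => // n; have [A1 _ _] := PN n.
  have := half w n; have := w20 n.+1.
  by case: A1 => ->; lra.
have [b Hb] : exists b, forall n, (P n).2 <= b <= (P n).2 + h / 2 ^+ n.
  apply: nested_halving => // n; have [_ A1 _] := PN n.
  have := half h n; have := h20 n.+1.
  by case: A1 => ->; lra.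
have [d fd] : exists d, cder f (a +i* b) d.
  have [[]] := PP 0%N; rewrite !divr1 => *.
  have := Ha 0%N; have := Hb 0%N; rewrite !divr1 => *.
  by apply: fh; lra.
(* Chosen so that [4 * e * (w + h) ^+ 2] stays below [c]; the powers of 4 on the two sides cancel.
   The [+ 1] keeps the divisor positive when the rectangle is a point. *)
pose e := c / (8 * ((w + h) ^+ 2 + 1)).
have s0 : 0 < (w + h) ^+ 2 + 1 by rewrite ltr_wpDl// sqr_ge0.
have e0 : 0 < e by rewrite divr_gt0// mulr_gt0.
have [del del0 H] := fd _ e0.
have [n nd] : exists n, (w + h) / 2 ^+ n < del.
  have : (w + h) / 2 ^+ n @[n --> \oo] --> 0.
    have -> : 0 = (w + h) * 0 :> R by rewrite mulr0.
    under eq_fun do rewrite -exprVn.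
    by apply: cvgM; [exact: cvg_cst|apply: cvg_expr; rewrite ger0_norm// invf_lt1// ltr1n].
  by move/cvgrPdist_lt => /(_ _ del0) [n _ /(_ n (leqnn n))];
    rewrite sub0r normrN => Hn; exists n; exact: le_lt_trans (ler_norm _) Hn.
have [[X1 X2 Y1 Y2] Jn] := PP n.
have : cmod (J n (P n)) <= 4 * e * ((w + h) / 2 ^+ n) ^+ 2.
  have EL : (w + h) / 2 ^+ n = ((P n).1 + w / 2 ^+ n - (P n).1) + ((P n).2 + h / 2 ^+ n - (P n).2).
    by rewrite mulrDl; ring.
  rewrite EL; apply: (@rect_integral_small f _ _ _ _ a b d) => //; first exact: ltW.
    by move=> u v /andP[? ?] /andP[? ?]; apply: fh; apply/andP; split; lra.
  move=> z zz; have := H (z - (a +i* b)); rewrite [_ + (z - _)]addrC subrK; apply.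
  by apply: le_lt_trans zz _; rewrite -EL.
apply/negP; rewrite -ltNge; apply: lt_le_trans Jn.
have -> : 4 ^+ n = (2 ^+ n) ^+ 2 :> R.
  by rewrite -exprM mulnC exprM; congr (_ ^+ n); ring.
rewrite expr_div_n mulrA ltr_pM2r ?invr_gt0 ?exprn_gt0// /e.
have -> : 4 * (c / (8 * ((w + h) ^+ 2 + 1))) * (w + h) ^+ 2 =
  c * ((w + h) ^+ 2 / (2 * ((w + h) ^+ 2 + 1))).
  by field; rewrite gt_eqF.
rewrite gtr_pMr// ltr_pdivrMr ?mulr_gt0// mul1r; have := sqr_ge0 (w + h); lra.
Qed.

End goursat.

(** * Cauchy's formula for the derivative *)

Definition square_integral (R : realType) (f : R[i] -> R[i]) : R[i] :=
  rect_integral f (-1) 1 (-1) 1.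

(** This is 2 pi i. It is used through its inverse, which the positivity of its imaginary part makes
    legitimate. *)
Definition winding_const (R : realType) : R[i] :=
  square_integral (fun w : R[i] => w^-1).

(* Cauchy's formula for [f'(z)], on the square of half-side 1 about [z];
   subtracting the constant [f z] does not change the contour integral. *)
Definition cauchy_der (R : realType) (f : R[i] -> R[i]) (z : R[i]) : R[i] :=
  (winding_const R)^-1 * square_integral (fun w => (f (z + w) - f z) * w ^- 2).

Section cauchy_formula.
Variable R : realType.
Implicit Types f g : R[i] -> R[i].

Lemma entire_ccont f : entire f -> ccont f.
Proof. by move=> /entireP ef z; have [d /cder_cont] := ef z. Qed.

Lemma ccont_atD f g z : ccont_at f z -> ccont_at g z ->
  ccont_at (fun w => f w + g w) z.
Proof.
move=> fz gz e e0; have e2 : 0 < e / 2 by rewrite divr_gt0.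
have [d1 d10 h1] := fz _ e2; have [d2 d20 h2] := gz _ e2.
exists (Num.min d1 d2); first by rewrite lt_min d10.
move=> h; rewrite lt_min => /andP[/h1 H1 /h2 H2].
rewrite opprD addrACA (le_trans (cmodD _ _))//; lra.
Qed.

Lemma ccont_atM f g z : ccont_at f z -> ccont_at g z ->
  ccont_at (fun w => f w * g w) z.
Proof.
move=> fz gz e e0; set N := cmod (f z) + cmod (g z) + 1.
have N0 : 0 < N by rewrite ltr_wpDl// addr_ge0// cmod_ge0.
pose e' := Num.min 1 (e / N).
have e'0 : 0 < e' by rewrite lt_min ltr01 divr_gt0.
have e'1 : e' <= 1 by rewrite ge_min lexx.
have e'N : e' * N <= e by rewrite -ler_pdivlMr// ge_min lexx orbT.
have [d1 d10 h1] := fz _ e'0; have [d2 d20 h2] := gz _ e'0.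
exists (Num.min d1 d2); first by rewrite lt_min d10.
move=> h; rewrite lt_min => /andP[/h1 H1 /h2 H2].
have -> : f (z + h) * g (z + h) - f z * g z =
  (f (z + h) - f z) * (g (z + h) - g z) + (f (z + h) - f z) * g z +
  f z * (g (z + h) - g z) by ring.
apply: (le_trans (cmodD _ _)); apply: (le_trans (lerD (cmodD _ _) (lexx _))).
rewrite !cmodM; apply: le_trans e'N; rewrite /N !mulrDr.
set x := cmod (f (z + h) - f z) in H1 *; set y := cmod (g (z + h) - g z) in H2 *.
have : x * y <= e' * 1 by rewrite ler_pM ?cmod_ge0// (le_trans H2).
have : x * cmod (g z) <= e' * cmod (g z) by rewrite ler_wpM2r ?cmod_ge0.
have : cmod (f z) * y <= cmod (f z) * e' by rewrite ler_wpM2l ?cmod_ge0.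
lra.
Qed.

Lemma ccont_shift f z : ccont f -> ccont (fun w => f (z + w)).
Proof. by move=> fc w e /(fc (z + w)) [del del0 H]; exists del => // h /H; rewrite addrA. Qed.

Lemma ccont_cst (c : R[i]) : ccont (fun=> c).
Proof. by move=> z; exact: cder_cont (@cder_cst _ c z). Qed.

Definition edge_cont f (s : R) := forall t : R, - s <= t <= s ->
  [/\ rcont (fun t => f (t +i* s)) t, rcont (fun t => f (t +i* (- s))) t,
      rcont (fun t => f (s +i* t)) t & rcont (fun t => f ((- s) +i* t)) t].

Definition centered_integral f (s : R) := rect_integral f (- s) s (- s) s.

Lemma edge_cintegrable f s : edge_cont f s ->
  [/\ cintegrable `[- s, s] (fun t => f (t +i* s)),
      cintegrable `[- s, s] (fun t => f (t +i* (- s))),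
      cintegrable `[- s, s] (fun t => f (s +i* t)) &
      cintegrable `[- s, s] (fun t => f ((- s) +i* t))].
Proof.
by move=> fc; split; apply: rcont_cintegrable_itv => t /fc[].
Qed.

Lemma centered_integralD f g s : edge_cont f s -> edge_cont g s ->
  centered_integral (fun w => f w + g w) s =
  centered_integral f s + centered_integral g s.
Proof.
move=> /edge_cintegrable[f1 f2 f3 f4] /edge_cintegrable[g1 g2 g3 g4].
rewrite /centered_integral /rect_integral !cintegralB//;
  try exact: cintegrableD.
rewrite (cintegralD _ f1 g1)// (cintegralD _ f2 g2)// (cintegralD _ f3 g3)//.
rewrite (cintegralD _ f4 g4)//; ring.
Qed.

Lemma centered_integralZ c f s : edge_cont f s ->
  centered_integral (fun w => c * f w) s = c * centered_integral f s.
Proof.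
move=> /edge_cintegrable[f1 f2 f3 f4].
rewrite /centered_integral /rect_integral !cintegralB//;
  try exact: cintegrableZ.
rewrite !cintegralZ//; ring.
Qed.

(** The boundary of the square of half-side [s] lies between the circles of radii [s] and [2 * s].
    Each of the two paired integrals has an integrand of size [2 * M], an interval of length [2 * s]
    and the factor 2 of [cmod_cintegral_itv_le], whence 8 + 8 = 16. *)
Lemma cmod_centered_integral_le f (s M : R) : 0 <= s -> edge_cont f s ->
  (forall w, s <= cmod w <= 2 * s -> cmod (f w) <= M) ->
  cmod (centered_integral f s) <= 16 * s * M.
Proof.
move=> s0 fc fM; have [f1 f2 f3 f4] := edge_cintegrable fc.
have ss : - s <= s by lra.
have H t : - s <= t <= s -> [/\ cmod (f (t +i* s)) <= M,
    cmod (f (t +i* (- s))) <= M, cmod (f (s +i* t)) <= M &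
    cmod (f ((- s) +i* t)) <= M].
  move=> ts.
  have tn : `|t| <= s by rewrite ler_norml.
  have sn : `|s| = s by rewrite ger0_norm.
  have U x y : `|x| <= s -> `|y| <= s -> cmod (x +i* y) <= 2 * s.
    by move=> xs ys; apply: (le_trans (cmod_ReIm _)) => /=; lra.
  by split; apply: fM; rewrite U ?normrN ?sn ?tn// andbT;
    [have := normIm_cmod (t +i* s)|have := normIm_cmod (t +i* - s)
    |have := normRe_cmod (s +i* t)|have := normRe_cmod (- s +i* t)];
    rewrite /= ?normrN sn.
apply: (le_trans (cmodD _ _)); rewrite cmodM cmod_i mul1r.
have -> : 16 * s * M = 2 * (M + M) * (s - - s) + 2 * (M + M) * (s - - s) by ring.
apply: lerD; apply: cmod_cintegral_itv_le => //; try exact: cintegrableB.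
  by move=> t /H[h1 h2 h3 h4]; apply: (le_trans (cmodD _ _)); rewrite cmodN lerD.
by move=> t /H[h1 h2 h3 h4]; apply: (le_trans (cmodD _ _)); rewrite cmodN lerD.
Qed.

Lemma holo_edge_cont f s : 0 < s ->
  (forall w, w != 0 -> exists d, cder f w d) -> edge_cont f s.
Proof.
move=> s0 fh t _.
have H x y : (x != 0) || (y != 0) -> exists d, cder f (x +i* y) d.
  by move=> xy; apply: fh; rewrite eq_complex /= negb_and.
have sn : - s != 0 by rewrite oppr_eq0 gt_eqF.
have sp : s != 0 by rewrite gt_eqF.
split.
- by have [|d /cder_hcont//] := H t s; rewrite sp orbT.
- by have [|d /cder_hcont//] := H t (- s); rewrite sn orbT.
- by have [|d /cder_vcont//] := H s t; rewrite sp.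
- by have [|d /cder_vcont//] := H (- s) t; rewrite sn.
Qed.

(** The region between the two squares is cut into two strips of full height and two blocks, below
    and above the small square. None of the four contains 0, so their integrals vanish by Goursat's
    theorem. *)
Lemma centered_integral_shrink f (s : R) : 0 < s < 1 ->
  (forall w, w != 0 -> exists d, cder f w d) ->
  square_integral f = centered_integral f s.
Proof.
move=> s01 fh; have /andP[s0 s1] := s01.
have H x y : (x != 0) || (y != 0) -> exists d, cder f (x +i* y) d.
  by move=> xy; apply: fh; rewrite eq_complex /= negb_and.
have nz (x : R) : (x < 0) || (0 < x) -> x != 0 by case/orP => ?; [rewrite lt_eqF|rewrite gt_eqF].
have hc y t : y != 0 -> rcont (fun t => f (t +i* y)) t.
  by move=> y0; have [|d /cder_hcont//] := H t y; rewrite y0 orbT.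
have vc x t : x != 0 -> rcont (fun t => f (x +i* t)) t.
  by move=> x0; have [|d /cder_vcont//] := H x t; rewrite x0.
have N1 : (-1 : R) != 0 by apply: nz; rewrite ltrN10.
have Ns : (- s : R) != 0 by apply: nz; rewrite oppr_lt0 s0.
have P1 : (1 : R) != 0 by [].
have Ps : s != 0 by rewrite gt_eqF.
rewrite /square_integral (@rect_integral_hsplit _ f _ (- s));
  [|by lra|move=> *; by [apply: hc|apply: vc]..].
rewrite (@rect_integral_hsplit _ f (- s) s 1);
  [|by lra|move=> *; by [apply: hc|apply: vc]..].
rewrite (@goursat _ f (-1) (- s)); [|by lra|by lra|]; last first.
  by move=> x y xx yy; apply: H; rewrite nz//; lra.
rewrite (@goursat _ f s 1); [|by lra|by lra|]; last first.
  by move=> x y xx yy; apply: H; rewrite nz//; lra.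
rewrite (@rect_integral_vsplit _ f _ _ _ (- s));
  [|by lra|move=> *; by [apply: hc|apply: vc]..].
rewrite (@rect_integral_vsplit _ f (- s) s (- s) s 1);
  [|by lra|move=> *; by [apply: hc|apply: vc]..].
rewrite (@goursat _ f (- s) s (- 1) (- s)); [|by lra|by lra|]; last first.
  by move=> x y xx yy; apply: H; rewrite (nz y) ?orbT//; lra.
rewrite (@goursat _ f (- s) s s 1); [|by lra|by lra|]; last first.
  by move=> x y xx yy; apply: H; rewrite (nz y) ?orbT//; lra.
by rewrite !(add0r, addr0).
Qed.

Lemma cder_inv (z : R[i]) : z != 0 -> exists d, cder (fun w : R[i] => w^-1) z d.
Proof. by move=> z0; exact: (cderV z0 (cder_id z)). Qed.

(** On the paired horizontal edges, 1/(t - i) - 1/(t + i) has imaginary part 2/(1 + t^2), which is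
    at least 1 for |t| <= 1; the vertical pair gives the same integrand. Each pair thus contributes
    at least 2. *)
Lemma Im_winding_const_gt0 : 0 < complex.Im (winding_const R).
Proof.
have cI : edge_cont (fun w : R[i] => w^-1) 1.
  by apply: holo_edge_cont => // w; exact: cder_inv.
have [f1 f2 f3 f4] := edge_cintegrable cI.
have pos (g : R -> R) : lebesgue_measure.-integrable `[- 1, 1] (EFin \o g) ->
    (forall t, g t = 2 / (1 + t ^+ 2)) ->
    2 <= \int[lebesgue_measure]_(t in `[-1, 1]) g t.
  move=> gi gE.
  have -> : 2 = \int[(@lebesgue_measure R)]_(t in `[(-1), 1]) (1 : R).
    by rewrite Rintegral_itv_cst ?mul1r ?opprK//; lra.
  apply: le_Rintegral => //; first exact: itv_integrable_cst.
  move=> t /=; rewrite in_itv/= gE => t1.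
  have : 0 <= (1 - t) * (1 + t) by apply: mulr_ge0; lra.
  by have := sqr_ge0 t => *; rewrite ler_pdivlMr ?ltr_pwDl//; lra.
rewrite /winding_const /square_integral /rect_integral cImD cImM.
set A := complex.Im _; set B := complex.Re (cintegral _ _).
have -> : complex.Re 'i = 0 :> R by []. 
have -> : complex.Im 'i = 1 :> R by []. 
have A2 : 2 <= A.
  apply: pos.
    by have [] := @cintegrableB _ _ _ _ (measurable_itv _) f2 f1.
  move=> t; rewrite cImD cImN /= sqrrN expr1n; field.
  by rewrite gt_eqF// ltr_pwDl// sqr_ge0.
have B2 : 2 <= B.
  apply: pos.
    by have [] := @cintegrableB _ _ _ _ (measurable_itv _) f3 f4.
  move=> t; rewrite cReD cReN /= sqrrN expr1n; field.
  by rewrite gt_eqF// ltr_pwDl// sqr_ge0.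
by rewrite mul0r add0r mul1r; lra.
Qed.

(** The remainder [k] is holomorphic away from 0 and o(1/|w|) at 0. Shrinking the square to
    half-side [s] bounds its integral by 16 s times o(1/s), so the integral vanishes. What is left
    of the integrand is d/w, which integrates to [d] times the winding constant. *)
Lemma cauchy_derE f z d : entire f -> cder f z d -> d = cauchy_der f z.
Proof.
move=> ef fd.
have c0 : winding_const R != 0.
  by apply: contraTneq Im_winding_const_gt0 => -> /=; rewrite ltxx.
pose k w := (f (z + w) - f z - d * w) * w ^- 2.
have sh w : exists d, cder (fun w => f (z + w)) w d.
  have /entireP/(_ (w + z)) [d' fd'] := ef; exists d'.
  by under [X in cder X]eq_fun do rewrite addrC; exact: cder_shift fd'.
have inv2 w : w != 0 -> exists d, cder (fun w : R[i] => w ^- 2) w d.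
  move=> w0; apply: (@cderV _ (fun w => w ^+ 2)); first by rewrite expf_neq0.
  exact: cderM (cder_id w) (cder_id w).
have kd w : w != 0 -> exists d, cder k w d.
  move=> w0; have [d1 h1] := sh w; have [d2 h2] := inv2 _ w0.
  eexists; apply: cderM h2; apply: cderB.
    by apply: cderB; [exact: h1|exact: cder_cst].
  by apply: cderZ; exact: cder_id.
have k0 : square_integral k = 0.
  apply/eqP; rewrite -cmod_eq0; apply/negPn/negP => C0.
  have {}C0 : 0 < cmod (square_integral k) by rewrite lt_neqAle eq_sym C0 cmod_ge0.
  set C := cmod _ in C0.
  (* With this tolerance the integral over the small square is at most [16 * s * (C / 32 / s)], that
     is [C / 2], although its modulus is [C]. *)
  have e0 : 0 < C / 32 by rewrite divr_gt0.
  have [del del0 H] := fd _ e0.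
  (* Shrinking asks for [s < 1]; the tolerance asks for [2 * s < del], since [2 * s] bounds the
     modulus on the boundary. *)
  pose s := Num.min 2^-1 (del / 4).
  have s0 : 0 < s by rewrite lt_min invr_gt0 ltr0n /= divr_gt0.
  have s1 : s <= 2^-1 by rewrite ge_min lexx.
  have s2del : 2 * s < del.
    have : s <= del / 4 by rewrite ge_min lexx orbT.
    lra.
  have : C <= 16 * s * (C / 32 / s).
    have CE : C = cmod (centered_integral k s).
      by rewrite /C (@centered_integral_shrink _ s)//; lra.
    rewrite {1}CE.
    apply: cmod_centered_integral_le; [exact: ltW|exact: holo_edge_cont|].
    move=> w /andP[sw ws].
    have w0 : 0 < cmod w by exact: lt_le_trans sw.
    rewrite /k cmodM cmodV expr2 cmodM invfM mulrA.
    apply: (@le_trans _ _ (C / 32 / cmod w)).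
      rewrite ler_pM2r ?invr_gt0// ler_pdivrMr//; apply: H.
      exact: le_lt_trans ws s2del.
    by rewrite (ler_pM2l e0) lef_pV2.
  have -> : 16 * s * (C / 32 / s) = C / 2 by field; rewrite gt_eqF.
  lra.
have cI : edge_cont (fun w : R[i] => w^-1) 1.
  by apply: holo_edge_cont => // w; exact: cder_inv.
have kI : edge_cont k 1 by exact: holo_edge_cont.
have dI : edge_cont (fun w : R[i] => d * w^-1) 1.
  apply: holo_edge_cont => // w w0; have [d' wd] := cder_inv w0.
  by eexists; exact: cderZ wd.
rewrite /cauchy_der.
have -> : (fun w => (f (z + w) - f z) * w ^- 2) = (fun w => k w + d * w^-1).
  apply/funext => w; rewrite /k; have [->|w0] := eqVneq w 0.
    (* At [w = 0] both sides are 0, because the inverse of 0 is 0. *)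
    by rewrite !expr2 !mulr0 invr0 !mulr0 addr0.
  by field.
rewrite [square_integral _](centered_integralD kI dI).
rewrite (centered_integralZ _ cI) [centered_integral k 1]k0 add0r.
by rewrite mulrCA mulVf// mulr1.
Qed.

Lemma cauchy_der_edge f z : ccont f ->
  edge_cont (fun w => (f (z + w) - f z) * w ^- 2) 1.
Proof.
move=> fc t t1; pose k w := (f (z + w) - f z) * w ^- 2.
have H w : w != 0 -> ccont_at k w.
  move=> w0; apply: ccont_atM.
    by apply: ccont_atD; [exact: ccont_shift|exact: ccont_cst].
  have w20 : w ^+ 2 != 0 by rewrite expf_neq0.
  have [d] := @cderV _ (fun w => w ^+ 2) w _ w20 (cderM (cder_id w) (cder_id w)).
  exact: cder_cont.
have N x y : (x != 0) || (y != 0) -> x +i* y != 0 :> R[i].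
  by rewrite eq_complex /= negb_and.
by split; [apply: (@ccont_at_hcont _ k)|apply: (@ccont_at_hcont _ k)
  |apply: (@ccont_at_vcont _ k)|apply: (@ccont_at_vcont _ k)]; apply: H; apply: N;
  rewrite ?oppr_eq0 oner_eq0// orbT.
Qed.

(** Linearity is stated for continuous functions: [entire_cauchy_der] applies it to a combination
    that contains the derivative itself, at a stage where only the continuity of the latter is
    known. *)
Lemma cauchy_derD f g z : ccont f -> ccont g ->
  cauchy_der (fun w => f w + g w) z = cauchy_der f z + cauchy_der g z.
Proof.
move=> fc gc; rewrite /cauchy_der -mulrDr; congr (_ * _).
have fe := cauchy_der_edge z fc; have ge := cauchy_der_edge z gc.
have -> : (fun w => (f (z + w) + g (z + w) - (f z + g z)) * w ^- 2) =
  (fun w => (f (z + w) - f z) * w ^- 2 + (g (z + w) - g z) * w ^- 2).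
  by apply/funext => w; ring.
exact: centered_integralD fe ge.
Qed.

Lemma cauchy_derZ c f z : ccont f ->
  cauchy_der (fun w => c * f w) z = c * cauchy_der f z.
Proof.
move=> fc; rewrite /cauchy_der mulrCA; congr (_ * _).
have -> : (fun w => (c * f (z + w) - c * f z) * w ^- 2) =
  (fun w => c * ((f (z + w) - f z) * w ^- 2)).
  by apply/funext => w; ring.
exact: centered_integralZ _ (cauchy_der_edge z fc).
Qed.

Definition cauchy_norm : R := 16 * cmod (winding_const R)^-1.

Lemma cauchy_norm_ge0 : 0 <= cauchy_norm.
Proof. by rewrite mulr_ge0// cmod_ge0. Qed.

(** Increments are bounded because the integrand has [f z] subtracted. On the boundary of the square
    1 <= |w| <= 2, so [w ^- 2] contributes at most 1. *)
Lemma cmod_cauchy_der_le f z (M : R) : ccont f ->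
  (forall w, cmod w <= 2 -> cmod (f (z + w) - f z) <= M) ->
  cmod (cauchy_der f z) <= cauchy_norm * M.
Proof.
move=> fc fM; rewrite cmodM /cauchy_norm mulrC [16 * _]mulrC -mulrA.
rewrite [leRHS]mulrC ler_wpM2r ?cmod_ge0// -[16]mulr1.
apply: (cmod_centered_integral_le _ (cauchy_der_edge z fc)) => // w.
rewrite mulr1 => /andP[w1 w2]; rewrite cmodM cmodV expr2 cmodM.
have M0 := le_trans (cmod_ge0 _) (fM _ w2).
rewrite ler_pdivrMr ?mulr_gt0 ?(lt_le_trans ltr01)//.
apply: (le_trans (fM _ w2)); rewrite ler_peMr//.
by rewrite -[1]mulr1 ler_pM.
Qed.

End cauchy_formula.

(** * Weighted bounds *)

Definition wt (R : realType) (r k : R) (z : R[i]) : R :=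
  (1 + cmod z) `^ (- k) * expR (r * `|complex.Im z|).

(** Bounds the ratio of the weights at two points at distance at most [rho]; the absolute value of
    [k] serves both signs of the exponent. *)
Definition wt_growth (R : realType) (r k rho : R) : R :=
  (1 + rho) `^ `|k| * expR (r * rho).

Definition wbounded (R : realType) (r k M : R) (f : R[i] -> R[i]) : Prop :=
  forall z, cmod (f z) <= M * wt r k z.

Section weights.
Variable R : realType.
Implicit Types (r k M rho : R) (f g : R[i] -> R[i]).

Lemma wt_gt0 r k z : 0 < wt r k z.
Proof. by rewrite mulr_gt0 ?expR_gt0// powR_gt0// ltr_pwDl// cmod_ge0. Qed.

(** In logarithms, |ln a - ln b| <= ln c is multiplied by |p|. The inequalities between [a] and [b]
    come in both directions because [p] may have either sign. *)
Lemma powR_quasi (a b c p : R) : 0 < a -> 0 < b -> 0 < c ->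
  a <= b * c -> b <= a * c -> a `^ p <= c `^ `|p| * b `^ p.
Proof.
move=> a0 b0 c0 ab ba; rewrite /powR !gt_eqF// -expRD ler_expR.
have H1 : ln a <= ln b + ln c by rewrite -lnM ?posrE// ler_ln ?posrE ?mulr_gt0.
have H2 : ln b <= ln a + ln c by rewrite -lnM ?posrE// ler_ln ?posrE ?mulr_gt0.
rewrite -lerBlDr -mulrBr; apply: le_trans (ler_norm _) _.
by rewrite normrM ler_wpM2l// ler_norml; apply/andP; split; lra.
Qed.

Lemma wt_shift r k rho z h : 0 <= r -> cmod h <= rho ->
  wt r k (z + h) <= wt_growth r k rho * wt r k z.
Proof.
move=> r0 hr; rewrite /wt_growth /wt mulrACA ler_pM//.
- exact: powR_ge0.
- have z0 := cmod_ge0 z; have h0 := cmod_ge0 h.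
  have zh0 := cmod_ge0 (z + h).
  have zh : cmod (z + h) <= cmod z + rho.
    by rewrite (le_trans (cmodD _ _))// lerD2l.
  have zh' : cmod z <= cmod (z + h) + rho.
    have -> : z = (z + h) + (- h) by rewrite addrK.
    by rewrite (le_trans (cmodD _ _))// addrK cmodN lerD2l.
  have m1 : 0 <= cmod z * rho by apply: mulr_ge0 => //; lra.
  have m2 : 0 <= cmod (z + h) * rho by apply: mulr_ge0 => //; lra.
  have rho0 := le_trans h0 hr.
  have := @powR_quasi (1 + cmod (z + h)) (1 + cmod z) (1 + rho) (- k).
  by rewrite normrN; apply; rewrite ?mulrDl ?mulrDr; lra.
- rewrite -expRD ler_expR -mulrDr ler_wpM2l// cImD.
  rewrite (le_trans (ler_normD _ _))// addrC lerD2r.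
  exact: le_trans (normIm_cmod _) hr.
Qed.

Lemma wboundedW r k M M' f : M <= M' -> wbounded r k M f -> wbounded r k M' f.
Proof.
by move=> MM' H z; apply: le_trans (H z) _; rewrite ler_pM2r ?wt_gt0.
Qed.

Lemma wbounded_ge0 r k M f : wbounded r k M f -> 0 <= M.
Proof.
move=> /(_ 0) H; rewrite -(pmulr_lge0 _ (wt_gt0 r k 0)).
exact: le_trans (cmod_ge0 _) H.
Qed.

Lemma wboundedD r k M N f g : wbounded r k M f -> wbounded r k N g ->
  wbounded r k (M + N) (fun z => f z + g z).
Proof.
by move=> Hf Hg z; rewrite mulrDl (le_trans (cmodD _ _))// lerD.
Qed.

Lemma wboundedB r k M N f g : wbounded r k M f -> wbounded r k N g ->
  wbounded r k (M + N) (fun z => f z - g z).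
Proof.
by move=> Hf Hg z; rewrite mulrDl (le_trans (cmodD _ _))// cmodN lerD.
Qed.

Lemma wboundedZ r k M c f : wbounded r k M f ->
  wbounded r k (cmod c * M) (fun z => c * f z).
Proof.
by move=> Hf z; rewrite cmodM -mulrA ler_wpM2l// cmod_ge0.
Qed.

Lemma wbounded_shift r k M a f : 0 <= r -> wbounded r k M f ->
  wbounded r k (wt_growth r k (cmod a) * M) (fun z => f (z + a)).
Proof.
move=> r0 Hf z; apply: (le_trans (Hf _)); rewrite [wt_growth _ _ _ * _]mulrC -mulrA.
by rewrite ler_wpM2l ?(wbounded_ge0 Hf)// wt_shift.
Qed.

Lemma wbounded_near r k M rho f z h : 0 <= r -> wbounded r k M f ->
  cmod h <= rho -> cmod (f (z + h)) <= wt_growth r k rho * M * wt r k z.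
Proof.
move=> r0 Hf hr; apply: (le_trans (Hf _)); rewrite [wt_growth _ _ _ * _]mulrC -mulrA.
by rewrite ler_wpM2l ?(wbounded_ge0 Hf)// wt_shift.
Qed.

End weights.

Section real_line_derivative.
Variable R : realType.

Lemma is_derive_real (u : R -> R) (t d : R) :
  (forall e, 0 < e -> exists2 del, 0 < del &
    forall s, `|s| < del -> `|u (t + s) - u t - d * s| <= e * `|s|) ->
  is_derive t (1 : R) u d.
Proof.
move=> H.
have D : (fun h : R => h^-1 *: (u (h *: 1 + t) - u t)) @ 0^' --> d.
  apply/cvgrPdist_le => e /H[del del0 {}H].
  rewrite near_withinE; apply/nbhs_ballP; exists del => //= h.
  rewrite /ball/= sub0r normrN => /H {}H h0.
  rewrite -(ler_pM2r (_ : 0 < `|h|)) ?normr_gt0//.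
  rewrite -normrM; apply: le_trans H; rewrite -normrN /GRing.scale /= mulr1.
  by rewrite le_eqVlt; apply/orP; left; apply/eqP; congr `|_|; rewrite [h + t]addrC; field.
split; last exact: cvg_lim D.
by apply/cvg_ex; exists d.
Qed.

Lemma cder_line (f : R[i] -> R[i]) (a b d : R[i]) (t : R) :
  cder f (a + b * t%:C) d ->
  is_derive t 1 (fun t => complex.Re (f (a + b * t%:C))) (complex.Re (d * b)) /\
  is_derive t 1 (fun t => complex.Im (f (a + b * t%:C))) (complex.Im (d * b)).
Proof.
move=> fd.
have H e : 0 < e -> exists2 del, 0 < del & forall s : R, `|s| < del ->
    cmod (f (a + b * (t + s)%:C) - f (a + b * t%:C) - d * b * s%:C) <= e * `|s|.
  have b0 : 0 < cmod b + 1 by rewrite ltr_wpDl// cmod_ge0.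
  move=> e0; have [|del del0 H] := fd (e / (cmod b + 1)); first by rewrite divr_gt0.
  exists (del / (cmod b + 1)); first by rewrite divr_gt0.
  move=> s; rewrite ltr_pdivlMr// => sd.
  have bs : cmod (b * s%:C) <= `|s| * (cmod b + 1).
    by rewrite cmodM cmod_real mulrC ler_wpM2l// lerDl.
  have := H _ (le_lt_trans bs sd).
  rewrite realcD mulrDr addrA mulrA => /le_trans; apply.
  rewrite mulrAC ler_pdivrMr// -mulrA ler_wpM2l// ltW//.
split; apply: is_derive_real => e /H[del del0 {}H]; exists del => // s /H;
  apply: le_trans.
- have := normRe_cmod (f (a + b * (t + s)%:C) - f (a + b * t%:C) - d * b * s%:C).
  by rewrite !(cReD, cReN) (cReM (d * b)) [complex.Im s%:C]/= mulr0 subr0.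
- have := normIm_cmod (f (a + b * (t + s)%:C) - f (a + b * t%:C) - d * b * s%:C).
  by rewrite !(cImD, cImN) (cImM (d * b)) [complex.Im s%:C]/= mulr0 add0r.
Qed.

(** A complex-valued function has no mean value point in general, so the theorem is applied to the
    real and to the imaginary part; hence the factor 2. *)
Lemma cmod_increment_le (f f' : R[i] -> R[i]) z h (M : R) :
  (forall w, cder f w (f' w)) ->
  (forall t : R, 0 <= t <= 1 -> cmod (f' (z + h * t%:C)) <= M) ->
  cmod (f (z + h) - f z) <= 2 * M * cmod h.
Proof.
move=> ff' fM.
have E1 : z + h = z + h * 1%:C by rewrite mulr1.
have E0 : z = z + h * 0%:C by rewrite mulr0 addr0.
have bnd t : 0 <= t <= 1 -> cmod (f' (z + h * t%:C) * h) <= M * cmod h.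
  by move=> t01; rewrite cmodM ler_wpM2r ?cmod_ge0// fM.
apply: (le_trans (cmod_ReIm _)); rewrite -mulrA mulrDl !mul1r.
have D1 (t : R) := (cder_line (ff' (z + h * t%:C))).1.
have D2 (t : R) := (cder_line (ff' (z + h * t%:C))).2.
apply: lerD.
- have [c /itvP c01 E] := @MVT R (fun t => complex.Re (f (z + h * t%:C)))
    (fun t => complex.Re (f' (z + h * t%:C) * h)) 0 1 ltr01 (fun t _ => D1 t)
    (derivable_within_continuous (fun t _ => @ex_derive _ _ _ _ _ _ _ (D1 t))).
  move: E; rewrite -E1 -E0 subr0 mulr1 -cReN -cReD => ->.
  by apply: (le_trans (normRe_cmod _)); apply: bnd; rewrite !c01.
- have [c /itvP c01 E] := @MVT R (fun t => complex.Im (f (z + h * t%:C)))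
    (fun t => complex.Im (f' (z + h * t%:C) * h)) 0 1 ltr01 (fun t _ => D2 t)
    (derivable_within_continuous (fun t _ => @ex_derive _ _ _ _ _ _ _ (D2 t))).
  move: E; rewrite -E1 -E0 subr0 mulr1 -cImN -cImD => ->.
  by apply: (le_trans (normIm_cmod _)); apply: bnd; rewrite !c01.
Qed.

End real_line_derivative.

(** * Taylor estimates, derivatives and limits of entire functions in the weighted norms *)

Section entire_functions.
Variable R : realType.
Implicit Types (r k M : R) (f g : R[i] -> R[i]) (z w h : R[i]).

Lemma cder_cauchy f z : entire f -> cder f z (cauchy_der f z).
Proof.
by move=> ef; have /entireP/(_ z) [d fd] := ef; rewrite -(cauchy_derE ef fd).
Qed.

Lemma cauchy_der_shift f z a :
  cauchy_der (fun w => f (w + a)) z = cauchy_der f (z + a).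
Proof.
rewrite /cauchy_der; have -> // : (fun w => (f (z + w + a) - f (z + a)) * w ^- 2) =
  (fun w => (f (z + a + w) - f (z + a)) * w ^- 2).
by apply/funext => w; rewrite (addrAC z).
Qed.

Lemma entire_shift f a : entire f -> entire (fun w => f (w + a)).
Proof.
move=> ef; apply/entireP => z; have /entireP/(_ (z + a)) [d fd] := ef.
by exists d; exact: cder_shift.
Qed.

Lemma entireZ c f : entire f -> entire (fun w => c * f w).
Proof.
move=> /entireP ef; apply/entireP => z.
by have [d1 h1] := ef z; eexists; exact: cderZ h1.
Qed.

Lemma entireB f g : entire f -> entire g -> entire (fun w => f w - g w).
Proof.
move=> /entireP ef /entireP eg; apply/entireP => z.
by have [d1 h1] := ef z; have [d2 h2] := eg z; eexists; exact: cderB h1 h2.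
Qed.

Lemma entire_refl f : entire f -> entire (fun w => f (- w)).
Proof.
move=> /entireP ef; apply/entireP => z; have [d fd] := ef (0 - z).
by exists (- d); have := cder_refl fd; under eq_fun do rewrite sub0r.
Qed.

Lemma cauchy_der_cder f z d : entire f -> cder f z d -> cauchy_der f z = d.
Proof. by move=> ef fd; rewrite (cauchy_derE ef fd). Qed.

Definition der_const r k : R := cauchy_norm R * (2 * wt_growth r k 2).

Lemma wt_growth_ge0 r k rho : 0 <= wt_growth r k rho.
Proof. by rewrite mulr_ge0 ?powR_ge0 ?expR_ge0. Qed.

Lemma der_const_ge0 r k : 0 <= der_const r k.
Proof.
by rewrite mulr_ge0 ?cauchy_norm_ge0// mulr_ge0// wt_growth_ge0.
Qed.

(* Cauchy's estimate: the weights vary by bounded factors on unit scale, so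
   differentiation is a bounded operator for each of the weighted norms. *)
Lemma wbounded_cauchy_der r k M f : 0 <= r -> ccont f -> wbounded r k M f ->
  wbounded r k (der_const r k * M) (cauchy_der f).
Proof.
move=> r0 fc Hf z.
have -> : der_const r k * M * wt r k z =
  cauchy_norm R * (2 * (wt_growth r k 2 * M * wt r k z)) by rewrite /der_const; ring.
apply: cmod_cauchy_der_le => // w w2.
apply: (le_trans (cmodD _ _)); rewrite cmodN mulrDl mul1r lerD//.
  exact: wbounded_near.
by rewrite -{1}[z]addr0; apply: wbounded_near => //; rewrite cmod0.
Qed.

Definition lip_const r k rho : R :=
  cauchy_norm R * (2 * (2 * (wt_growth r k (2 + rho) * der_const r k))).

Lemma lip_const_ge0 r k rho : 0 <= lip_const r k rho.
Proof.
apply: mulr_ge0; first exact: cauchy_norm_ge0.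
do 2 apply: mulr_ge0 => //.
by apply: mulr_ge0; [exact: wt_growth_ge0|exact: der_const_ge0].
Qed.

(** Cauchy's estimate is applied to the increment [f (w + h) - f w] as a function of [w], which the
    mean value inequality makes proportional to |h|. The existence of a second derivative is deduced
    later from this bound. *)
Lemma cauchy_der_lipschitz r k rho M f z h : 0 <= r -> entire f -> wbounded r k M f ->
  cmod h <= rho ->
  cmod (cauchy_der f (z + h) - cauchy_der f z) <= lip_const r k rho * M * wt r k z * cmod h.
Proof.
move=> r0 ef Hf h1; have fc := entire_ccont ef.
have Hf' := wbounded_cauchy_der r0 fc Hf.
have efh := @entire_shift f h ef.
have ge := entireB efh ef.
have gE : cauchy_der (fun w => f (w + h) - f w) z = cauchy_der f (z + h) - cauchy_der f z.
  apply: (cauchy_der_cder ge).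
  exact: cderB (cder_shift (cder_cauchy (z + h) ef)) (cder_cauchy z ef).
pose B := 2 * (wt_growth r k (2 + rho) * (der_const r k * M) * wt r k z) * cmod h.
have gB w : cmod w <= 2 -> cmod (f (z + w + h) - f (z + w)) <= B.
  move=> w2; apply: (cmod_increment_le (fun w => cder_cauchy w ef)) => t t01.
  rewrite -addrA; apply: wbounded_near => //.
  apply: (le_trans (cmodD _ _)); rewrite cmodM cmod_real.
  rewrite lerD// -[leRHS]mulr1 ler_pM ?cmod_ge0// ger0_norm; lra.
rewrite -gE; have -> : lip_const r k rho * M * wt r k z * cmod h = cauchy_norm R * (2 * B).
  by rewrite /lip_const /B; ring.
apply: (cmod_cauchy_der_le (entire_ccont ge)) => w w2.
apply: (le_trans (cmodD _ _)); rewrite cmodN mulrDl mul1r lerD ?gB//.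
by have := gB 0; rewrite addr0; apply; rewrite cmod0.
Qed.

(** The mean value inequality for [f w - cauchy_der f z * w], whose derivative vanishes at [z] and
    is Lipschitz. *)
Lemma taylor1 r k rho M f z h : 0 <= r -> entire f -> wbounded r k M f ->
  cmod h <= rho ->
  cmod (f (z + h) - f z - h * cauchy_der f z) <=
    2 * lip_const r k rho * M * wt r k z * cmod h ^+ 2.
Proof.
move=> r0 ef Hf h1.
have gd w : cder (fun w => f w - cauchy_der f z * w) w (cauchy_der f w - cauchy_der f z * 1).
  by apply: cderB; [exact: cder_cauchy|apply: cderZ; exact: cder_id].
have := cmod_increment_le gd (z := z) (h := h) (M := lip_const r k rho * M * wt r k z * cmod h).
have -> : f (z + h) - cauchy_der f z * (z + h) - (f z - cauchy_der f z * z) =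
  f (z + h) - f z - h * cauchy_der f z by ring.
have -> : 2 * (lip_const r k rho * M * wt r k z * cmod h) * cmod h =
  2 * lip_const r k rho * M * wt r k z * cmod h ^+ 2 by ring.
apply=> t t01; rewrite mulr1.
have ht : cmod (h * t%:C) <= cmod h.
  by rewrite cmodM cmod_real -[leRHS]mulr1 ler_wpM2l ?cmod_ge0// ger0_norm; lra.
apply: (le_trans (cauchy_der_lipschitz z r0 ef Hf (le_trans ht h1))).
have c0 := mulr_ge0 (mulr_ge0 (lip_const_ge0 r k rho) (wbounded_ge0 Hf)) (ltW (wt_gt0 r k z)).
exact: ler_wpM2l c0 _ _ ht.
Qed.

Lemma cder_quadratic f z d (C : R) :
  (forall h, cmod h <= 1 -> cmod (f (z + h) - f z - d * h) <= C * cmod h ^+ 2) ->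
  cder f z d.
Proof.
move=> H e e0; have C0 : 0 < `|C| + 1 by rewrite ltr_wpDl.
exists (Num.min 1 (e / (`|C| + 1))); first by rewrite lt_min ltr01 divr_gt0.
move=> h; rewrite lt_min => /andP[h1]; rewrite ltr_pdivlMr// => h2.
apply: (le_trans (H _ (ltW h1))); rewrite expr2 mulrA ler_wpM2r ?cmod_ge0//.
apply: le_trans (ltW h2); rewrite mulrC ler_wpM2l ?cmod_ge0//.
by rewrite (le_trans (ler_norm _))// lerDl.
Qed.

Lemma ccont_lipschitz f (L : R[i] -> R) :
  (forall z h, cmod h <= 1 -> cmod (f (z + h) - f z) <= L z * cmod h) -> ccont f.
Proof.
move=> H z e e0; have C0 : 0 < `|L z| + 1 by rewrite ltr_wpDl.
exists (Num.min 1 (e / (`|L z| + 1))); first by rewrite lt_min ltr01 divr_gt0.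
move=> h; rewrite lt_min => /andP[h1]; rewrite ltr_pdivlMr// => h2.
apply: (le_trans (H _ _ (ltW h1))).
apply: le_trans (ltW h2); rewrite mulrC ler_wpM2l ?cmod_ge0//.
by rewrite (le_trans (ler_norm _))// lerDl.
Qed.

(** The Cauchy integral is linear in the function and commutes with translations. Applied to the
    Taylor remainder of [f] it gives the Taylor remainder of [cauchy_der f], so the quadratic
    estimate carries over. *)
Lemma entire_cauchy_der r k M f : 0 <= r -> entire f -> wbounded r k M f ->
  entire (cauchy_der f).
Proof.
move=> r0 ef Hf; have fc := entire_ccont ef.
have dc : ccont (cauchy_der f).
  by apply: (@ccont_lipschitz _ (fun z => lip_const r k 1 * M * wt r k z)) => z h h1;
    exact: cauchy_der_lipschitz.
apply/entireP => z; exists (cauchy_der (cauchy_der f) z).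
apply: (@cder_quadratic _ _ _ (cauchy_norm R *
  (2 * (2 * lip_const r k 1 * M * (wt_growth r k 2 * wt r k z))))) => h h1.
pose rem w := f (w + h) + -1 * f w + (- h) * cauchy_der f w.
have c1 : ccont (fun w => f (w + h)) by apply/entire_ccont/entire_shift.
have c2 : ccont (fun w => -1 * f w) by apply/entire_ccont/entireZ.
have c3 : ccont (fun w => - h * cauchy_der f w).
  by move=> w; apply: ccont_atM; [exact: ccont_cst|exact: dc].
have c12 : ccont (fun w => f (w + h) + -1 * f w) by move=> w; exact: ccont_atD.
have remc : ccont rem by move=> w; exact: ccont_atD.
have -> : cauchy_der f (z + h) - cauchy_der f z - cauchy_der (cauchy_der f) z * h =
    cauchy_der rem z.
  rewrite [RHS](cauchy_derD _ c12 c3) (cauchy_derD _ c1 c2) cauchy_der_shift.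
  rewrite (cauchy_derZ _ _ fc) (cauchy_derZ _ _ dc); ring.
rewrite -mulrA; apply: cmod_cauchy_der_le => // w w2.
have R1 u : cmod u <= 2 -> cmod (rem (z + u)) <=
    2 * lip_const r k 1 * M * (wt_growth r k 2 * wt r k z) * cmod h ^+ 2.
  move=> u2; rewrite /rem mulN1r mulNr.
  apply: (le_trans (taylor1 (z + u) r0 ef Hf h1)).
  have c0 := mulr_ge0 (mulr_ge0 (ler0n R 2) (lip_const_ge0 r k 1)) (wbounded_ge0 Hf).
  by rewrite ler_wpM2r ?exprn_ge0 ?cmod_ge0// (ler_wpM2l c0)// wt_shift.
apply: (le_trans (cmodD _ _)); rewrite cmodN -mulrA mulrDl mul1r lerD ?R1//.
by have := R1 0; rewrite addr0; apply; rewrite cmod0.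
Qed.

Lemma entire_iter_cauchy_der r (Mk : R -> R) f n : 0 <= r -> entire f ->
  (forall k, wbounded r k (Mk k) f) ->
  entire (iter n (@cauchy_der R) f) /\
  forall k, wbounded r k (der_const r k ^+ n * Mk k) (iter n (@cauchy_der R) f).
Proof.
move=> r0 ef Hf; elim: n => [|n [I1 I2]]; first by split => // k; rewrite mul1r.
split; first exact: entire_cauchy_der I1 (I2 0).
by move=> k; rewrite exprS -mulrA; apply: wbounded_cauchy_der => //; exact: entire_ccont.
Qed.

(** The real derivatives are the traces of the iterates of [cauchy_der], which are bounded in every
    weight. On the real line the exponential factor of the weight is 1, and the exponent [k = m]
    absorbs [x ^+ m]. *)
Lemma schwartz_entire r (Mk : R -> R) f : 0 <= r -> entire f ->
  (forall k, wbounded r k (Mk k) f) -> schwartz (fun x => f x%:C).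
Proof.
move=> r0 ef Hf.
have DE n (x : R) : is_derive x 1 (fun x : R => complex.Re (iter n (@cauchy_der R) f x%:C))
    (complex.Re (iter n.+1 (@cauchy_der R) f x%:C)) /\
  is_derive x 1 (fun x : R => complex.Im (iter n (@cauchy_der R) f x%:C))
    (complex.Im (iter n.+1 (@cauchy_der R) f x%:C)).
  have [en _] := entire_iter_cauchy_der n r0 ef Hf.
  have := @cder_line R (iter n (@cauchy_der R) f) 0 1 _ x.
  rewrite add0r mul1r => /(_ _ (cder_cauchy _ en)).
  rewrite mulr1 iterS.
  by under eq_fun do rewrite add0r mul1r;
     under [X in _ /\ is_derive _ _ X _]eq_fun do rewrite add0r mul1r.
have reE n : derive1n n (fun x => complex.Re (f x%:C)) =
    fun x => complex.Re (iter n (@cauchy_der R) f x%:C).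
  elim: n => // n IH; rewrite derive1nS IH; apply/funext => x.
  by rewrite derive1E; have [[_ ->] _] := DE n x.
have imE n : derive1n n (fun x => complex.Im (f x%:C)) =
    fun x => complex.Im (iter n (@cauchy_der R) f x%:C).
  elim: n => // n IH; rewrite derive1nS IH; apply/funext => x.
  by rewrite derive1E; have [_ [_ ->]] := DE n x.
have B m n (x : R) : `|x| ^+ m * cmod (iter n (@cauchy_der R) f x%:C) <=
    der_const r m%:R ^+ n * Mk m%:R.
  have [_ /(_ m%:R x%:C)] := entire_iter_cauchy_der n r0 ef Hf.
  set M := _ * Mk _; rewrite /wt /= normr0 mulr0 expR0 mulr1 => H.
  have x0 : 0 < 1 + cmod x%:C by rewrite ltr_pwDl// cmod_ge0.
  have -> : M = (1 + cmod x%:C) ^+ m * (M * (1 + cmod x%:C) `^ (- m%:R)).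
    by rewrite powRN powR_mulrn ?ltW// mulrCA mulfV ?mulr1// expf_neq0// gt_eqF.
  apply: ler_pM => //; rewrite ?exprn_ge0 ?cmod_ge0//.
  by rewrite lerXn2r ?nnegrE// ?(ltW x0)// cmod_real lerDr.
split; split.
- by move=> n x; rewrite reE; have [[]] := DE n x.
- move=> m n; exists (der_const r m%:R ^+ n * Mk m%:R) => x.
  rewrite reE normrM normrX; apply: le_trans (B m n x).
  by rewrite ler_wpM2l ?exprn_ge0// normRe_cmod.
- by move=> n x; rewrite imE; have [_ []] := DE n x.
- move=> m n; exists (der_const r m%:R ^+ n * Mk m%:R) => x.
  rewrite imE normrM normrX; apply: le_trans (B m n x).
  by rewrite ler_wpM2l ?exprn_ge0// normIm_cmod.
Qed.

(** The intervals of radius [a n] around [u n] meet pairwise, so the supremum of their left ends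
    lies in all of them; this yields the rate together with the limit. *)
Lemma real_cauchy_limit (u a : nat -> R) :
  (forall n m, (n <= m)%N -> `|u m - u n| <= a n) ->
  exists l, forall n, `|l - u n| <= a n.
Proof.
move=> H; have a0 n : 0 <= a n by rewrite (le_trans _ (H n n _)).
have nm n m : u m - a m <= u n + a n.
  have [nm|mn] := leqP n m.
    by have := H _ _ nm; rewrite ler_norml => /andP[_]; have := a0 m; lra.
  by have := H _ _ (ltnW mn); rewrite ler_norml => /andP[]; have := a0 n; lra.
exists (sup (range (fun n => u n - a n))) => n.
rewrite ler_norml; apply/andP; split.
  rewrite lerBrDr addrC; apply: ub_le_sup; last by exists n.
  by exists (u n + a n) => _ [m _ <-].
rewrite lerBlDr addrC; apply: ge_sup; first by exists (u 0%N - a 0%N); exists 0%N.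
by move=> _ [m _ <-].
Qed.

Lemma cmod_cauchy_limit (u : nat -> R[i]) (a : nat -> R) :
  (forall n m, (n <= m)%N -> cmod (u m - u n) <= a n) ->
  exists l, forall n, cmod (l - u n) <= 2 * a n.
Proof.
move=> H.
have [|x Hx] := @real_cauchy_limit (fun n => complex.Re (u n)) a.
  by move=> n m /H; apply: le_trans; rewrite -cReN -cReD normRe_cmod.
have [|y Hy] := @real_cauchy_limit (fun n => complex.Im (u n)) a.
  by move=> n m /H; apply: le_trans; rewrite -cImN -cImD normIm_cmod.
exists (x +i* y) => n; apply: (le_trans (cmod_ReIm _)).
by rewrite cReD cReN cImD cImN mulrDl !mul1r lerD.
Qed.

Lemma le_limit0 (a : nat -> R) (x y c : R) :
  (forall e, 0 < e -> exists n, a n <= e) -> 0 <= c ->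
  (forall n, x <= y + a n * c) -> x <= y.
Proof.
move=> a0 c0 H; apply/ler_addgt0Pr => e e0.
have c1 : 0 < c + 1 by rewrite ltr_wpDl.
have [|n an] := a0 (e / (c + 1)); first by rewrite divr_gt0.
apply: (le_trans (H n)); rewrite lerD2l.
move: an; rewrite ler_pdivlMr// mulrDr => an.
have [a_ge0|a_lt0] := leP 0 (a n); first by move: an; rewrite mulr1; lra.
by rewrite (le_trans _ (ltW e0))// mulr_le0_ge0// ltW.
Qed.

(** Cauchy's estimate for the differences makes the derivatives converge too. The quadratic Taylor
    bound is uniform in [n], so it passes to the limit and shows that the limit [G'] of the
    derivatives is the derivative of [G]. *)
Lemma entire_limit r k (F : nat -> R[i] -> R[i]) (a : nat -> R) (M : R) :
  0 <= r -> (forall n, entire (F n)) -> wbounded r k M (F 0%N) ->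
  (forall e, 0 < e -> exists n, a n <= e) ->
  (forall n m, (n <= m)%N -> wbounded r k (a n) (fun z => F m z - F n z)) ->
  exists G, entire G /\ forall n, wbounded r k (2 * a n) (fun z => G z - F n z).
Proof.
move=> r0 eF F0 a0 Fa.
have lim z : exists l, forall n, cmod (l - F n z) <= 2 * (a n * wt r k z).
  by apply: cmod_cauchy_limit => n m nm; exact: Fa.
have lim' z : exists l, forall n, cmod (l - cauchy_der (F n) z) <=
    2 * (der_const r k * a n * wt r k z).
  apply: cmod_cauchy_limit => n m nm.
  rewrite -(cauchy_der_cder (entireB (eF m) (eF n))
    (cderB (cder_cauchy z (eF m)) (cder_cauchy z (eF n)))).
  apply: wbounded_cauchy_der (Fa _ _ nm) _ => //.
  exact/entire_ccont/entireB.
have [G HG] := choice lim; have [G' HG'] := choice lim'.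
exists G; split; last by move=> n z; rewrite -mulrA.
have an0 n : 0 <= a n by exact: wbounded_ge0 (Fa n n (leqnn n)).
have FM n : wbounded r k (M + a 0%N) (F n).
  have := wboundedD F0 (Fa 0%N n (leq0n n)).
  by congr (wbounded _ _ _ _); apply/funext => z; rewrite addrC subrK.
apply/entireP => z; exists (G' z).
apply: (@cder_quadratic _ _ _ (2 * lip_const r k 1 * (M + a 0%N) * wt r k z)) => h h1.
(* Collects the errors of replacing [G (z + h)], [G z] and [G' z] by their approximations of index
   [n], for |h| <= 1. *)
pose c := 2 * (wt_growth r k 1 * wt r k z + wt r k z + der_const r k * wt r k z).
have wt0 := ltW (wt_gt0 r k z).
have c0 : 0 <= c.
  apply: mulr_ge0 => //; apply: addr_ge0.
    apply: addr_ge0 => //; exact: mulr_ge0 (wt_growth_ge0 _ _ _) wt0.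
  exact: mulr_ge0 (der_const_ge0 _ _) wt0.
apply: (le_limit0 a0 c0) => n.
have -> : G (z + h) - G z - G' z * h =
  (F n (z + h) - F n z - h * cauchy_der (F n) z) +
  ((G (z + h) - F n (z + h)) - (G z - F n z) - (G' z - cauchy_der (F n) z) * h) by ring.
apply: (le_trans (cmodD _ _)); apply: lerD; first exact: taylor1.
have A1 : cmod (G (z + h) - F n (z + h)) <= 2 * (a n * (wt_growth r k 1 * wt r k z)).
  apply: (le_trans (HG _ _)); apply: ler_wpM2l => //.
  by apply: ler_wpM2l; [exact: an0|exact: wt_shift].
have A2 := HG z n.
have A3 : cmod ((G' z - cauchy_der (F n) z) * h) <= 2 * (der_const r k * a n * wt r k z).
  by rewrite cmodM -[leRHS]mulr1 ler_pM ?cmod_ge0.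
apply: (le_trans (cmodD _ _)); rewrite cmodN.
apply: (le_trans (lerD (cmodD _ _) (lexx _))); rewrite cmodN /c.
have -> : a n * (2 * (wt_growth r k 1 * wt r k z + wt r k z + der_const r k * wt r k z)) =
  2 * (a n * (wt_growth r k 1 * wt r k z)) + 2 * (a n * wt r k z) +
  2 * (der_const r k * a n * wt r k z) by ring.
by rewrite !lerD.
Qed.

End entire_functions.

(** * The Gamma kernel and its convolution operator *)

(* [t^(s-1) e^(-t) dt = log_gamma_kernel s u du] under [t = e^u]. *)
Definition log_gamma_kernel (R : realType) (s u : R) : R := expR (s * u - expR u).

Section log_gamma_kernel.
Variable R : realType.
Notation mu := (@lebesgue_measure R).
Notation W := (@log_gamma_kernel R).
Implicit Types s u p : R.

Lemma expR_ge_quadratic u : 0 <= u -> 1 + u + u ^+ 2 / 4 <= expR u.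
Proof.
move=> u0; have -> : expR u = expR (u / 2) * expR (u / 2).
  by rewrite -expRD; congr expR; field.
have -> : 1 + u + u ^+ 2 / 4 = (1 + u / 2) * (1 + u / 2) by field.
have h0 : 0 <= 1 + u / 2 by rewrite addr_ge0// divr_ge0.
by apply: ler_pM => //; exact: expR_ge1Dx.
Qed.

Lemma sqr_le_cosh u : u ^+ 2 / 4 <= expR u + expR (- u) - 2.
Proof.
wlog u0 : u / 0 <= u => [H|].
  have [/H//|u0] := leP 0 u.
  by have := H (- u); rewrite sqrrN opprK oppr_ge0 => /(_ (ltW u0)); lra.
by have := expR_ge_quadratic u0; have := expR_ge1Dx (- u); lra.
Qed.

(** From (|u|/2 - e)^2 >= 0. The mean of |u| is thus controlled by exponential moments, which for
    the Gamma law are rational in the parameter; [e] is the scale of the deviation and is chosen in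
    [nconv_limit]. *)
Lemma norm_le_cosh u (e : R) : 0 < e -> `|u| <= e + (expR u + expR (- u) - 2) / e.
Proof.
move=> e0; have H := sqr_le_cosh u; rewrite -lerBlDl ler_pdivlMr//.
apply: le_trans H; rewrite -(real_normK (num_real u)) -subr_ge0.
have -> : `|u| ^+ 2 / 4 - (`|u| - e) * e = (`|u| / 2 - e) ^+ 2 by field.
exact: sqr_ge0.
Qed.

Lemma log_gamma_kernel_gt0 s u : 0 < W s u.
Proof. exact: expR_gt0. Qed.

(** For negative [u] the factor [expR (s * u)] is the decay itself. For positive [u] the inner
    exponential dominates u^2/4, and 2 s u - u^2/4 is at most 4 s^2. *)
Lemma log_gamma_kernel_le s u : 0 < s ->
  W s u <= expR (4 * s ^+ 2) * expR (- s * `|u|).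
Proof.
move=> s0; rewrite -expRD ler_expR.
have [u0|u0] := leP 0 u.
  rewrite ger0_norm//; have H := expR_ge_quadratic u0.
  have := sqr_ge0 (u / 2 - 2 * s).
  have -> : (u / 2 - 2 * s) ^+ 2 = u ^+ 2 / 4 - 2 * (s * u) + 4 * s ^+ 2 by field.
  lra.
rewrite ltr0_norm//; have := expR_gt0 u; have := sqr_ge0 s; lra.
Qed.

Lemma power_exp_bound (s p : R) : 0 < s -> 0 <= p ->
  exists2 C, 0 < C & forall x : R, 0 <= x -> (1 + x) `^ p * expR (- s * x) <= C.
Proof.
move=> s0; rewrite le_eqVlt => /predU1P[<-|p0].
  exists 1 => // x x0; rewrite powRr0 mul1r -expR0 ler_expR.
  by rewrite mulNr oppr_le0 mulr_ge0// ltW.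
(* The exponent is the maximum of p ln(1 + x) - s x over 1 + x > 0, attained at 1 + x = p/s; the
   inequality ln y <= y - 1 at y = (s/p)(1 + x) proves it. *)
exists (expR (s - p * (1 + ln (s / p)))); first exact: expR_gt0.
move=> x x0; have x1 : 0 < 1 + x by rewrite ltr_pwDl.
rewrite /powR gt_eqF// -expRD ler_expR.
have sp : 0 < s / p by rewrite divr_gt0.
have y0 : 0 < s / p * (1 + x) by exact: mulr_gt0.
have H : ln (s / p) + ln (1 + x) <= s / p * (1 + x) - 1.
  rewrite -lnM ?posrE//.
  have y1 : -1 < s / p * (1 + x) - 1 by lra.
  by have := le_ln1Dx y1; rewrite [1 + (_ - 1)]addrC subrK.
have : p * (ln (s / p) + ln (1 + x)) <= p * (s / p * (1 + x) - 1).
  by rewrite ler_pM2l.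
have -> : p * (s / p * (1 + x) - 1) = s + s * x - p by field; rewrite gt_eqF.
lra.
Qed.

Lemma integrable_oneDsqrV : mu.-integrable setT (EFin \o (fun u => (oneDsqr u)^-1)).
Proof.
have c : continuous (fun u : R => (oneDsqr u)^-1) by exact: continuous_oneDsqrV.
apply/integrableP; split.
  by apply/measurable_EFinP; exact: continuous_measurable_fun.
under eq_integral do rewrite /= ger0_norm ?invr_ge0//.
rewrite ge0_symfun_integralT//.
- rewrite (_ : [set x | 0 <= x] = `[0, +oo[%classic); last first.
    by apply/seteqP; split => x /=; rewrite in_itv/= andbT.
  by rewrite integral0y_oneDsqr -EFinM ltry.
- by move=> x /=; rewrite /oneDsqr sqrrN.
Qed.

(** Two powers beyond [p] pay for the comparison with 1/(1 + u^2), which serves both as an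
    integrable majorant and to make boundary terms vanish. *)
Lemma log_gamma_kernel_decay s p : 0 < s -> 0 <= p ->
  exists2 C, 0 < C & forall u, W s u * (1 + `|u|) `^ p <= C * (oneDsqr u)^-1.
Proof.
move=> s0 p0; have [C C0 H] := @power_exp_bound s (p + 2) s0 (addr_ge0 p0 (ler0n _ 2)).
exists (expR (4 * s ^+ 2) * C); first by rewrite mulr_gt0// expR_gt0.
move=> u; rewrite ler_pdivlMr; last by rewrite (lt_le_trans ltr01)// oneDsqr_ge1.
have u1 : 0 < 1 + `|u| by rewrite ltr_pwDl.
apply: (@le_trans _ _ (expR (4 * s ^+ 2) * expR (- s * `|u|) * (1 + `|u|) `^ p * (1 + `|u|) ^+ 2)).
  apply: ler_pM.
  - by rewrite mulr_ge0 ?powR_ge0// ltW// log_gamma_kernel_gt0.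
  - by rewrite (le_trans ler01)// oneDsqr_ge1.
  - by rewrite ler_wpM2r ?powR_ge0// log_gamma_kernel_le.
  - rewrite /oneDsqr -[u ^+ 2](real_normK (num_real u)).
    have := normr_ge0 u; have := sqr_ge0 `|u|; rewrite sqrrD; lra.
rewrite -!mulrA ler_pM2l ?expR_gt0//.
have := H _ (normr_ge0 u); rewrite powRD; last by rewrite (gt_eqF u1) implybT.
by rewrite (powR_mulrn _ (ltW u1)) [_ * expR _]mulrC.
Qed.

Lemma continuous_log_gamma_kernel s : continuous (W s).
Proof.
move=> u; apply: continuous_comp; last exact: continuous_expR.
apply: continuousB; last exact: continuous_expR.
by apply: continuousM => //; exact: cst_continuous.
Qed.

Lemma integrable_kernel_power s p : 0 < s -> 0 <= p ->
  mu.-integrable setT (EFin \o (fun u => W s u * (1 + `|u|) `^ p)).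
Proof.
move=> s0 p0; have [C C0 H] := log_gamma_kernel_decay s0 p0.
have := rintegrableZ C (@measurableT _ _) integrable_oneDsqrV.
apply: le_rintegrable => //.
  apply: measurable_funM; first by
    apply: continuous_measurable_fun; exact: continuous_log_gamma_kernel.
  apply: (@measurableT_comp _ _ _ _ _ _ (fun x : R => x `^ p)) => //.
  exact: measurable_funD.
by move=> u _; rewrite ger0_norm ?H// mulr_ge0 ?powR_ge0// ltW// log_gamma_kernel_gt0.
Qed.

Lemma integrable_kernel s : 0 < s -> mu.-integrable setT (EFin \o W s).
Proof.
move=> s0; have := integrable_kernel_power s0 (lexx 0).
by apply: eq_rintegrable => // u _; rewrite powRr0 mulr1.
Qed.

Definition gamma_int s : R := \int[mu]_u W s u.

Lemma gamma_int_gt0 s : 0 < s -> 0 < gamma_int s.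
Proof.
move=> s0.
have H : \int[mu]_(u in `[0, 1]) expR (- expR 1) <= \int[mu]_(u in `[0, 1]) W s u.
  apply: le_Rintegral => //; first exact: itv_integrable_cst.
    by apply: integrableS (integrable_kernel s0).
  move=> u /=; rewrite in_itv/= => /andP[u0 u1]; rewrite ler_expR.
  have : expR u <= expR 1 by rewrite ler_expR.
  have : 0 <= s * u by rewrite mulr_ge0// ltW.
  lra.
have H2 : \int[mu]_(u in `[0, 1]) W s u <= gamma_int s.
  rewrite /gamma_int [leLHS]Rintegral_mkcond; apply: le_Rintegral => //.
  - rewrite -restrict_EFin; apply/integrable_restrict => //; rewrite setTI.
    by apply: integrableS (integrable_kernel s0).
  - exact: integrable_kernel.
  - by move=> u _; rewrite patchE; case: ifP => // _; exact: ltW (log_gamma_kernel_gt0 _ _).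
apply: lt_le_trans H2; apply: lt_le_trans H.
by rewrite Rintegral_itv_cst// subr0 mulr1 expR_gt0.
Qed.

(** This removes the boundary terms in integration by parts on the line: the fundamental theorem on
    [-n, n] is combined with dominated convergence, and the decay of [h] sends the end values to
    0. *)
Lemma Rintegral_derivative0 (h h' : R -> R) (C : R) :
  (forall u, is_derive u 1 h (h' u)) -> continuous h' ->
  mu.-integrable setT (EFin \o h') ->
  (forall u, `|h u| <= C * (oneDsqr u)^-1) ->
  \int[mu]_u h' u = 0.
Proof.
move=> hd hc hi hC.
pose f_ (n : nat) : R -> \bar R := (EFin \o h') \_ `[- n%:R, n%:R].
have mh : measurable_fun setT h' by exact: continuous_measurable_fun.
have hn (n : nat) : \int[mu]_(u in `[- n.+1%:R, n.+1%:R]) h' u = h n.+1%:R - h (- n.+1%:R).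
  rewrite /Rintegral (@continuous_FTC2 _ h' h) ?ltr0n//.
  - by rewrite gtrN ?ltr0n.
  - exact: continuous_subspaceT.
  - have ch : continuous h.
      by move=> u; apply/differentiable_continuous/derivable1_diffP; have [] := hd u.
    split.
    + by move=> u _; have [] := hd u.
    + by apply: cvg_at_right_filter; exact: ch.
    + by apply: cvg_at_left_filter; exact: ch.
  - by move=> u _; rewrite derive1E; have [_ ->] := hd u.
have fL : (\int[mu]_u (f_ n u) @[n --> \oo] --> \int[mu]_u (h' u)%:E)%E.
  have [] // := @dominated_convergence _ _ R mu setT measurableT f_ (EFin \o h')
    (fun u => `|(h' u)%:E|%E).
  - move=> n; apply/(measurable_restrictT _ _).1 => //.
    by apply/measurable_EFinP; exact: measurable_funTS.
  - exact/measurable_EFinP.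
  - apply/aeW => u _; apply: cvg_near_cst; near=> n.
    rewrite /f_ patchE mem_set//= in_itv/= -ler_norml; near: n.
    exact: nbhs_infty_ger.
  - exact: integrable_abse.
  - by apply/aeW => u n _; rewrite /f_ patchE; case: ifP => //= _; rewrite normr0 lee_fin.
(* The index is shifted because the fundamental theorem is applied on a non-degenerate interval. *)
have {}fL : (\int[mu]_u (f_ n.+1 u) @[n --> \oo] --> \int[mu]_u (h' u)%:E)%E.
  by rewrite (cvg_shiftS (fun n => \int[mu]_u (f_ n u))%E).
have fE n : (\int[mu]_u (f_ n.+1 u) = (h n.+1%:R - h (- n.+1%:R))%:E)%E.
  rewrite -hn /Rintegral fineK; first by rewrite [RHS]integral_mkcond.
  apply: integrable_fin_num => //.
  exact: (integrableS measurableT _ (@subsetT _ _) hi).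
have d0 : h n.+1%:R - h (- n.+1%:R) @[n --> \oo] --> (0 : R).
  apply: norm_cvg0.
  apply: (@squeeze_cvgr _ _ _ _ (cst 0) (fun n => 2 * C * harmonic n)).
  - near=> n; rewrite normr_ge0 /=.
    have C0 : 0 <= C.
      have := le_trans (normr_ge0 _) (hC 0).
      by rewrite /oneDsqr expr0n addr0 invr1 mulr1.
    have B (x : R) : `|x| = n.+1%:R -> `|h x| <= C * harmonic n.
      move=> xn; apply: (le_trans (hC x)); rewrite ler_wpM2l//.
      rewrite lef_pV2 ?posrE ?ltr0n// ?(lt_le_trans ltr01 (oneDsqr_ge1 x))//.
      rewrite /oneDsqr -(real_normK (num_real x)) xn.
      have : (1 : R) <= n.+1%:R by rewrite ler1n.
      by move=> n1; rewrite expr2 (@le_trans _ _ (n.+1%:R * n.+1%:R))// ?lerDr// ler_peMr.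
    by rewrite -mulrA mulrDl !mul1r (le_trans (ler_normB _ _))// lerD//;
      apply: B; rewrite ?normrN ger0_norm.
  - exact: cvg_cst.
  - rewrite -(mulr0 (2 * C)); apply: cvgM; [exact: cvg_cst|exact: cvg_harmonic].
have dL : ((h n.+1%:R - h (- n.+1%:R))%:E @[n --> \oo] --> 0%:E)%E.
  by apply: cvg_EFin => //; exact: nearW.
move: fL; under eq_fun do rewrite fE.
by move=> /(cvg_unique (@ereal_hausdorff R) dL) H; rewrite /Rintegral -H.
Unshelve. all: by end_near. Qed.

End log_gamma_kernel.

(* Convolution with [log_gamma_kernel s]: the Fourier multiplier
   [Gamma(s - i xi)]. *)
Definition lgconv (R : realType) (s : R) (G : R[i] -> R[i]) (z : R[i]) : R[i] :=
  cintegral setT (fun u => (log_gamma_kernel s u)%:C * G (z - u%:C)).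

(** Up to a factor 2, this bounds the convolution in a weight with |k| = p: a translation by a real
    [u] costs (1 + |u|)^p. *)
Definition kernel_moment (R : realType) (s p : R) : R :=
  \int[@lebesgue_measure R]_u (log_gamma_kernel s u * (1 + `|u|) `^ p).

Section log_gamma_convolution.
Variable R : realType.
Notation mu := (@lebesgue_measure R).
Notation W := (@log_gamma_kernel R).
Implicit Types (s u p r k M : R) (G H : R[i] -> R[i]) (z h : R[i]).

(** Real translations leave the imaginary part alone, so the exponential factor is unchanged and the
    cost is polynomial. A cost of exp(r |u|) could not be integrated against the kernel for r >= s,
    since the kernel decays only like exp(s u) at minus infinity. *)
Lemma wt_real_shift r k z (a : R) :
  wt r k (z + a%:C) <= (1 + `|a|) `^ `|k| * wt r k z.
Proof.
have wtE (w : R[i]) : wt r k w = wt 0 k w * expR (r * `|complex.Im w|).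
  by rewrite /wt mul0r expR0 mulr1.
rewrite !wtE cImD /= addr0 mulrA ler_pM2r ?expR_gt0//.
apply: (le_trans (@wt_shift _ 0 k `|a| z a%:C (lexx _) _)).
  by rewrite cmod_real.
by rewrite /wt_growth mul0r expR0 mulr1.
Qed.

Lemma rcont_line G z (u : R) : ccont_at G (z - u%:C) -> rcont (fun t => G (z - t%:C)) u.
Proof.
move=> Gc e /Gc[del del0 H]; exists del => // t td.
have := H (- t%:C); rewrite cmodN cmod_real => /(_ td).
by rewrite realcD opprD addrA.
Qed.

Lemma cintegrable_scale (w h : R -> R) (g : R -> R[i]) : continuous w ->
  (forall t, rcont g t) -> mu.-integrable setT (EFin \o h) ->
  (forall t, `|w t| * cmod (g t) <= h t) ->
  cintegrable setT (fun t => (w t)%:C * g t).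
Proof.
move=> wc gc hi B; have mw : measurable_fun setT w by exact: continuous_measurable_fun.
have [mr mi] := rcont_measurable gc; split.
- apply: le_rintegrable hi => //.
    apply: (@eq_measurable_fun _ _ _ _ _ (fun t => w t * complex.Re (g t))).
      by move=> t _; rewrite cReM /= mul0r subr0.
    exact: measurable_funM.
  by move=> t _; apply: le_trans (B t); rewrite -(cmod_real (w t)) -cmodM normRe_cmod.
- apply: le_rintegrable hi => //.
    apply: (@eq_measurable_fun _ _ _ _ _ (fun t => w t * complex.Im (g t))).
      by move=> t _; rewrite cImM /= mul0r addr0.
    exact: measurable_funM.
  by move=> t _; apply: le_trans (B t); rewrite -(cmod_real (w t)) -cmodM normIm_cmod.
Qed.

(** The bound is on the horizontal line through [z] alone, so that [cder_lgconv] can apply it to a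
    Taylor remainder, with a constant quadratic in [h]. *)
Lemma lgconv_integrable_le s p (c : R) G z : 0 < s -> 0 <= p -> ccont G ->
  (forall u, cmod (G (z - u%:C)) <= c * (1 + `|u|) `^ p) ->
  cintegrable setT (fun u => (W s u)%:C * G (z - u%:C)) /\
  cmod (lgconv s G z) <= 2 * kernel_moment s p * c.
Proof.
move=> s0 p0 Gc B.
have hi := rintegrableZ c (@measurableT _ _) (integrable_kernel_power s0 p0).
have hB t : `|W s t| * cmod (G (z - t%:C)) <= c * (W s t * (1 + `|t|) `^ p).
  rewrite ger0_norm ?(ltW (log_gamma_kernel_gt0 _ _))// mulrCA ler_pM2l//.
  exact: log_gamma_kernel_gt0.
have ci : cintegrable setT (fun u => (W s u)%:C * G (z - u%:C)).
  apply: cintegrable_scale hi hB; first exact: continuous_log_gamma_kernel.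
  by move=> t; apply: rcont_line; exact: Gc.
split => //; apply: (le_trans (cmod_cintegral_le _ ci hi _)) => //.
  by move=> t _; rewrite cmodM cmod_real.
by rewrite RintegralZl// ?[c * _]mulrC ?mulrA//; exact: integrable_kernel_power.
Qed.

Lemma kernel_moment_ge0 s p : 0 <= kernel_moment s p.
Proof.
apply: Rintegral_ge0 => u _.
by rewrite mulr_ge0 ?powR_ge0// ltW// log_gamma_kernel_gt0.
Qed.

Lemma wbounded_line r k M G z u : wbounded r k M G ->
  cmod (G (z - u%:C)) <= M * wt r k z * (1 + `|u|) `^ `|k|.
Proof.
move=> HG; apply: (le_trans (HG _)); rewrite -mulrA ler_wpM2l ?(wbounded_ge0 HG)//.
by rewrite mulrC -[`|u|]normrN -realcN wt_real_shift.
Qed.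

Lemma lgconv_integrable s r k M G z : 0 < s -> ccont G -> wbounded r k M G ->
  cintegrable setT (fun u => (W s u)%:C * G (z - u%:C)).
Proof.
move=> s0 Gc HG.
by have [] := lgconv_integrable_le s0 (normr_ge0 k) Gc (fun u => wbounded_line z u HG).
Qed.

Lemma wbounded_lgconv s r k M G : 0 < s -> ccont G -> wbounded r k M G ->
  wbounded r k (2 * kernel_moment s `|k| * M) (lgconv s G).
Proof.
move=> s0 Gc HG z; rewrite -mulrA.
by have [] := lgconv_integrable_le s0 (normr_ge0 k) Gc (fun u => wbounded_line z u HG).
Qed.

Lemma lgconvD s r k M N G H z : 0 < s -> ccont G -> wbounded r k M G ->
  ccont H -> wbounded r k N H ->
  lgconv s (fun w => G w + H w) z = lgconv s G z + lgconv s H z.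
Proof.
move=> s0 Gc HG Hc HH; rewrite /lgconv -cintegralD//;
  try exact: lgconv_integrable.
by apply: eq_cintegral => u _; rewrite mulrDr.
Qed.

Lemma lgconvZ s r k M c G z : 0 < s -> ccont G -> wbounded r k M G ->
  lgconv s (fun w => c * G w) z = c * lgconv s G z.
Proof.
move=> s0 Gc HG; rewrite /lgconv -cintegralZ//; last exact: lgconv_integrable HG.
by apply: eq_cintegral => u _; rewrite mulrCA.
Qed.

Lemma lgconv_shift s G a z : lgconv s (fun w => G (w + a)) z = lgconv s G (z + a).
Proof. by rewrite /lgconv; apply: eq_cintegral => u _; rewrite addrAC. Qed.

(** Differentiation under the integral: the Taylor remainder of [G] is integrated against the
    kernel, and its bound stays quadratic in [h]. *)
Lemma cder_lgconv s r k M G z : 0 < s -> 0 <= r -> entire G -> wbounded r k M G ->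
  cder (lgconv s G) z (lgconv s (cauchy_der G) z).
Proof.
move=> s0 r0 eG HG; have Gc := entire_ccont eG.
have eG' := entire_cauchy_der r0 eG HG; have G'c := entire_ccont eG'.
have HG' := wbounded_cauchy_der r0 Gc HG.
apply: (@cder_quadratic _ _ _ _
  (2 * kernel_moment s `|k| * (2 * lip_const r k 1 * M * wt r k z))) => h h1.
pose G1 w := G (w + h).
pose G2 w := -1 * G w.
pose G3 w := - h * cauchy_der G w.
have c1 : ccont G1 by apply/entire_ccont/entire_shift.
have c2 : ccont G2 by apply/entire_ccont/entireZ.
have c3 : ccont G3 by apply/entire_ccont/entireZ.
have H1 : wbounded r k _ G1 := @wbounded_shift _ r k M h G r0 HG.
have H2 : wbounded r k _ G2 := @wboundedZ _ r k M (-1) G HG.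
have H3 : wbounded r k _ G3 := @wboundedZ _ r k _ (- h) _ HG'.
have H12 := wboundedD H1 H2.
have c12 : ccont (fun w => G1 w + G2 w) by move=> w; exact: ccont_atD.
have c123 : ccont (fun w => G1 w + G2 w + G3 w) by move=> w; exact: ccont_atD.
have -> : lgconv s G (z + h) - lgconv s G z - lgconv s (cauchy_der G) z * h =
    lgconv s (fun w => G1 w + G2 w + G3 w) z.
  rewrite (lgconvD _ s0 c12 H12 c3 H3) (lgconvD _ s0 c1 H1 c2 H2).
  rewrite lgconv_shift (lgconvZ _ _ s0 Gc HG) (lgconvZ _ _ s0 G'c HG'); ring.
have B u : cmod (G1 (z - u%:C) + G2 (z - u%:C) + G3 (z - u%:C)) <=
    2 * lip_const r k 1 * M * wt r k z * cmod h ^+ 2 * (1 + `|u|) `^ `|k|.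
  rewrite /G1 /G2 /G3 mulN1r mulNr; apply: (le_trans (taylor1 _ r0 eG HG h1)).
  rewrite [leRHS]mulrAC ler_wpM2r ?exprn_ge0 ?cmod_ge0// -[leRHS]mulrA.
  have c0 := mulr_ge0 (mulr_ge0 (ler0n R 2) (lip_const_ge0 r k 1)) (wbounded_ge0 HG).
  apply: (ler_wpM2l c0).
  by rewrite [leRHS]mulrC -[`|u|]normrN -realcN wt_real_shift.
rewrite -[leRHS]mulrA.
by have [_] := lgconv_integrable_le s0 (normr_ge0 k) c123 B.
Qed.

Lemma entire_lgconv s r k M G : 0 < s -> 0 <= r -> entire G -> wbounded r k M G ->
  entire (lgconv s G).
Proof.
move=> s0 r0 eG HG; apply/entireP => z; exists (lgconv s (cauchy_der G) z).
exact: cder_lgconv HG.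
Qed.

Lemma log_gamma_kernelS s u : W (s + 1) u = expR u * W s u.
Proof. by rewrite /log_gamma_kernel -expRD; congr expR; ring. Qed.

Lemma is_derive_kernel s u : is_derive u 1 (W s) (s * W s u - W (s + 1) u).
Proof.
rewrite log_gamma_kernelS /log_gamma_kernel.
have D : is_derive u 1 (fun u => s * u - expR u) (s * 1 - expR u).
  by apply: is_deriveB; apply: is_deriveZ.
have := @is_derive1_comp _ expR (fun u => s * u - expR u) u _ _ (is_derive_expR _) D.
by move=> H; apply: is_derive_eq H _; ring.
Qed.

(** On the Fourier side, Gamma(s + 1 - i xi) = (s - i xi) Gamma(s - i xi). The difference of the
    integrands is the derivative in [u] of [W s u] times [G (z - u)], because W_s' = s W_s -
    W_(s+1), and that product decays at both ends. *)
Lemma lgconv_by_parts s r k M G z : 0 < s -> 0 <= r -> entire G -> wbounded r k M G ->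
  s%:C * lgconv s G z - lgconv s (cauchy_der G) z = lgconv (s + 1) G z.
Proof.
move=> s0 r0 eG HG; have Gc := entire_ccont eG.
have eG' := entire_cauchy_der r0 eG HG; have G'c := entire_ccont eG'.
have HG' := wbounded_cauchy_der r0 Gc HG.
have s10 : 0 < s + 1 by rewrite addr_gt0.
have [i1r i1i] := lgconv_integrable z s0 Gc HG.
have [i2r i2i] := lgconv_integrable z s0 G'c HG'.
have [i3r i3i] := lgconv_integrable z s10 Gc HG.
have [C C0 decay] := log_gamma_kernel_decay s0 (normr_ge0 k).
have c0 : 0 <= M * wt r k z by rewrite mulr_ge0 ?(wbounded_ge0 HG)// ltW// wt_gt0.
have bnd u : cmod ((W s u)%:C * G (z - u%:C)) <= M * wt r k z * C * (oneDsqr u)^-1.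
  rewrite cmodM cmod_real ger0_norm; last exact: ltW (log_gamma_kernel_gt0 _ _).
  apply: (@le_trans _ _ (M * wt r k z * (W s u * (1 + `|u|) `^ `|k|))).
    rewrite mulrCA ler_pM2l ?log_gamma_kernel_gt0//; exact: wbounded_line.
  by rewrite -[leRHS]mulrA ler_wpM2l.
have line u : z - u%:C = z + -1 * u%:C by rewrite mulN1r.
(* [P] stands for either of the two projections to the reals, so that the integration by parts is
   done once for both components. *)
have main (P : R[i] -> R) (Pc : forall t, {for t, continuous (fun u => P (G (z - u%:C)))})
    (Pc' : forall t, {for t, continuous (fun u => P (cauchy_der G (z - u%:C)))}) :
  (forall (a : R) w, P (a%:C * w) = a * P w) -> (forall w, `|P w| <= cmod w) ->
  (forall u, is_derive u 1 (fun u => P (G (z - u%:C))) (- P (cauchy_der G (z - u%:C)))) ->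
  mu.-integrable setT (EFin \o (fun u => P ((W s u)%:C * G (z - u%:C)))) ->
  mu.-integrable setT (EFin \o (fun u => P ((W s u)%:C * cauchy_der G (z - u%:C)))) ->
  mu.-integrable setT (EFin \o (fun u => P ((W (s + 1) u)%:C * G (z - u%:C)))) ->
  s * \int[mu]_u P ((W s u)%:C * G (z - u%:C)) -
    \int[mu]_u P ((W s u)%:C * cauchy_der G (z - u%:C)) =
  \int[mu]_u P ((W (s + 1) u)%:C * G (z - u%:C)).
  move=> Pl Pn Pd i1 i2 i3.
  apply/eqP; rewrite -subr_eq0; apply/eqP.
  have mT : @measurable _ (measurableTypeR R) setT by [].
  have i1s := rintegrableZ s mT i1.
  have i12 := rintegrableB mT i1s i2.
  rewrite -RintegralZl// -RintegralB// -RintegralB//.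
  apply: (@Rintegral_derivative0 _ (fun u => W s u * P (G (z - u%:C))) _ (M * wt r k z * C)).
  - move=> u; have D := is_deriveM (is_derive_kernel s u) (Pd u).
    by apply: is_derive_eq D _; rewrite !Pl /GRing.scale /=; ring.
  - under eq_fun do rewrite !Pl.
    move=> t; apply: cvgB; [apply: cvgB|].
    + apply: cvgM; [exact: cvg_cst|].
      by apply: cvgM; [exact: continuous_log_gamma_kernel|exact: Pc].
    + by apply: cvgM; [exact: continuous_log_gamma_kernel|exact: Pc'].
    + by apply: cvgM; [exact: continuous_log_gamma_kernel|exact: Pc].
  - exact: rintegrableB.
  - by move=> u; rewrite -Pl; apply: le_trans (Pn _) (bnd u).
have GRI t := rcont_ReIm (rcont_line (Gc (z - t%:C))).
have GRI' t := rcont_ReIm (rcont_line (G'c (z - t%:C))).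
have D (t : R) : is_derive t 1 (fun u : R => complex.Re (G (z - u%:C)))
     (- complex.Re (cauchy_der G (z - t%:C))) /\
   is_derive t 1 (fun u : R => complex.Im (G (z - u%:C)))
     (- complex.Im (cauchy_der G (z - t%:C))).
  have := cder_line (a := z) (b := -1) (t := t) (cder_cauchy _ eG).
  rewrite mulrN1 cReN cImN mulN1r.
  by under eq_fun do rewrite mulN1r;
     under [X in _ /\ is_derive _ _ X _]eq_fun do rewrite mulN1r.
apply: complexP; rewrite ?(cReD, cImD, cReN, cImN, cReM, cImM) /= mul0r ?subr0 ?addr0.
- apply: main => //.
  + by move=> t; have [] := GRI t.
  + by move=> t; have [] := GRI' t.
  + by move=> a w; rewrite cReM /= mul0r subr0.
  + exact: normRe_cmod.
  + by move=> t; have [] := D t.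
- apply: main => //.
  + by move=> t; have [] := GRI t.
  + by move=> t; have [] := GRI' t.
  + by move=> a w; rewrite cImM /= mul0r addr0.
  + exact: normIm_cmod.
  + by move=> t; have [] := D t.
Qed.

Lemma lgconv_cst1 s z : lgconv s (fun=> 1) z = (gamma_int s)%:C.
Proof.
rewrite /lgconv /cintegral; apply: complexP => /=.
  by apply: eq_Rintegral => u _; rewrite mulr1 mul0r subr0.
rewrite (_ : (fun u => _) = cst 0); last by apply/funext => u; rewrite mulr0 mul0r addr0.
by rewrite Rintegral_cst// mul0r.
Qed.

(** The constant 1 is bounded for the trivial weight [r = k = 0], and for it the integration by
    parts becomes Euler's recursion. *)
Lemma gamma_intS s : 0 < s -> gamma_int (s + 1) = s * gamma_int s.
Proof.
move=> s0.
have e1 : entire (fun=> 1 : R[i]).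
  by apply/entireP => z; exists 0; exact: cder_cst.
have b1 : wbounded 0 0 1 (fun=> 1 : R[i]).
  by move=> z; rewrite /wt oppr0 powRr0 !mul1r mul0r expR0 cmod1.
have := @lgconv_by_parts s 0 0 1 (fun=> 1) 0 s0 (lexx _) e1 b1.
rewrite !lgconv_cst1.
have -> : lgconv s (cauchy_der (fun=> 1)) 0 = 0.
  have -> : cauchy_der (fun=> 1) = (fun=> 0 * (1 : R[i])).
    by apply/funext => z; rewrite mul0r; apply: cauchy_der_cder => //; exact: cder_cst.
  by rewrite (lgconvZ _ _ s0 (entire_ccont e1) b1) mul0r.
by rewrite subr0 -realcM => /complexI ->.
Qed.

End log_gamma_convolution.

(** * The Euler product of [1/Gamma] *)

(* [nconv s G z] is the mean of [G (z + ln s - U)], where [e^U] is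
   Gamma(s)-distributed; it tends to [G z] as [s] grows. *)
Definition nconv (R : realType) (s : R) (G : R[i] -> R[i]) (z : R[i]) : R[i] :=
  (gamma_int s)^-1%:C * lgconv s G (z + (ln s)%:C).

(* The factor [1 - D/s] of the Euler product of [1/Gamma], followed by the
   translation that makes the product converge. *)
Definition euler_step (R : realType) (s : R) (G : R[i] -> R[i]) (z : R[i]) : R[i] :=
  let w := z + (ln (1 + s^-1))%:C in G w - s^-1%:C * cauchy_der G w.

Fixpoint euler_prod (R : realType) (g : R) (G : R[i] -> R[i]) (n : nat) : R[i] -> R[i] :=
  if n is m.+1 then euler_step (g + m%:R) (euler_prod g G m) else G.

Section euler_product.
Variable R : realType.
Notation mu := (@lebesgue_measure R).
Notation W := (@log_gamma_kernel R).
Implicit Types (s t r k M : R) (G H : R[i] -> R[i]) (z : R[i]).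

Lemma ln_step_bounds s : 0 < s ->
  [/\ 0 <= ln (1 + s^-1), ln (1 + s^-1) <= s^-1 &
      `|ln (1 + s^-1) - s^-1| <= (s^-1) ^+ 2].
Proof.
move=> s0; set a := s^-1; have a0 : 0 < a by rewrite invr_gt0.
have a1 : 0 < 1 + a by rewrite addr_gt0.
have up : ln (1 + a) <= a by apply: le_ln1Dx; lra.
(* The lower bound comes from the upper bound ln(1 + x) <= x at x = - a/(1 + a), since 1/(1 + a) = 1
   - a/(1 + a). *)
have lo : a - a ^+ 2 <= ln (1 + a).
  have q : 0 < (1 + a)^-1 by rewrite invr_gt0.
  have qE : (1 + a)^-1 = 1 + (- (a / (1 + a))) by field; rewrite gt_eqF.
  have := @le_ln1Dx R (- (a / (1 + a))).
  rewrite -qE lnV ?posrE// => H.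
  have {}H : - ln (1 + a) <= - (a / (1 + a)) by apply: H; lra.
  have : a - a ^+ 2 <= a / (1 + a).
    rewrite ler_pdivlMr// -subr_ge0.
    have -> : a - (a - a ^+ 2) * (1 + a) = a * a * a by ring.
    by rewrite !mulr_ge0// ltW.
  lra.
split => //; first by rewrite ln_ge0// lerDl ltW.
rewrite ler_norml; apply/andP; split; last by have := sqr_ge0 a; lra.
lra.
Qed.

Definition euler_step_const (r k rho : R) : R :=
  3 * lip_const r k rho + der_const r k.

Lemma euler_step_const_ge0 r k rho : 0 <= euler_step_const r k rho.
Proof.
by apply: addr_ge0; [apply: mulr_ge0 => //; exact: lip_const_ge0|exact: der_const_ge0].
Qed.

Lemma entire_euler_step s r k M G : 0 <= r -> entire G -> wbounded r k M G ->
  entire (euler_step s G).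
Proof.
move=> r0 eG HG; have eG' := entire_cauchy_der r0 eG HG.
have e1 := @entire_shift _ _ (ln (1 + s^-1))%:C eG.
have e2 := @entireZ _ s^-1%:C _ (@entire_shift _ _ (ln (1 + s^-1))%:C eG').
exact: entireB e1 e2.
Qed.

(** With [a = s^-1] and [h = ln (1 + a)], the step minus the identity is the Taylor remainder at
    [h], minus [a] times an increment of the derivative, plus [h - a] times the derivative. Each is
    O(a^2), as h = a + O(a^2); they contribute 2 and 1 Lipschitz constants and one [der_const]. The
    radius [g^-1] bounds every [h], so the constant is uniform in [s >= g]. *)
Lemma wbounded_euler_stepB g s r k M G : 0 < g -> g <= s -> 0 <= r -> entire G ->
  wbounded r k M G ->
  wbounded r k ((s^-1) ^+ 2 * (euler_step_const r k g^-1 * M))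
    (fun z => euler_step s G z - G z).
Proof.
move=> g0 gs r0 eG HG z.
have s0 := lt_le_trans g0 gs.
have [h0 hs hd] := ln_step_bounds s0.
have sg : s^-1 <= g^-1 by rewrite lef_pV2.
rewrite /euler_step; set h := ln _ in h0 hs hd *; set a := s^-1 in sg hs hd *.
have a0 : 0 <= a by rewrite invr_ge0 ltW.
have hc : cmod h%:C <= g^-1 by rewrite cmod_real ger0_norm// (le_trans hs).
have Gc := entire_ccont eG.
have T1 := taylor1 z r0 eG HG hc.
have T2 := cauchy_der_lipschitz z r0 eG HG hc.
have T3 := wbounded_cauchy_der r0 Gc HG z.
move: T1 T2; rewrite cmod_real ger0_norm//.
set L := lip_const _ _ _ => T1 T2.
have -> : G (z + h%:C) - a%:C * cauchy_der G (z + h%:C) - G z =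
  (G (z + h%:C) - G z - h%:C * cauchy_der G z) -
  a%:C * (cauchy_der G (z + h%:C) - cauchy_der G z) +
  (h - a)%:C * cauchy_der G z by rewrite realcD realcN; ring.
apply: (le_trans (cmodD _ _)); apply: (le_trans (lerD (cmodD _ _) (lexx _))).
rewrite cmodN (cmodM a%:C) (cmodM (h - a)%:C) !cmod_real (ger0_norm a0).
have c0 : 0 <= L * M * wt r k z.
  exact: mulr_ge0 (mulr_ge0 (lip_const_ge0 r k _) (wbounded_ge0 HG)) (ltW (wt_gt0 r k z)).
have c1 : 0 <= der_const r k * M * wt r k z.
  exact: mulr_ge0 (mulr_ge0 (der_const_ge0 r k) (wbounded_ge0 HG)) (ltW (wt_gt0 r k z)).
have hh : h ^+ 2 <= a ^+ 2 by rewrite lerXn2r ?nnegrE.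
have B1 : 2 * L * M * wt r k z * h ^+ 2 <= 2 * (L * M * wt r k z) * a ^+ 2.
  have -> : 2 * L * M * wt r k z * h ^+ 2 = 2 * (L * M * wt r k z) * h ^+ 2 by ring.
  exact: ler_wpM2l (mulr_ge0 (ler0n R 2) c0) _ _ hh.
have B2 : a * cmod (cauchy_der G (z + h%:C) - cauchy_der G z) <= (L * M * wt r k z) * a ^+ 2.
  apply: (@le_trans _ _ (a * (L * M * wt r k z * a))).
    by rewrite ler_wpM2l// (le_trans T2)// ler_wpM2l.
  by rewrite le_eqVlt; apply/orP; left; apply/eqP; ring.
have B3 : `|h - a| * cmod (cauchy_der G z) <= a ^+ 2 * (der_const r k * M * wt r k z).
  by rewrite ler_pM ?cmod_ge0.
have -> : a ^+ 2 * (euler_step_const r k g^-1 * M) * wt r k z =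
   2 * (L * M * wt r k z) * a ^+ 2 + (L * M * wt r k z) * a ^+ 2 +
   a ^+ 2 * (der_const r k * M * wt r k z).
  by rewrite /euler_step_const -/L; ring.
apply: lerD; first by apply: lerD; [exact: le_trans T1 B1|exact: B2].
exact: B3.
Qed.

(** The factor s - D raises the parameter by integration by parts. The translations add up, as
    [ln s + ln (1 + s^-1) = ln (s + 1)], and the normalisations agree by [gamma_intS]. *)
Lemma nconvE_euler_step s r k M G z : 0 < s -> 0 <= r -> entire G -> wbounded r k M G ->
  nconv s (euler_step s G) z = nconv (s + 1) G z.
Proof.
move=> s0 r0 eG HG; have Gc := entire_ccont eG.
have eG' := entire_cauchy_der r0 eG HG; have G'c := entire_ccont eG'.
have HG' := wbounded_cauchy_der r0 Gc HG.
set h : R[i] := (ln (1 + s^-1))%:C.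
have c1 : ccont (fun w => G (w + h)) by apply/entire_ccont/entire_shift.
have eh' := @entire_shift _ _ h eG'.
have c2 : ccont (fun w => - s^-1%:C * cauchy_der G (w + h)).
  by apply/entire_ccont/entireZ.
have H1 := @wbounded_shift _ r k M h G r0 HG.
have H2 := @wbounded_shift _ r k _ h _ r0 HG'.
have H3 := wboundedZ (- s^-1%:C) H2.
rewrite /nconv; have -> : euler_step s G =
  (fun w => G (w + h) + - s^-1%:C * cauchy_der G (w + h)).
  by apply/funext => w; rewrite /euler_step mulNr.
rewrite (lgconvD _ s0 c1 H1 c2 H3) (lgconvZ _ _ s0 (entire_ccont eh') H2).
rewrite !lgconv_shift gamma_intS// -(lgconv_by_parts _ s0 r0 eG HG).
have -> : z + (ln s)%:C + h = z + (ln (s + 1))%:C.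
  rewrite -addrA -realcD -lnM ?posrE ?addr_gt0 ?invr_gt0//.
  by rewrite mulrDr mulr1 mulfV ?gt_eqF.
rewrite invfM realcM; set A := lgconv _ _ _; set B := lgconv _ _ _.
have ss : s%:C * s^-1%:C = 1 :> R[i] by rewrite -realcM mulfV ?gt_eqF.
have -> : A + - s^-1%:C * B = s^-1%:C * (s%:C * A - B).
  by rewrite mulrBr mulrA [_ * s%:C]mulrC ss mul1r mulNr.
by rewrite mulrA [_ * s^-1%:C]mulrC.
Qed.

Lemma entire_nconv s r k M G : 0 < s -> 0 <= r -> entire G -> wbounded r k M G ->
  entire (nconv s G).
Proof.
move=> s0 r0 eG HG; apply: entireZ; apply: entire_shift.
exact: entire_lgconv HG.
Qed.

Definition nconv_const s r k : R :=
  cmod (gamma_int s)^-1%:C * (wt_growth r k (cmod (ln s)%:C) *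
    (2 * kernel_moment s `|k|)).

Lemma wbounded_nconv s r k M G : 0 < s -> 0 <= r -> ccont G -> wbounded r k M G ->
  wbounded r k (nconv_const s r k * M) (nconv s G).
Proof.
move=> s0 r0 Gc HG; rewrite /nconv_const.
set c := (gamma_int s)^-1%:C; set a : R[i] := (ln s)%:C.
have -> : cmod c * (wt_growth r k (cmod a) * (2 * kernel_moment s `|k|)) * M =
  cmod c * (wt_growth r k (cmod a) * (2 * kernel_moment s `|k| * M)) by ring.
have H := wboundedZ c (@wbounded_shift _ r k _ a _ r0 (wbounded_lgconv s0 Gc HG)).
exact: H.
Qed.

Lemma cauchy_der_nconv s r k M G z : 0 < s -> 0 <= r -> entire G -> wbounded r k M G ->
  cauchy_der (nconv s G) z = nconv s (cauchy_der G) z.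
Proof.
move=> s0 r0 eG HG; apply: cauchy_der_cder; first exact: entire_nconv HG.
apply: cderZ; apply: cder_shift; exact: cder_lgconv HG.
Qed.

Lemma nconv_euler_stepC s t r k M G z : 0 < s -> 0 <= r -> entire G -> wbounded r k M G ->
  nconv s (euler_step t G) z = euler_step t (nconv s G) z.
Proof.
move=> s0 r0 eG HG; have Gc := entire_ccont eG.
have eG' := entire_cauchy_der r0 eG HG; have G'c := entire_ccont eG'.
have HG' := wbounded_cauchy_der r0 Gc HG.
set h : R[i] := (ln (1 + t^-1))%:C.
have c1 : ccont (fun w => G (w + h)) by apply/entire_ccont/entire_shift.
have eh' := @entire_shift _ _ h eG'.
have c2 : ccont (fun w => - t^-1%:C * cauchy_der G (w + h)).
  by apply/entire_ccont/entireZ.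
have H1 := @wbounded_shift _ r k M h G r0 HG.
have H2 := @wbounded_shift _ r k _ h _ r0 HG'.
have H3 := wboundedZ (- t^-1%:C) H2.
rewrite /euler_step (cauchy_der_nconv _ s0 r0 eG HG) /nconv.
have -> : (fun z0 => let w := z0 + (ln (1 + t^-1))%:C in G w - t^-1%:C * cauchy_der G w) =
  (fun w => G (w + h) + - t^-1%:C * cauchy_der G (w + h)).
  by apply/funext => w /=; rewrite mulNr.
rewrite (lgconvD _ s0 c1 H1 c2 H3) (lgconvZ _ _ s0 (entire_ccont eh') H2).
rewrite !lgconv_shift -/h [z + (ln s)%:C + h]addrAC; ring.
Qed.

(** A telescoping majorant of the sum of (g + m)^(-2) over m >= n: for s >= g, 1/s^2 is at most (g +
    1)/g times 1/s - 1/(s + 1). *)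
Definition euler_tail (g : R) (n : nat) : R := (g + 1) / g / (g + n%:R).

Lemma euler_tail_ge0 g n : 0 < g -> 0 <= euler_tail g n.
Proof.
by move=> g0; rewrite /euler_tail !divr_ge0// ?addr_ge0// ltW.
Qed.

Lemma euler_tail_step g n : 0 < g ->
  ((g + n%:R)^-1) ^+ 2 <= euler_tail g n - euler_tail g n.+1.
Proof.
move=> g0; rewrite /euler_tail -(natr1 n) addrA; set s := g + n%:R.
have gs : g <= s by rewrite lerDl.
have s0 : 0 < s := lt_le_trans g0 gs.
have s1 : 0 < s + 1 by rewrite addr_gt0.
rewrite -subr_ge0.
have -> : (g + 1) / g / s - (g + 1) / g / (s + 1) - s^-1 ^+ 2 =
  (s - g) / (g * s ^+ 2 * (s + 1)) by field; rewrite !gt_eqF.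
by rewrite divr_ge0 ?subr_ge0// !mulr_ge0// ltW// exprn_gt0.
Qed.

Lemma euler_tail_small g (e : R) : 0 < g -> 0 < e -> exists n, euler_tail g n <= e.
Proof.
move=> g0 e0; set C := (g + 1) / g / e.
have C0 : 0 <= C by rewrite /C !divr_ge0// ?addr_ge0// ltW.
exists (Num.truncn C).+1; rewrite /euler_tail ler_pdivrMr; last by rewrite addr_gt0.
rewrite [e * _]mulrC -ler_pdivrMr//; apply: (@le_trans _ _ (Num.truncn C).+1%:R).
  by rewrite ltW// truncnS_gt.
by rewrite lerDr ltW.
Qed.

(** A step multiplies the bound by at most 1 + E/s^2 <= exp(E/s^2), and the exponents telescope
    through [euler_tail]. Entireness is carried along because the next step differentiates the
    product. *)
Lemma euler_prod_spec g r k M G n : 0 < g -> 0 <= r -> entire G -> wbounded r k M G ->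
  entire (euler_prod g G n) /\
  wbounded r k (expR (euler_step_const r k g^-1 * (euler_tail g 0 - euler_tail g n)) * M)
    (euler_prod g G n).
Proof.
move=> g0 r0 eG HG; elim: n => [|n [en Hn]].
  by split => //; rewrite subrr mulr0 expR0 mul1r.
split; first exact: entire_euler_step en Hn.
set E := euler_step_const _ _ _ in Hn *.
have E0 : 0 <= E by exact: euler_step_const_ge0.
have gs : g <= g + n%:R by rewrite lerDl.
have HB := wbounded_euler_stepB g0 gs r0 en Hn.
have := wboundedD Hn HB.
have -> : (fun z => euler_prod g G n z + (euler_step (g + n%:R) (euler_prod g G n) z -
  euler_prod g G n z)) = euler_prod g G n.+1.
  by apply/funext => z; rewrite addrC subrK.
apply: wboundedW; rewrite -/E.
set x := expR _; set a := _ ^+ 2.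
have -> : x * M + a * (E * (x * M)) = (1 + E * a) * (x * M) by ring.
have -> : E * (euler_tail g 0 - euler_tail g n.+1) =
  E * (euler_tail g n - euler_tail g n.+1) + E * (euler_tail g 0 - euler_tail g n) by ring.
rewrite expRD -mulrA ler_wpM2r//.
  exact: mulr_ge0 (expR_ge0 _) (wbounded_ge0 HG).
apply: le_trans (expR_ge1Dx _); rewrite lerD2l ler_wpM2l//.
exact: euler_tail_step.
Qed.

Definition euler_const g r k : R := expR (euler_step_const r k g^-1 * euler_tail g 0).

Lemma wbounded_euler_prod g r k M G n : 0 < g -> 0 <= r -> entire G ->
  wbounded r k M G -> wbounded r k (euler_const g r k * M) (euler_prod g G n).
Proof.
move=> g0 r0 eG HG; have [_] := euler_prod_spec n g0 r0 eG HG.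
apply: wboundedW; rewrite ler_wpM2r ?(wbounded_ge0 HG)// ler_expR.
rewrite ler_wpM2l ?euler_step_const_ge0// gerBl; exact: euler_tail_ge0.
Qed.

Definition euler_error g r k M : R :=
  euler_step_const r k g^-1 * (euler_const g r k * M).

Lemma wbounded_euler_prodB g r k M G n m : 0 < g -> 0 <= r -> entire G ->
  wbounded r k M G -> (n <= m)%N ->
  wbounded r k (euler_error g r k M * euler_tail g n)
    (fun z => euler_prod g G m z - euler_prod g G n z).
Proof.
move=> g0 r0 eG HG nm.
have c0 : 0 <= euler_error g r k M.
  apply: mulr_ge0; first exact: euler_step_const_ge0.
  exact: mulr_ge0 (expR_ge0 _) (wbounded_ge0 HG).
(* The induction carries the exact difference of tails, which telescopes; its negative term is
   dropped at the end. *)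
have : wbounded r k (euler_error g r k M * (euler_tail g n - euler_tail g m))
    (fun z => euler_prod g G m z - euler_prod g G n z).
  rewrite -(subnK nm); elim: (m - n)%N => [|j IH].
    by move=> z; rewrite add0n !subrr mulr0 mul0r cmod0.
  have [ej _] := euler_prod_spec (j + n) g0 r0 eG HG.
  have gs : g <= g + (j + n)%:R by rewrite lerDl.
  have HB := wbounded_euler_stepB g0 gs r0 ej (wbounded_euler_prod _ g0 r0 eG HG).
  have := wboundedD HB IH.
  have -> : (fun z => euler_step (g + (j + n)%:R) (euler_prod g G (j + n)) z -
      euler_prod g G (j + n) z + (euler_prod g G (j + n) z - euler_prod g G n z)) =
    (fun z => euler_prod g G (j.+1 + n) z - euler_prod g G n z).
    by apply/funext => z; rewrite addrA subrK.
  apply: wboundedW; rewrite addSn -/(euler_error g r k M).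
  rewrite [X in X + _ <= _]mulrC -mulrDr ler_wpM2l//.
  have := @euler_tail_step g (j + n) g0; lra.
apply: wboundedW; rewrite ler_wpM2l// gerBl; exact: euler_tail_ge0.
Qed.

(** The newest factor is moved outside [nconv g], then back inside [nconv (g + n%:R)], where it
    raises the parameter by 1. *)
Lemma nconv_euler_prod g r k M G n : 0 < g -> 0 <= r -> entire G -> wbounded r k M G ->
  nconv g (euler_prod g G n) = nconv (g + n%:R) G.
Proof.
move=> g0 r0 eG HG; elim: n => [|n IH]; first by rewrite addr0.
have [en Hn] := euler_prod_spec n g0 r0 eG HG.
have gn0 : 0 < g + n%:R by rewrite ltr_pwDl.
apply/funext => z; rewrite /= (nconv_euler_stepC _ _ g0 r0 en Hn) IH.
rewrite -(nconv_euler_stepC _ _ gn0 r0 eG HG) (nconvE_euler_step _ gn0 r0 eG HG).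
by rewrite -addrA natr1.
Qed.

(** With the product on this side the identity yields injectivity; [nconv_euler_prod] yields
    surjectivity. *)
Lemma euler_prod_nconv g r k M G n : 0 < g -> 0 <= r -> entire G -> wbounded r k M G ->
  euler_prod g (nconv g G) n = nconv (g + n%:R) G.
Proof.
move=> g0 r0 eG HG; elim: n => [|n IH]; first by rewrite addr0.
have gn0 : 0 < g + n%:R by rewrite ltr_pwDl.
apply/funext => z; rewrite /= IH.
rewrite -(nconv_euler_stepC _ _ gn0 r0 eG HG) (nconvE_euler_step _ gn0 r0 eG HG).
by rewrite -addrA natr1.
Qed.

End euler_product.

(** * Concentration of the logarithmic Gamma law and inversion of the convolution *)

Section inversion.
Variable R : realType.
Notation mu := (@lebesgue_measure R).
Notation W := (@log_gamma_kernel R).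
Implicit Types (s r k M : R) (G H : R[i] -> R[i]) (z : R[i]).

Lemma wt0_real_shift r z (a : R) : wt r 0 (z + a%:C) = wt r 0 z.
Proof. by rewrite /wt oppr0 !powRr0 cImD /= addr0. Qed.

Lemma real_increment_le r M G z (x : R) : 0 <= r -> entire G -> wbounded r 0 M G ->
  cmod (G (z + x%:C) - G z) <= 2 * (der_const r 0 * M * wt r 0 z) * `|x|.
Proof.
move=> r0 eG HG; rewrite -(cmod_real x).
apply: (cmod_increment_le (fun w => cder_cauchy w eG)) => t _.
have := wbounded_cauchy_der r0 (entire_ccont eG) HG (z + x%:C * t%:C).
by rewrite -realcM wt0_real_shift.
Qed.

(** If exp(U) has the Gamma(s) law, the difference is the mean of G(z + ln s - U) - G(z), hence of
    the order of E|ln s - U|. By [norm_le_cosh] that is at most e + (E[s exp(-U)] + E[exp(U)/s] -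
    2)/e, and the two means are s/(s - 1), finite since [1 < s], and 1. The 4 is 2 from the
    increment times 2 from the complex integral. *)
Lemma nconv_concentration s r M G z (e : R) : 1 < s -> 0 <= r -> entire G ->
  wbounded r 0 M G -> 0 < e ->
  cmod (nconv s G z - G z) <=
    4 * (der_const r 0 * M * wt r 0 z) * (e + ((s - 1) * e)^-1).
Proof.
move=> s1 r0 eG HG e0; set L := der_const r 0 * M * wt r 0 z.
have s0 : 0 < s by apply: lt_trans s1.
have s10 : 0 < s - 1 by rewrite subr_gt0.
have L0 : 0 <= L.
  exact: mulr_ge0 (mulr_ge0 (der_const_ge0 r 0) (wbounded_ge0 HG)) (ltW (wt_gt0 r 0 z)).
have Gc := entire_ccont eG.
set w0 := z + (ln s)%:C.
have gs0 := gamma_int_gt0 s0.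
have mT : @measurable _ (measurableTypeR R) setT by [].
have ge1 : wbounded 0 0 1 (fun=> 1 : R[i]).
  by move=> w; rewrite /wt oppr0 powRr0 !mul1r mul0r expR0 cmod1.
have ce1 : ccont (fun=> 1 : R[i]) by exact: ccont_cst.
have i1 := lgconv_integrable w0 s0 Gc HG.
have i2 := cintegrableZ (G z) mT (lgconv_integrable w0 s0 ce1 ge1).
have E : nconv s G z - G z = (gamma_int s)^-1%:C *
    cintegral setT (fun u => (W s u)%:C * (G (w0 - u%:C) - G z)).
  have -> : cintegral setT (fun u => (W s u)%:C * (G (w0 - u%:C) - G z)) =
      lgconv s G w0 - G z * (gamma_int s)%:C.
    rewrite -(lgconv_cst1 s w0) /lgconv -cintegralZ//; last exact: lgconv_integrable ge1.
    rewrite -cintegralB//.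
    by apply: eq_cintegral => u _; ring.
  rewrite mulrBr /nconv mulrCA -realcM mulVf ?gt_eqF// mulr1.
  by [].
pose h u := 2 * L * ((e - 2 / e) * W s u + s / e * W (s - 1) u + (s * e)^-1 * W (s + 1) u).
have hi : mu.-integrable setT (EFin \o h).
  apply: rintegrableZ => //; apply: rintegrableD => //; first apply: rintegrableD => //.
  - by apply: rintegrableZ => //; exact: integrable_kernel.
  - by apply: rintegrableZ => //; exact: integrable_kernel.
  - by apply: rintegrableZ => //; apply: integrable_kernel; rewrite addr_gt0.
have hB u : cmod ((W s u)%:C * (G (w0 - u%:C) - G z)) <= h u.
  rewrite cmodM cmod_real ger0_norm; last exact: ltW (log_gamma_kernel_gt0 _ _).
  have -> : w0 - u%:C = z + (ln s - u)%:C by rewrite realcD realcN addrA.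
  have := real_increment_le z (ln s - u) r0 eG HG; rewrite -/L => H1.
  have H2 := norm_le_cosh (ln s - u) e0.
  apply: (@le_trans _ _ (W s u * (2 * L * (e + (expR (ln s - u) + expR (- (ln s - u)) - 2) / e)))).
    rewrite ler_pM2l ?log_gamma_kernel_gt0//; apply: (le_trans H1).
    by rewrite ler_wpM2l// mulr_ge0.
  have E1 : W s u * expR (ln s - u) = s * W (s - 1) u.
    rewrite expRB lnK ?posrE// -{1}(subrK 1 s) log_gamma_kernelS.
    by field; rewrite gt_eqF// expR_gt0.
  have E2 : W s u * expR (- (ln s - u)) = s^-1 * W (s + 1) u.
    by rewrite opprB expRB lnK ?posrE// log_gamma_kernelS; field; rewrite gt_eqF.
  have -> : W s u * (2 * L * (e + (expR (ln s - u) + expR (- (ln s - u)) - 2) / e)) =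
    2 * L * (e * W s u + (W s u * expR (ln s - u) + W s u * expR (- (ln s - u)) - 2 * W s u) / e).
    by field; rewrite gt_eqF.
  rewrite E1 E2 /h le_eqVlt; apply/orP; left; apply/eqP; field.
  by rewrite !gt_eqF.
have hI : \int[mu]_u h u = 2 * L * (gamma_int s * (e + ((s - 1) * e)^-1)).
  have k1 := integrable_kernel s0.
  have k2 := integrable_kernel s10.
  have k3 : mu.-integrable setT (EFin \o W (s + 1)) by apply: integrable_kernel; rewrite addr_gt0.
  have z1 := rintegrableZ (e - 2 / e) mT k1.
  have z2 := rintegrableZ (s / e) mT k2.
  have z3 := rintegrableZ (s * e)^-1 mT k3.
  have z12 := rintegrableD mT z1 z2.
  rewrite /h RintegralZl//; last exact: rintegrableD.
  rewrite RintegralD// RintegralD// !RintegralZl// -!/(gamma_int _).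
  rewrite gamma_intS//.
  have -> : gamma_int s = (s - 1) * gamma_int (s - 1) by rewrite -gamma_intS// subrK.
  by field; rewrite !gt_eqF.
have ci : cintegrable setT (fun u => (W s u)%:C * (G (w0 - u%:C) - G z)).
  have := cintegrableB mT i1 i2.
  by congr (cintegrable _ _); apply/funext => u; ring.
rewrite E cmodM cmod_real ger0_norm ?invr_ge0 ?(ltW gs0)//.
have := cmod_cintegral_le mT ci hi (fun t _ => hB t); rewrite hI => H.
apply: (le_trans (ler_wpM2l _ H)); first by rewrite invr_ge0 ltW.
rewrite le_eqVlt; apply/orP; left; apply/eqP; field.
by rewrite !gt_eqF.
Qed.

Lemma nconv_limit g r M G z (d : R) : 0 < g -> 0 <= r -> entire G ->
  wbounded r 0 M G -> 0 < d ->
  exists N, forall n, (N <= n)%N -> cmod (nconv (g + n%:R) G z - G z) <= d.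
Proof.
move=> g0 r0 eG HG d0; set L := der_const r 0 * M * wt r 0 z.
have L0 : 0 <= L.
  exact: mulr_ge0 (mulr_ge0 (der_const_ge0 r 0) (wbounded_ge0 HG)) (ltW (wt_gt0 r 0 z)).
have L1 : 0 < L + 1 by rewrite ltr_wpDl.
(* Once s - 1 >= e^(-2), both terms of the concentration bound are at most [e], for a total of
   [8 * L * e]; the [+ 1] allows [L = 0]. *)
have [e e0 ed] : exists2 e, 0 < e & 8 * (L + 1) * e = d.
  exists (d / (8 * (L + 1))); first by rewrite divr_gt0// mulr_gt0.
  by rewrite mulrC divfK// gt_eqF// mulr_gt0.
(* One unit takes the truncation above [e ^- 2], the other makes up for the [- 1] in s - 1. *)
exists (Num.truncn (e ^- 2)).+2 => n Nn.
have n1 : e ^- 2 <= g + n%:R - 1.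
  have : (Num.truncn (e ^- 2)).+2%:R <= n%:R :> R by rewrite ler_nat.
  have : e ^- 2 < (Num.truncn (e ^- 2)).+1%:R by exact: truncnS_gt.
  rewrite -[in (_.+2)%:R]natr1; lra.
have ee : 0 < e ^- 2 by rewrite invr_gt0 exprn_gt0.
have s1 : 1 < g + n%:R by rewrite -subr_gt0 (lt_le_trans ee).
apply: (le_trans (nconv_concentration z s1 r0 eG HG e0)); rewrite -/L.
have : ((g + n%:R - 1) * e)^-1 <= e.
  rewrite -[leRHS]invrK lef_pV2 ?posrE ?invr_gt0// ?mulr_gt0 ?subr_gt0//.
  rewrite -ler_pdivrMr//; apply: le_trans n1; by rewrite expr2 invfM.
move=> H; apply: (@le_trans _ _ (4 * L * (2 * e))).
  by apply: ler_wpM2l; [rewrite mulr_ge0|rewrite [leRHS]mulrDl mul1r lerD2l].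
by move: ed; rewrite mulrDr mulrDl mulr1; lra.
Qed.

Lemma wbounded_pointwise_limit r k M G (F : nat -> R[i] -> R[i]) :
  (forall n, wbounded r k M (F n)) ->
  (forall z e, 0 < e -> exists n, cmod (G z - F n z) <= e) -> wbounded r k M G.
Proof.
move=> HF HG z; apply/ler_addgt0Pr => e /(HG z)[n Hn].
have -> : G z = F n z + (G z - F n z) by rewrite addrC subrK.
by apply: (le_trans (cmodD _ _)); apply: lerD; [exact: HF|exact: Hn].
Qed.

Lemma nconvB s r k M N G H z : 0 < s -> ccont G -> wbounded r k M G ->
  ccont H -> wbounded r k N H ->
  nconv s (fun w => G w - H w) z = nconv s G z - nconv s H z.
Proof.
move=> s0 Gc HG Hc HH; have Hc' : ccont (fun w => -1 * H w).
  by move=> w; apply: ccont_atM; [exact: ccont_cst|exact: Hc].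
have HH' := wboundedZ (-1) HH.
rewrite /nconv; have -> : (fun w => G w - H w) = (fun w => G w + -1 * H w).
  by apply/funext => w; rewrite mulN1r.
by rewrite (lgconvD _ s0 Gc HG Hc' HH') (lgconvZ _ _ s0 Hc HH); ring.
Qed.

Lemma nconv_const_ge0 s r k : 0 <= nconv_const s r k.
Proof.
apply: mulr_ge0; first exact: cmod_ge0.
apply: mulr_ge0; first exact: wt_growth_ge0.
by apply: mulr_ge0 => //; exact: kernel_moment_ge0.
Qed.

(** [H] is the limit of the partial products in the norm for k = 0. As [nconv g] is bounded for that
    norm, [nconv g H] is the limit of [nconv (g + n%:R) G], which is [G]. The bounds for the other
    [k] hold uniformly along the sequence and pass to the pointwise limit, so one [H] serves them
    all with the same [r]. *)
Lemma nconv_surjective g r M G : 0 < g -> 0 <= r -> entire G -> wbounded r 0 M G ->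
  exists H, [/\ entire H,
    forall k N, wbounded r k N G -> wbounded r k (euler_const g r k * N) H &
    nconv g H = G].
Proof.
move=> g0 r0 eG HG.
pose c := euler_error g r 0 M.
have c0 : 0 <= c.
  apply: mulr_ge0; first exact: euler_step_const_ge0.
  exact: mulr_ge0 (expR_ge0 _) (wbounded_ge0 HG).
pose a n := c * euler_tail g n.
have asmall e : 0 < e -> exists n, a n <= e.
  move=> e0; have c1 : 0 < c + 1 by rewrite ltr_wpDl.
  have [|n Hn] := @euler_tail_small R g (e / (c + 1)) g0; first by rewrite divr_gt0.
  exists n; move: Hn; rewrite ler_pdivlMr// /a mulrDr mulr1 mulrC => Hn.
  by apply: le_trans Hn; rewrite lerDl euler_tail_ge0.
have eF n : entire (euler_prod g G n) by have [] := euler_prod_spec n g0 r0 eG HG.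
have [H [eH HH]] := @entire_limit R r 0 (euler_prod g G) a M r0 eF HG asmall
  (fun n m nm => wbounded_euler_prodB g0 r0 eG HG nm).
have small C : 0 <= C -> forall e, 0 < e -> exists n, C * a n <= e.
  move=> C0 e e0; have C1 : 0 < C + 1 by rewrite ltr_wpDl.
  have [|n Hn] := asmall (e / (C + 1)); first by rewrite divr_gt0.
  have an0 : 0 <= a n by rewrite mulr_ge0// euler_tail_ge0.
  exists n; move: Hn; rewrite ler_pdivlMr// mulrDr mulr1 mulrC => Hn.
  by apply: le_trans Hn; rewrite lerDl.
have Hlim z e : 0 < e -> exists n, cmod (H z - euler_prod g G n z) <= e.
  move=> e0; have [|n Hn] := small (2 * wt r 0 z) _ _ e0.
    by rewrite mulr_ge0// ltW// wt_gt0.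
  by exists n; apply: (le_trans (HH n z)); rewrite mulrAC.
exists H; split => //.
  move=> k N HN; apply: wbounded_pointwise_limit Hlim => n.
  exact: wbounded_euler_prod.
apply/funext => z; apply/eqP; rewrite -subr_eq0 -cmod_eq0 eq_le cmod_ge0 andbT.
apply/ler_addgt0Pr => e e0; rewrite add0r.
have e2 : 0 < e / 2 by rewrite divr_gt0.
have [N HN] := nconv_limit z g0 r0 eG HG e2.
have HH0 : wbounded r 0 (euler_const g r 0 * M) H.
  by apply: wbounded_pointwise_limit Hlim => n; exact: wbounded_euler_prod.
have Hc := entire_ccont eH.
have [|n0 Hn0] := small (nconv_const g r 0 * 2 * wt r 0 z) _ _ e2.
  apply: mulr_ge0; last exact: ltW (wt_gt0 _ _ _).
  by rewrite mulr_ge0// nconv_const_ge0.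
pose n := maxn N n0.
have Fc := entire_ccont (eF n).
have HF := wbounded_euler_prod n g0 r0 eG HG.
have dc := entire_ccont (entireB eH (eF n)).
have -> : nconv g H z - G z =
    nconv g (fun w => H w - euler_prod g G n w) z + (nconv (g + n%:R) G z - G z).
  rewrite (nconvB _ g0 Hc HH0 Fc HF) (nconv_euler_prod _ g0 r0 eG HG).
  by rewrite addrA subrK.
apply: (le_trans (cmodD _ _)); rewrite [e in leRHS]splitr; apply: lerD; last first.
  by apply: HN; rewrite leq_maxl.
apply: le_trans Hn0; have := wbounded_nconv g0 r0 dc (HH n) z.
move=> /le_trans; apply.
have p (m : nat) : 0 < g + m%:R by rewrite ltr_pwDl.
have aa : a n <= a n0.
  apply: ler_wpM2l => //; rewrite /euler_tail ler_wpM2l//.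
    by rewrite divr_ge0// ?addr_ge0// ltW.
  by rewrite lef_pV2 ?posrE// lerD2l ler_nat leq_maxr.
rewrite [leLHS](_ : _ = nconv_const g r 0 * 2 * wt r 0 z * a n); last by rewrite /a; ring.
apply: ler_wpM2l aa; apply: mulr_ge0; last exact: ltW (wt_gt0 _ _ _).
by rewrite mulr_ge0// nconv_const_ge0.
Qed.

Lemma cauchy_der_real_zero G (x : R) : entire G -> (forall t : R, G t%:C = 0) ->
  cauchy_der G x%:C = 0.
Proof.
move=> eG G0; set d := cauchy_der _ _.
have fd : cder G x%:C d by exact: cder_cauchy.
apply/eqP; rewrite -cmod_eq0 eq_le cmod_ge0 andbT; apply/ler_addgt0Pr => e e0.
have [del del0 H] := fd _ e0.
have d2 : 0 < del / 2 by rewrite divr_gt0.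
have := H (del / 2)%:C; rewrite cmod_real ger0_norm ?(ltW d2)//.
rewrite -realcD !G0 subrr sub0r cmodN cmodM cmod_real ger0_norm ?(ltW d2)// add0r.
by rewrite ler_pM2r//; apply; lra.
Qed.

Lemma euler_prod_real_zero g r k M G n : 0 < g -> 0 <= r -> entire G ->
  wbounded r k M G -> (forall t : R, G t%:C = 0) ->
  forall t : R, euler_prod g G n t%:C = 0.
Proof.
move=> g0 r0 eG HG G0; elim: n => [//|n IH] t.
have [en _] := euler_prod_spec n g0 r0 eG HG.
rewrite /= /euler_step -realcD IH cauchy_der_real_zero//.
by rewrite mulr0 subr0.
Qed.

(** An Euler step at a real point uses the value and the derivative of its argument at a real point,
    and that derivative can be computed along the real line. Vanishing there is thus inherited by
    every [nconv (g + n%:R) H], and these tend to [H]. *)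
Lemma nconv_injective g r M H : 0 < g -> 0 <= r -> entire H -> wbounded r 0 M H ->
  (forall t : R, nconv g H t%:C = 0) -> forall t : R, H t%:C = 0.
Proof.
move=> g0 r0 eH HH H0 t.
apply/eqP; rewrite -cmod_eq0 eq_le cmod_ge0 andbT; apply/ler_addgt0Pr => e e0.
have [N /(_ N (leqnn N))] := nconv_limit t%:C g0 r0 eH HH e0.
rewrite -(euler_prod_nconv N g0 r0 eH HH).
have en := entire_nconv g0 r0 eH HH.
rewrite (euler_prod_real_zero _ g0 r0 en (wbounded_nconv g0 r0 (entire_ccont eH) HH))//.
by rewrite sub0r cmodN add0r.
Qed.

End inversion.

(** * The Laplace transform as a convolution *)

Section exponential_substitution.
Variable R : realType.
Notation mu := (@lebesgue_measure R).

Lemma is_derive_expR_shift (y u : R) :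
  is_derive u 1 (fun u => expR (u - y)) (expR (u - y)).
Proof.
have D : is_derive u 1 (fun u => u - y) (1 - 0).
  exact: is_deriveB.
have := @is_derive1_comp _ expR (fun u => u - y) u _ _ (is_derive_expR _) D.
by move=> H; apply: is_derive_eq H _; ring.
Qed.

Lemma continuous_expR_shift (y : R) : continuous (fun u => expR (u - y)).
Proof.
by move=> u; apply/differentiable_continuous/derivable1_diffP;
  have [] := is_derive_expR_shift y u.
Qed.

Lemma expR_shift_substitution_itv (q : R -> R) (y a b : R) : continuous q -> a <= b ->
  (\int[mu]_(t in `[expR (a - y), expR (b - y)]) (q (ln t))%:E =
   \int[mu]_(u in `[a, b]) (expR (u - y) * q (u - y))%:E)%E.
Proof.
move=> qc ab; have ec : continuous (fun u => expR (u - y)) by exact: continuous_expR_shift.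
have dE : derive1 (fun u => expR (u - y)) = (fun u => expR (u - y)).
  by apply/funext => u; rewrite derive1E; have [_ ->] := is_derive_expR_shift y u.
rewrite (@integration_by_substitution_increasing _ (fun u => expR (u - y)) (fun t => q (ln t)))//.
- apply: eq_integral => u _; rewrite dE.
  change ((q (ln (expR (u - y))) * expR (u - y))%:E = (expR (u - y) * q (u - y))%:E).
  by rewrite expRK mulrC.
- by move=> u v _ _ uv; rewrite ltr_expR ltrD2r.
- by rewrite dE => u _; exact: ec.
- by rewrite dE; apply/cvg_ex; exists (expR (a - y)); apply: cvg_at_right_filter; exact: ec.
- by rewrite dE; apply/cvg_ex; exists (expR (b - y)); apply: cvg_at_left_filter; exact: ec.
- split.
  + by move=> u _; have [] := is_derive_expR_shift y u.
  + by apply: cvg_at_right_filter; exact: ec.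
  + by apply: cvg_at_left_filter; exact: ec.
- apply: continuous_in_subspaceT => t; rewrite inE /= in_itv /= => /andP[t0 _].
  apply: continuous_comp; last exact: qc.
  by apply: continuous_ln; apply: lt_le_trans t0; exact: expR_gt0.
Qed.

(** Exhaustion by the intervals [B n] and their images [A n] under the substitution, with monotone
    convergence on both sides. *)
Lemma ge0_expR_shift_substitution (q : R -> R) (y : R) : continuous q ->
  (forall x, 0 <= q x) ->
  (\int[mu]_(t in `]0%R, +oo[) (q (ln t))%:E =
   \int[mu]_u (expR (u - y) * q (u - y))%:E)%E.
Proof.
move=> qc q0.
pose A n := `[expR (- n%:R - y), expR (n%:R - y)]%classic.
pose B n := `[- n%:R, n%:R : R]%classic.
have UA : \bigcup_n A n = `]0%R, +oo[%classic.
  apply/seteqP; split => [t [n _]|t] /=; rewrite in_itv/=.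
    by rewrite /A /= in_itv /= => /andP[h _]; rewrite andbT (lt_le_trans _ h)// expR_gt0.
  rewrite ?andbT => t0; exists (Num.truncn `|ln t + y|).+1 => //=.
  have := truncnS_gt `|ln t + y|; move: (_.+1) => n /ltW.
  rewrite ler_norml => /andP[h1 h2].
  by rewrite /A /= in_itv /= -{1 2}(lnK t0) !ler_expR; apply/andP; split; lra.
have UB : \bigcup_n B n = setT.
  apply/seteqP; split => // u _; exists (Num.truncn `|u|).+1 => //=.
  have := truncnS_gt `|u|; move: (_.+1) => n /ltW.
  by rewrite ler_norml /B /= in_itv /=.
have ndA : nondecreasing_seq A.
  move=> n m nm; rewrite subsetEset; apply: subset_itv; rewrite bnd_simp ler_expR lerD2r.
    by rewrite lerN2 ler_nat.
  by rewrite ler_nat.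
have ndB : nondecreasing_seq B.
  move=> n m nm; rewrite subsetEset; apply: subset_itv; rewrite bnd_simp.
    by rewrite lerN2 ler_nat.
  by rewrite ler_nat.
have mA : measurable_fun (`]0%R, +oo[%classic : set R) (fun t : R => (q (ln t))%:E).
  apply/measurable_EFinP; apply: open_continuous_measurable_fun.
    exact: interval_open.
  move=> t; rewrite inE /= in_itv /= andbT => t0.
  by apply: continuous_comp; [exact: continuous_ln|exact: qc].
have eqc : continuous (fun u => expR (u - y) * q (u - y)).
  move=> u; apply: cvgM; first exact: continuous_expR_shift.
  apply: (@continuous_comp _ _ _ (fun u => u - y) q); last exact: qc.
  by apply: cvgB; [exact: cvg_id|exact: cvg_cst].
have LA := @ge0_nondecreasing_set_cvg_integral _ (measurableTypeR R) R A
  (fun t => (q (ln t))%:E) mu ndA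
  (fun n => measurable_itv _).
have LB := @ge0_nondecreasing_set_cvg_integral _ (measurableTypeR R) R B
  (fun u => (expR (u - y) * q (u - y))%:E) mu ndB (fun n => measurable_itv _).
move: LA; rewrite UA => LA; move: LB; rewrite UB => LB.
have E n : (\int[mu]_(u in B n) (expR (u - y) * q (u - y))%:E =
    \int[mu]_(t in A n) (q (ln t))%:E)%E.
  apply/esym/expR_shift_substitution_itv => //.
  by rewrite lerNl (le_trans (_ : _ <= 0)) ?oppr_le0.
have {}LA : ((\int[mu]_(u in B n) (expR (u - y) * q (u - y))%:E) @[n --> \oo] -->
    \int[mu]_(t in `]0%R, +oo[) (q (ln t))%:E)%E.
  under eq_fun do rewrite E; apply: LA.
    move=> n; apply: (measurable_funS _ _ mA) => //; rewrite -UA; exact: bigcup_sup.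
  by move=> n t _; rewrite lee_fin.
apply: (cvg_unique (@ereal_hausdorff R) LA); apply: LB.
  move=> n; apply: measurable_funTS; apply/measurable_EFinP.
  exact: continuous_measurable_fun.
by move=> n u _; rewrite lee_fin mulr_ge0 ?expR_ge0.
Qed.

(** Positive and negative parts are compared as extended reals, so continuity of [q] is enough. *)
Lemma expR_shift_substitution (q : R -> R) (y : R) : continuous q ->
  \int[mu]_(t in `]0, +oo[) q (ln t) = \int[mu]_u (expR (u - y) * q (u - y)).
Proof.
move=> qc; rewrite /Rintegral; congr fine.
have pc : continuous (fun x => Num.max (q x) 0).
  by move=> x; apply: (@continuous_max _ _ q (cst 0)); [exact: qc|exact: cst_continuous].
have nc : continuous (fun x => Num.max (- q x) 0).
  move=> x; apply: (@continuous_max _ _ (fun x => - q x) (cst 0)); last exact: cst_continuous.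
  by apply: cvgN; exact: qc.
rewrite integralE [RHS]integralE; congr (_ - _)%E.
- transitivity (\int[mu]_(t in `]0%R, +oo[) (Num.max (q (ln t)) 0)%:E)%E.
    by apply: eq_integral => t _; rewrite funeposE -EFin_max.
  rewrite (ge0_expR_shift_substitution y pc); last by move=> x; rewrite le_max lexx orbT.
  apply: eq_integral => u _; rewrite funeposE -EFin_max.
  by rewrite maxr_pMr ?expR_ge0// mulr0.
- transitivity (\int[mu]_(t in `]0%R, +oo[) (Num.max (- q (ln t)) 0)%:E)%E.
    by apply: eq_integral => t _; rewrite funenegE -EFinN -EFin_max.
  rewrite (ge0_expR_shift_substitution y nc); last by move=> x; rewrite le_max lexx orbT.
  apply: eq_integral => u _; rewrite funenegE -EFinN -EFin_max.
  by rewrite maxr_pMr ?expR_ge0// mulr0 mulrN.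
Qed.

End exponential_substitution.

Section laplace_profile.
Variable R : realType.
Notation mu := (@lebesgue_measure R).
Implicit Types (g : R) (f : Rpos R -> R[i]) (Phi : R[i] -> R[i]).

(** Both factors are extended to the plane through the real part, which reduces the claim to
    [ccont_atM]. *)
Lemma rcontM (p q : R -> R[i]) t : rcont p t -> rcont q t ->
  rcont (fun t => p t * q t) t.
Proof.
have lift (p' : R -> R[i]) : rcont p' t ->
    ccont_at (fun z => p' (complex.Re z)) t%:C.
  move=> pc e /pc[del del0 H]; exists del => // h hd.
  by rewrite cReD; apply: H; exact: le_lt_trans (normRe_cmod _) hd.
move=> /lift pc /lift qc e /(ccont_atM pc qc)[del del0 H]; exists del => // s sd.
by have := H s%:C; rewrite cmod_real cReD; apply.
Qed.

Lemma rcont_real (w : R -> R) t : {for t, continuous w} -> rcont (fun t => (w t)%:C) t.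
Proof.
move=> /cvgrPdist_le wc e /wc /nbhs_ballP[del /= del0 H]; exists del => // s sd.
change (cmod ((w (t + s))%:C - (w t)%:C) <= e).
rewrite -realcN -realcD cmod_real distrC; apply: H.
by rewrite /ball /= opprD addrA subrr sub0r normrN.
Qed.

Lemma cintegral_expR_substitution (q : R -> R[i]) (y : R) : (forall t, rcont q t) ->
  cintegral (Rpos R) (fun t => q (ln t)) =
  cintegral setT (fun u => (expR (u - y))%:C * q (u - y)).
Proof.
move=> qc; apply: complexP => /=.
- rewrite (@expR_shift_substitution _ (fun x => complex.Re (q x)) y); last first.
    by move=> t; have [] := rcont_ReIm (qc t).
  by apply: eq_Rintegral => u _; rewrite cReM /= mul0r subr0.
- rewrite (@expR_shift_substitution _ (fun x => complex.Im (q x)) y); last first.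
    by move=> t; have [] := rcont_ReIm (qc t).
  by apply: eq_Rintegral => u _; rewrite cImM /= mul0r addr0.
Qed.

Lemma ext0_val f (t : Rpos R) : ext0 f (val t) = f t.
Proof. exact: (congr1 (fun h : Rpos R -> R[i] => h t) (valLK 0 f)). Qed.

Lemma Rpos_val (t : R) : 0 < t -> exists t' : Rpos R, val t' = t.
Proof.
move=> t0; have tP : t \in Rpos R by rewrite inE /Rpos /= in_itv /= andbT.
by exists (SigSub tP).
Qed.

Lemma ext0_log_profile g f (x : R) :
  ext0 f (expR x) = (expR ((g - 2^-1) * x))%:C * log_profile g f x.
Proof.
rewrite /log_profile mulrA -realcM -expRD -mulrDl.
by rewrite (_ : _ + _ = 0) ?mul0r ?expR0 ?mul1r//; ring.
Qed.

Lemma log_profile_inj g f1 f2 : log_profile g f1 =1 log_profile g f2 -> f1 = f2.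
Proof.
move=> E; apply/funext => t.
have t0 : 0 < val t.
  by have : Rpos R (val t) := set_valP t; rewrite /Rpos /= in_itv /= andbT.
by rewrite -!ext0_val -(lnK t0) !(ext0_log_profile g) E.
Qed.

Lemma log_profile_surj g (F : R -> R[i]) : exists f, log_profile g f = F.
Proof.
exists (fun t => (expR ((g - 2^-1) * ln (val t)))%:C * F (ln (val t))).
apply/funext => x; have [t tx] := Rpos_val (expR_gt0 x).
rewrite /log_profile -tx ext0_val tx expRK mulrA -realcM -expRD -mulrDl.
by rewrite (_ : _ + _ = 0) ?mul0r ?expR0 ?mul1r//; ring.
Qed.

Lemma wt_refl (r k : R) (z : R[i]) : wt r k (- z) = wt r k z.
Proof. by rewrite /wt cmodN cImN normrN. Qed.

Lemma wbounded_refl r k M Phi : wbounded r k M Phi ->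
  wbounded r k M (fun z => Phi (- z)).
Proof. by move=> H z; rewrite -(wt_refl r k z). Qed.

(** With lambda = exp(y) and t = exp(u - y) one has t lambda = exp(u) and t^(g - 1) dt = exp(g (u -
    y)) du. The factor exp(- g y) is cancelled by the target profile, whose exponent is
    [2^-1 - (2^-1 - g)]. [Phi] is evaluated at u - y, whence the reflection. *)
Lemma log_profile_laplace g r k M f Phi (y : R) : 0 < g -> entire Phi ->
  wbounded r k M Phi ->
  (forall x : R, Phi x%:C = log_profile (g - 2^-1) f x) ->
  log_profile (2^-1 - g) (laplace f) y = lgconv g (fun z => Phi (- z)) y%:C.
Proof.
move=> g0 eP HP PF.
rewrite /log_profile; have [l ly] := Rpos_val (expR_gt0 y).
rewrite -ly ext0_val /laplace ly.
pose q x := (expR (- (expR x * expR y)))%:C *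
  ((expR ((g - 2^-1 - 2^-1) * x))%:C * Phi x%:C).
have qc t : rcont q t.
  apply: rcontM; first apply: rcont_real.
    apply: continuous_comp; last exact: continuous_expR.
    apply: continuousN; apply: continuousM; first exact: continuous_expR.
    exact: cst_continuous.
  apply: rcontM; first apply: rcont_real.
    apply: continuous_comp; last exact: continuous_expR.
    by apply: continuousM; [exact: cst_continuous|].
  have [d fd] := (entireP Phi).1 eP (0 + 1 * t%:C).
  have := cder_line_rcont fd; congr (rcont _ _); apply/funext => s.
  by rewrite add0r mul1r.
have -> : cintegral (Rpos R) (fun t => (expR (- (t * expR y)))%:C * ext0 f t) =
    cintegral (Rpos R) (fun t => q (ln t)).
  apply: eq_cintegral => t; rewrite /Rpos /= in_itv /= andbT => t0.
  by rewrite /q lnK// PF -ext0_log_profile lnK.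
rewrite (cintegral_expR_substitution y qc).
have eP' := entire_refl eP; have HP' := wbounded_refl HP.
have -> : (fun u => (expR (u - y))%:C * q (u - y)) =
  (fun u => (expR (- g * y))%:C * ((log_gamma_kernel g u)%:C * Phi (- (y%:C - u%:C)))).
  apply/funext => u; rewrite /q opprB -realcN -realcD !mulrA -!realcM -!expRD.
  congr (_%:C * _); congr expR.
  by rewrite subrK; field.
rewrite cintegralZ//; last exact: (lgconv_integrable _ g0 (entire_ccont eP') HP').
rewrite mulrA -realcM -expRD (_ : _ + _ = 0) ?expR0 ?mul1r//.
by ring.
Qed.

End laplace_profile.

(** * Convergence in Z through the norm for k = 0 *)

Section convergence.
Variable R : realType.
Implicit Types (Phi : nat -> R[i] -> R[i]).

Definition square (rho : R) : set R[i]^o :=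
  [set z | `|complex.Re z| <= rho /\ `|complex.Im z| <= rho].

Lemma compact_square rho : compact (square rho).
Proof.
pose h (p : R * R) : R[i]^o := p.1 +i* p.2.
have hc : continuous h.
  move=> p; apply/cvgrPdist_le => e e0.
  have [er re] : exists er : R, e = er%:C.
    by exists (complex.Re e); rewrite RRe_real// gtr0_real.
  have er0 : 0 < er by rewrite -ltcR -re.
  have e2 : 0 < er / 2 by rewrite divr_gt0.
  exists (ball p.1 (er / 2), ball p.2 (er / 2)).
    by split; apply: nbhsx_ballx.
  move=> [x y] [/= bx by_]; rewrite normcE_cmod re lecR.
  apply: (le_trans (cmod_ReIm _)); rewrite /h /= [er]splitr.
  by apply: lerD; apply: ltW.
have -> : square rho = h @` (`[- rho, rho]%classic `*` `[- rho, rho]%classic).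
  apply/seteqP; split => [z [h1 h2]|_ [[x y] [/= h1 h2] <-]].
    exists (complex.Re z, complex.Im z) => /=; last by case: z {h1 h2}.
    by rewrite !in_itv /= -!ler_norml.
  by move: h1 h2; rewrite !in_itv /= -!ler_norml.
apply: continuous_compact; first by apply: continuous_subspaceT.
by apply: compact_setX; exact: segment_compact.
Qed.

Lemma compact_cmod_bounded (K : set R[i]^o) : compact K ->
  exists M, forall z, K z -> cmod z <= M.
Proof.
move=> cK.
have cc : continuous (fun z : R[i]^o => cmod z : R^o).
  move=> z; apply/(@cvgrPdist_le _ _ _ (nbhs z) (nbhs_filter z)) => e e0.
  have eC : (0 : R[i]) < e%:C by rewrite ltcR.
  apply/nbhs_ballP; exists e%:C => // w; rewrite -ball_normE /= normcE_cmod ltcR => zw.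
  rewrite ler_norml; have := lerB_cmod z w; have := lerB_cmod w z.
  rewrite (cmodBC w); lra.
have /compact_bounded [M [_ HM]] := continuous_compact (continuous_subspaceT cc) cK.
exists (M + 1) => z Kz; apply: le_trans (ler_norm _) _.
by apply: HM; [rewrite ltrDl|exists z].
Qed.

(** Real tolerances replace the entourages of [R[i]^o], whose radii are elements of [R[i]]. *)
Lemma uniform_cvg0P (K : set R[i]^o) (Phi : nat -> R[i]^o -> R[i]^o) :
  {uniform K, Phi @ \oo --> (cst 0 : R[i]^o -> R[i]^o)} <->
  forall e : R, 0 < e -> exists N, forall n, (N <= n)%N ->
    forall z, K z -> cmod (Phi n z) <= e.
Proof.
split => [H e e0|H P].
  have eC : (0 : R[i]) < e%:C by rewrite ltcR.
  have : nbhs (cst 0 : {uniform` K -> R[i]^o})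
      [set h | forall z, K z -> cmod (h z) <= e].
    apply/uniform_nbhs; exists [set xy | ball xy.1 (PosNum eC)%:num xy.2]; split.
      exact: entourage_ball.
    move=> h /= hK z /hK; rewrite -ball_normE /= sub0r normrN normcE_cmod ltcR.
    exact: ltW.
  by move=> /H [N _ HN]; exists N => n Nn; exact: HN.
move=> /uniform_nbhs [E [entE EP]].
have [e e0 eE] : exists2 e : R[i], 0 < e & [set xy | ball xy.1 e xy.2] `<=` E.
  by move: entE; rewrite -entourage_ballE => -[e e0 eE]; exists e.
have [er re] : exists er : R, e = er%:C.
  by exists (complex.Re e); rewrite RRe_real// gtr0_real.
have er0 : 0 < er by rewrite -ltcR -re.
have er2 : 0 < er / 2 by rewrite divr_gt0.
have [N HN] := H _ er2.
exists N => // n /= Nn; apply: EP => z Kz; apply: eE => /=.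
rewrite -ball_normE /= sub0r normrN normcE_cmod re ltcR.
by apply: (le_lt_trans (HN _ Nn _ Kz)); lra.
Qed.

(** Outside the square of half-side [C1 / e] the uniform bound for k = 1 is already below [e];
    inside it, convergence on compact sets takes over. Convergence in Z therefore gives smallness in
    a norm for which the operators are bounded. *)
Lemma wbounded_small r (C1 : R) Phi : 0 < r ->
  (forall n, wbounded r 1 C1 (Phi n)) ->
  (forall K : set R[i]^o, compact K ->
     {uniform K, (Phi : nat -> R[i]^o -> R[i]^o) @ \oo --> (cst 0 : R[i]^o -> R[i]^o)}) ->
  forall e : R, 0 < e -> exists N, forall n, (N <= n)%N -> wbounded r 0 e (Phi n).
Proof.
move=> r0 HC HK e e0.
have C0 := wbounded_ge0 (HC 0%N).
have /uniform_cvg0P/(_ _ e0)[N HN] := HK _ (@compact_square (C1 / e)).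
exists N => n Nn z; rewrite /wt oppr0 powRr0 mul1r.
have e1 : 1 <= expR (r * `|complex.Im z|).
  by rewrite -[leLHS]expR0 ler_expR mulr_ge0// ltW.
have [zs|zs] := pselect (square (C1 / e) z).
  by apply: (le_trans (HN _ Nn _ zs)); rewrite ler_peMr// ltW.
have z1 : C1 / e <= cmod z.
  rewrite leNgt; apply/negP => h; apply: zs; split; apply: ltW.
    exact: le_lt_trans (normRe_cmod _) h.
  exact: le_lt_trans (normIm_cmod _) h.
apply: (le_trans (HC n z)); rewrite /wt mulrA ler_wpM2r ?expR_ge0//.
have p0 : 0 < 1 + cmod z by rewrite ltr_pwDl// cmod_ge0.
rewrite powRN powRr1 ?(ltW p0)// ler_pdivrMr//.
by move: z1; rewrite ler_pdivrMr// mulrC => z1; rewrite mulrDr; lra.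
Qed.

Lemma small_uniform r Phi : 0 <= r ->
  (forall e : R, 0 < e -> exists N, forall n, (N <= n)%N -> wbounded r 0 e (Phi n)) ->
  forall K : set R[i]^o, compact K ->
    {uniform K, (Phi : nat -> R[i]^o -> R[i]^o) @ \oo --> (cst 0 : R[i]^o -> R[i]^o)}.
Proof.
move=> r0 H K /compact_cmod_bounded[M HM]; apply/uniform_cvg0P => e e0.
have [|N HN] := H (e / expR (r * M)); first by rewrite divr_gt0 ?expR_gt0.
exists N => n Nn z Kz; apply: (le_trans (HN _ Nn z)).
rewrite /wt oppr0 powRr0 mul1r mulrAC ler_pdivrMr ?expR_gt0// ler_pM2l//.
by rewrite ler_expR ler_wpM2l// (le_trans (normIm_cmod _))// HM.
Qed.

Lemma Z_boundsP r (C : R -> R) (Phi : R[i] -> R[i]) :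
  Z_bounds r C Phi <-> forall k, wbounded r k (C k) Phi.
Proof. by split => H k z; have := H k z; rewrite /wt mulrA. Qed.

End convergence.

(** * Bijectivity of the Laplace transform and continuity in both directions *)

Section laplace_isomorphism.
Variable R : realType.
Implicit Types (g r k M : R) (G H Phi : R[i] -> R[i]) (phi : R -> R[i]).

Lemma wbounded_type_mono r r' k M G : r <= r' -> wbounded r k M G -> wbounded r' k M G.
Proof.
move=> rr HG z; apply: (le_trans (HG z)).
rewrite ler_wpM2l ?(wbounded_ge0 HG)// /wt ler_wpM2l ?powR_ge0//.
by rewrite ler_expR ler_wpM2r.
Qed.

(** The Schwartz condition is recovered from the bounds through Cauchy's estimates. *)
Lemma ZspaceP phi : Zspace phi <-> exists Phi r (C : R -> R),
  [/\ entire Phi, 0 < r, forall x : R, Phi x%:C = phi x &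
      forall k, wbounded r k (C k) Phi].
Proof.
split=> [[_ [Phi [[eP HP] [r [C [r0 /Z_boundsP HC]]]]]]|[Phi [r [C [eP r0 HP HC]]]]].
  by exists Phi, r, C.
split; last by exists Phi; split => //; exists r, C; split => //; exact/Z_boundsP.
have -> : phi = fun x => Phi x%:C by apply/funext => x; rewrite HP.
exact: schwartz_entire (ltW r0) eP HC.
Qed.

Lemma lgconvB s r k M N G H z : 0 < s -> ccont G -> wbounded r k M G ->
  ccont H -> wbounded r k N H ->
  lgconv s (fun w => G w - H w) z = lgconv s G z - lgconv s H z.
Proof.
move=> s0 Gc HG Hc HH; rewrite /lgconv -cintegralB//;
  try exact: lgconv_integrable.
by apply: eq_cintegral => u _; rewrite mulrBr.
Qed.

Lemma eq_lgconv_real s G H (y : R) : (forall x : R, G x%:C = H x%:C) ->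
  lgconv s G y%:C = lgconv s H y%:C.
Proof.
by move=> GH; apply: eq_cintegral => u _; rewrite -realcN -realcD GH.
Qed.

Lemma lgconv_injective g r M H : 0 < g -> 0 <= r -> entire H -> wbounded r 0 M H ->
  (forall t : R, lgconv g H t%:C = 0) -> forall t : R, H t%:C = 0.
Proof.
move=> g0 r0 eH HH H0; apply: (nconv_injective g0 r0 eH HH) => t.
by rewrite /nconv -realcD H0 mulr0.
Qed.

Definition lgconv_inv_const g r k : R :=
  cmod (gamma_int g)^-1%:C * (euler_const g r k * wt_growth r k (cmod (ln g)%:C)).

(** The translation by [ln g] and the normalisation by [gamma_int g] that [nconv] adds are
    undone. *)
Lemma lgconv_surjective g r M G : 0 < g -> 0 <= r -> entire G -> wbounded r 0 M G ->
  exists H, [/\ entire H,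
    forall k N, wbounded r k N G -> wbounded r k (lgconv_inv_const g r k * N) H &
    lgconv g H = G].
Proof.
move=> g0 r0 eG HG.
have eG' := @entire_shift R G (ln g)%:C eG.
have HG' := @wbounded_shift R r 0 M (ln g)%:C G r0 HG.
have [H [eH HH EH]] := nconv_surjective g0 r0 eG' HG'.
exists (fun z => (gamma_int g)^-1%:C * H z); split; first exact: entireZ.
  move=> k N HN; rewrite /lgconv_inv_const -2!mulrA; apply: wboundedZ.
  by apply: HH; exact: wbounded_shift.
apply/funext => z; rewrite (lgconvZ _ _ g0 (entire_ccont eH) (HH _ _ HG')).
have := congr1 (fun F => F (z - (ln g)%:C)) EH.
by rewrite /nconv subrK.
Qed.

Lemma laplace_continuation g f : 0 < g -> Zgamma (g - 2^-1) f ->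
  exists Phi r (C : R -> R), [/\ entire Phi, 0 < r,
    forall x : R, Phi x%:C = log_profile (g - 2^-1) f x,
    forall k, wbounded r k (C k) Phi &
    forall y : R, lgconv g (fun z => Phi (- z)) y%:C =
      log_profile (2^-1 - g) (laplace f) y].
Proof.
move=> g0 /ZspaceP[Phi [r [C [eP r0 PF HC]]]]; exists Phi, r, C; split => // y.
by rewrite (log_profile_laplace _ g0 eP (HC 0) PF).
Qed.

(** Injectivity and convergence are both about differences of profiles. The two functions may have
    different types, so the larger is taken; the bound for k = 0 is what [lgconv_injective] asks
    for. *)
Lemma laplace_difference g f1 f2 : 0 < g -> Zgamma (g - 2^-1) f1 ->
  Zgamma (g - 2^-1) f2 ->
  exists D r M, [/\ entire D, 0 < r, wbounded r 0 M D,
    forall x : R, D x%:C = log_profile (g - 2^-1) f1 x - log_profile (g - 2^-1) f2 x &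
    forall y : R, lgconv g (fun z => D (- z)) y%:C =
      log_profile (2^-1 - g) (laplace f1) y - log_profile (2^-1 - g) (laplace f2) y].
Proof.
move=> g0 /(laplace_continuation g0)[P1 [r1 [C1 [e1 r10 E1 B1 L1]]]].
move=> /(laplace_continuation g0)[P2 [r2 [C2 [e2 r20 E2 B2 L2]]]].
pose r := Num.max r1 r2.
have B1' : wbounded r 0 (C1 0) P1.
  by apply: wbounded_type_mono (B1 0); rewrite le_max lexx.
have B2' : wbounded r 0 (C2 0) P2.
  by apply: wbounded_type_mono (B2 0); rewrite le_max lexx orbT.
exists (fun z => P1 z - P2 z), r, (C1 0 + C2 0); split.
- exact: entireB.
- by rewrite lt_max r10.
- exact: wboundedB.
- by move=> x; rewrite E1 E2.
- move=> y; rewrite -L1 -L2.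
  exact: (lgconvB _ g0 (entire_ccont (entire_refl e1)) (wbounded_refl B1')
    (entire_ccont (entire_refl e2)) (wbounded_refl B2')).
Qed.

Lemma laplace_Zgamma g f : 0 < g -> Zgamma (g - 2^-1) f -> Zgamma (2^-1 - g) (laplace f).
Proof.
move=> g0 /(laplace_continuation g0)[Phi [r [C [eP r0 PF HC L]]]].
have eP' := entire_refl eP.
have HC' k : wbounded r k (C k) (fun z => Phi (- z)) := wbounded_refl (HC k).
apply/ZspaceP; exists (lgconv g (fun z => Phi (- z))), r,
  (fun k => 2 * kernel_moment g `|k| * C k); split.
- exact: entire_lgconv g0 (ltW r0) eP' (HC' 0).
- exact: r0.
- exact: L.
- by move=> k; exact: (wbounded_lgconv g0 (entire_ccont eP') (HC' k)).
Qed.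

Lemma laplace_inj g f1 f2 : 0 < g -> Zgamma (g - 2^-1) f1 -> Zgamma (g - 2^-1) f2 ->
  laplace f1 = laplace f2 -> f1 = f2.
Proof.
move=> g0 Z1 Z2 E; have [D [r [M [eD r0 HD DE DL]]]] := laplace_difference g0 Z1 Z2.
apply: (@log_profile_inj _ (g - 2^-1)) => x; apply/eqP; rewrite -subr_eq0 -DE.
(* The convolution acts on the reflected continuation, so the value at [x] is read at [- x]. *)
have := lgconv_injective g0 (ltW r0) (entire_refl eD) (wbounded_refl HD) _ (- x).
rewrite realcN opprK => -> // t.
by rewrite DL E subrr.
Qed.

Lemma laplace_surj g h : 0 < g -> Zgamma (2^-1 - g) h ->
  exists2 f, Zgamma (g - 2^-1) f & laplace f = h.
Proof.
move=> g0 /ZspaceP[G [r [C [eG r0 GE GC]]]].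
have [H [eH HH HG]] := lgconv_surjective g0 (ltW r0) eG (GC 0).
have [f fE] := log_profile_surj (g - 2^-1) (fun x : R => H (- x%:C)).
have eH' := entire_refl eH; have HH' k := wbounded_refl (HH _ _ (GC k)).
exists f.
  apply/ZspaceP; exists (fun z => H (- z)), r, (fun k => lgconv_inv_const g r k * C k).
  by split; [exact: eH'|exact: r0|move=> x; rewrite fE|exact: HH'].
apply: (@log_profile_inj _ (2^-1 - g)) => y.
rewrite (log_profile_laplace y g0 eH' (HH' 0)); last by move=> x; rewrite fE.
rewrite -GE -[in RHS]HG; congr (lgconv g _ _).
by apply/funext => z; rewrite opprK.
Qed.

Lemma laplace_seq_continuous g : 0 < g ->
  seq_continuous_on (Zgamma (g - 2^-1)) (Zgamma_cvg (g - 2^-1))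
    (Zgamma_cvg (2^-1 - g)) (@laplace R).
Proof.
move=> g0 f_ f Zf_ Zf [Phi [r [C [r0 HP HC HK]]]].
have eP' n : entire (fun z => Phi n (- z)) := entire_refl (HP n).1.
have HC' n k : wbounded r k (C k) (fun z => Phi n (- z)) :=
  wbounded_refl ((Z_boundsP r C (Phi n)).1 (HC n) k).
exists (fun n => lgconv g (fun z => Phi n (- z))), r,
  (fun k => 2 * kernel_moment g `|k| * C k); split; first exact: r0.
- move=> n; split; first exact: entire_lgconv g0 (ltW r0) (eP' n) (HC' n 0).
  (* The given [Phi n] and the difference [D] are known to agree on the real line, and these values
     determine the convolution at the real point [y]. *)
  move=> y; have [D [_ [_ [_ _ _ DE DL]]]] := laplace_difference g0 (Zf_ n) Zf.
  rewrite -DL; apply: eq_lgconv_real => x; have [_ PE] := HP n.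
  by rewrite -realcN DE PE.
- move=> n; apply/Z_boundsP => k.
  exact: (wbounded_lgconv g0 (entire_ccont (eP' n)) (HC' n k)).
- apply: small_uniform (ltW r0) _ => e e0.
  have S := wbounded_small r0 (fun n => (Z_boundsP r C (Phi n)).1 (HC n) 1) HK.
  have m0 : 0 < 2 * kernel_moment g `|0 : R| + 1.
    apply: ltr_wpDl => //; apply: mulr_ge0 => //; exact: kernel_moment_ge0.
  have [|N HN] := S (e / (2 * kernel_moment g `|0 : R| + 1)); first by rewrite divr_gt0.
  exists N => n Nn; have Hn := wbounded_refl (HN n Nn).
  apply: wboundedW (wbounded_lgconv g0 (entire_ccont (eP' n)) Hn).
  by rewrite mulrA ler_pdivrMr// mulrC ler_pM2l// lerDl.
Qed.

(** The convolution equation is solved for each [Phi n], with constants that depend on [g], [r] and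
    [k] and so are uniform in [n]. Injectivity on the real line, in a common type, identifies the
    reflected solutions with the profile of [L (h_ n)] minus that of [L h]. *)
Lemma laplace_inv_seq_continuous g (L : (Rpos R -> R[i]) -> (Rpos R -> R[i])) : 0 < g ->
  (forall h, Zgamma (2^-1 - g) h -> Zgamma (g - 2^-1) (L h) /\ laplace (L h) = h) ->
  seq_continuous_on (Zgamma (2^-1 - g)) (Zgamma_cvg (2^-1 - g))
    (Zgamma_cvg (g - 2^-1)) L.
Proof.
move=> g0 HL h_ h Zh_ Zh [Phi [r [C [r0 HP HC HK]]]].
have HC' n k : wbounded r k (C k) (Phi n) by have /Z_boundsP := HC n; apply.
have eP n : entire (Phi n) by have [] := HP n.
have /choice[H HH] n := lgconv_surjective g0 (ltW r0) (eP n) (HC' n 0).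
exists (fun n z => H n (- z)), r, (fun k => lgconv_inv_const g r k * C k);
  split; first exact: r0.
- move=> n; have [eH HB HE] := HH n; split; first exact: (entire_refl eH).
  have [Zf_ Lf_] := HL _ (Zh_ n); have [Zf Lf] := HL _ Zh.
  have [D [r' [M [eD r'0 HD DE DL]]]] := laplace_difference g0 Zf_ Zf.
  pose r2 := Num.max r r'.
  have r20 : 0 <= r2 by rewrite le_max (ltW r0).
  have B1 : wbounded r2 0 M (fun z => D (- z)).
    by apply: wbounded_type_mono (wbounded_refl HD); rewrite le_max lexx orbT.
  have B2 : wbounded r2 0 (lgconv_inv_const g r 0 * C 0) (H n).
    by apply: wbounded_type_mono (HB _ _ (HC' n 0)); rewrite le_max lexx.
  have eD' := entire_refl eD.
  have Z t : D (- t%:C) - H n t%:C = 0.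
    apply: (lgconv_injective g0 r20 (entireB eD' eH) (wboundedB B1 B2)) => {}t.
    rewrite (lgconvB _ g0 (entire_ccont eD') B1 (entire_ccont eH) B2) DL HE.
    by have [_ ->] := HP n; rewrite Lf_ Lf subrr.
  move=> x; rewrite -DE; have /eqP := Z (- x).
  by rewrite subr_eq0 realcN opprK => /eqP ->.
- move=> n; apply/Z_boundsP => k; have [_ HB _] := HH n.
  exact: wbounded_refl (HB _ _ (HC' n k)).
- apply: small_uniform (ltW r0) _ => e e0.
  have S := wbounded_small r0 (fun n => HC' n 1) HK.
  have c0 : 0 <= lgconv_inv_const g r 0.
    apply: mulr_ge0; first exact: cmod_ge0.
    by apply: mulr_ge0; [exact: expR_ge0|exact: wt_growth_ge0].
  have m0 : 0 < lgconv_inv_const g r 0 + 1 by rewrite ltr_wpDl.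
  have [|N HN] := S (e / (lgconv_inv_const g r 0 + 1)); first by rewrite divr_gt0.
  exists N => n Nn; have [_ HB _] := HH n.
  apply: wboundedW (wbounded_refl (HB _ _ (HN n Nn))).
  by rewrite mulrA ler_pdivrMr// mulrC ler_pM2l// lerDl.
Qed.

End laplace_isomorphism.

Theorem corollary4p10 (R : realType) (gamma : R) (hgamma : 0 < gamma) :
  isomorphism (Zgamma (gamma - 2^-1)) (Zgamma (2^-1 - gamma))
    (Zgamma_cvg (gamma - 2^-1)) (Zgamma_cvg (2^-1 - gamma))
    (@laplace R).
Proof.
have inv h : exists f, Zgamma (2^-1 - gamma) h ->
    Zgamma (gamma - 2^-1) f /\ laplace f = h.
  have [Zh|nZh] := pselect (Zgamma (2^-1 - gamma) h).
    by have [f Zf Lf] := laplace_surj hgamma Zh; exists f.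
  (* Outside the target space the value is arbitrary; it makes the inverse a total function, as
     [choice] requires. *)
  by exists h.
have [L HL] := choice inv.
split; first split.
- by move=> f; exact: laplace_Zgamma.
- move=> f1 f2; rewrite !inE => Z1 Z2; exact: laplace_inj Z1 Z2.
- by move=> h Zh; have [f Zf Lf] := laplace_surj hgamma Zh; exists f.
- exact: laplace_seq_continuous.
exists L; split.
- by move=> h /HL[].
- move=> f; rewrite inE => Zf; have [Z1 L1] := HL _ (laplace_Zgamma hgamma Zf).
  exact: laplace_inj Z1 Zf L1.
- by move=> h; rewrite inE => /HL[].
- exact: laplace_inv_seq_continuous.
Qed.
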